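(* Let $X$, $Y$ be metric spaces with $Y$ complete and $E$ a Banach lattice. Suppose that $T : X \to E$ is Lipschitz $p$-convex and $S : E \to Y$ is Lipschitz $p$-concave. Then the map $ST$ can be factored through an $L_p(\mu)$ space. Moreover, we may arrange to have $ST = S_1T_1$ with $T_1 : X \to L_p(\mu)$, $S_1 : L_p(\mu)\to Y$, $\mathrm{Lip}(T_1) \le M^{(p)}_{\mathrm{Lip}}(T)$ and $\mathrm{Lip}(S_1) \le M^{\mathrm{Lip}}_{(p)}(S)$.
   Context: Here $1\le p\le\infty$, $\mu$ is a suitable measure, and $\mathrm{Lip}(\cdot)$ denotes the Lipschitz constant. Banach lattices are real; expressions $(\sum_j |v_j|^p)^{1/p}$ in a Banach lattice are defined by the Krivine functional calculus. A Lipschitz map $T : X\to E$ from a metric space $(X,d)$ to a Banach lattice $E$ is Lipschitz $p$-convex if there is a constant $C\ge 0$ such that for all $n$, all $x_j,x_j'\in X$ and $\lambda_j\ge 0$ ($1\le j\le n$), $\big\|(\sum_{j=1}^n \lambda_j|Tx_j-Tx_j'|^p)^{1/p}\big\|_E \le C(\sum_{j=1}^n \lambda_j d(x_j,x_j')^p)^{1/p}$, with the obvious adjustment if $p=\infty$, namely $\big\|\bigvee_{j=1}^n \lambda_j|Tx_j-Tx_j'|\big\|_E\le C\max_j \lambda_j d(x_j,x_j')$. The smallest such $C$ is $M^{(p)}_{\mathrm{Lip}}(T)$. A map $S : E\to Y$ from a Banach lattice $E$ to a metric space $(Y,d)$ is Lipschitz $p$-concave if there is a constant $C\ge 0$ such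 that for all $n$, all $v_j,v_j'\in E$ and $\lambda_j\ge 0$ ($1\le j\le n$), $(\sum_{j=1}^n \lambda_j d(Sv_j,Sv_j')^p)^{1/p}\le C\big\|(\sum_{j=1}^n \lambda_j|v_j-v_j'|^p)^{1/p}\big\|_E$, with the analogous adjustment if $p=\infty$, namely $\max_j \lambda_j d(Sv_j,Sv_j')\le C\big\|\bigvee_{j=1}^n\lambda_j|v_j-v_j'|\big\|_E$. The smallest such $C$ is $M^{\mathrm{Lip}}_{(p)}(S)$.
   Formalization: For p = ∞ the claim is false as stated (identity of c_0), so there the map S_1 is defined and Lipschitz only on a closed vector sublattice of some L_∞(μ) containing the range of T_1; for p < ∞ it is on all of L_p(μ), as stated. *)

(* Defs.v *)
From HB Require Import structures.
From mathcomp Require Import all_boot all_order all_algebra.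
From mathcomp Require Import all_classical all_reals all_analysis.
From mathcomp Require Import measurable_realfun.

Set Implicit Arguments.
Unset Strict Implicit.
Unset Printing Implicit Defensive.

Import Order.TTheory GRing.Theory Num.Theory.
Import numFieldNormedType.Exports.

Local Open Scope classical_set_scope.
Local Open Scope ring_scope.

(* [Complete] carries a base point; a space that receives a map from a Banach
   lattice is nonempty, so nothing is lost. *)
#[short(type="completeMetricType")]
HB.structure Definition CompleteMetric (K : numDomainType) :=
  {T of Metric K T & Complete T}.

Section Lipschitz.
Context {R : realType} {U V : metricType R}.
Implicit Types (A : set U) (f : U -> V).

Definition lip_bounds A f : set R :=
  [set k | 0 <= k /\
     forall x y, A x -> A y -> mdist (f x) (f y) <= k * mdist x y].

Definition is_lipschitz_on A f := lip_bounds A f !=set0.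

(* Meaningful when [is_lipschitz_on A f]: [inf set0 = 0]. *)
Definition Lip_on A f : R := inf (lip_bounds A f).

End Lipschitz.

(* The order and the lattice operations are carried by the structure itself:
   [CompleteNormedModule] and [Order.Lattice] have no declared join. *)
HB.mixin Record isBanachLattice (R : realType) E
    & CompleteNormedModule R E := {
  lat_le : rel E ;
  lat_join : E -> E -> E ;
  lat_meet : E -> E -> E ;
  lat_le_refl : reflexive lat_le ;
  lat_le_anti : antisymmetric lat_le ;
  lat_le_trans : transitive lat_le ;
  lat_joinP : forall x y z,
    lat_le (lat_join x y) z = lat_le x z && lat_le y z ;
  lat_meetP : forall x y z,
    lat_le z (lat_meet x y) = lat_le z x && lat_le z y ;
  lat_leD2r : forall z x y, lat_le x y -> lat_le (x + z) (y + z) ;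
  lat_scale_ge0 : forall (a : R) x, 0 <= a -> lat_le 0 x -> lat_le 0 (a *: x) ;
  lat_norm_le : forall x y,
    lat_le (lat_join x (- x)) (lat_join y (- y)) -> `|x| <= `|y|
}.

#[short(type="banachLatticeType")]
HB.structure Definition BanachLattice (R : realType) :=
  {E of CompleteNormedModule R E & isBanachLattice R E}.

Definition lat_abs {R : realType} {E : banachLatticeType R} (x : E) : E :=
  lat_join x (- x).

Section Krivine.
Context {R : realType} {E : banachLatticeType R} {n : nat}.
Implicit Types (f g : 'rV[R]_n -> R) (v : 'I_n -> E).

Definition homogeneous_functions : set ('rV[R]_n -> R) :=
  [set f : 'rV[R]_n -> R | continuous f /\
     forall (a : R) (t : 'rV[R]_n), 0 <= a -> f (a *: t) = a * f t].

Local Notation H := homogeneous_functions.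

(* [tau] is a vector lattice homomorphism from [H] to [E] sending the j-th
   coordinate function to [v j]; its values outside [H] are irrelevant. *)
Definition krivine_hom v (tau : ('rV[R]_n -> R) -> E) : Prop :=
  [/\ forall j, tau (fun t => t 0 j) = v j,
      forall (a : R) f g, H f -> H g ->
        tau (fun t => a * f t + g t) = a *: tau f + tau g,
      forall f g, H f -> H g ->
        tau (fun t => Num.max (f t) (g t)) = lat_join (tau f) (tau g) &
      forall f g, H f -> H g ->
        tau (fun t => Num.min (f t) (g t)) = lat_meet (tau f) (tau g)].

(* By Krivine's theorem a [krivine_hom v] exists and is unique on [H], so for
   [f] in [H] the default value 0 is never used. *)
Definition krivine v f : E :=
  xget 0 [set w | exists2 tau, krivine_hom v tau & tau f = w].

End Krivine.

Section Convexity.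
Context {R : realType}.
Implicit Types (p : \bar R).

(* The value at [-oo] is junk: only [1 <= p] is used. *)
Definition psum p n (lam : 'I_n -> R) (a : 'I_n -> R) : R :=
  match p with
  | r%:E => (\sum_(j < n) lam j * `|a j| `^ r) `^ r^-1
  | +oo%E => \big[Num.max/0]_(j < n) (lam j * `|a j|)
  | -oo%E => 0
  end.

(* For [p = +oo] all the joined elements are >= 0, which justifies the
   neutral element 0. *)
Definition lat_psum (E : banachLatticeType R) p n
    (lam : 'I_n -> R) (v : 'I_n -> E) : E :=
  match p with
  | r%:E => krivine v (fun t => psum r%:E lam (fun j => t 0 j))
  | +oo%E => \big[lat_join/0]_(j < n) (lam j *: lat_abs (v j))
  | -oo%E => 0
  end.

Definition convexity_bounds p (X : metricType R) (E : banachLatticeType R)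
    (T : X -> E) : set R :=
  [set C | 0 <= C /\
     forall n (x x' : 'I_n -> X) (lam : 'I_n -> R), (forall j, 0 <= lam j) ->
       `|lat_psum p lam (fun j => T (x j) - T (x' j))|
         <= C * psum p lam (fun j => mdist (x j) (x' j))].

Definition lipschitz_p_convex p (X : metricType R) (E : banachLatticeType R)
    (T : X -> E) : Prop :=
  (exists k : R, forall x y, `|T x - T y| <= k * mdist x y) /\
  convexity_bounds p T !=set0.

Definition convexity_constant p (X : metricType R) (E : banachLatticeType R)
    (T : X -> E) : R := inf (convexity_bounds p T).

Definition concavity_bounds p (E : banachLatticeType R) (Y : metricType R)
    (S : E -> Y) : set R :=
  [set C | 0 <= C /\
     forall n (v v' : 'I_n -> E) (lam : 'I_n -> R), (forall j, 0 <= lam j) ->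
       psum p lam (fun j => mdist (S (v j)) (S (v' j)))
         <= C * `|lat_psum p lam (fun j => v j - v' j)|].

Definition lipschitz_p_concave p (E : banachLatticeType R) (Y : metricType R)
    (S : E -> Y) : Prop := concavity_bounds p S !=set0.

Definition concavity_constant p (E : banachLatticeType R) (Y : metricType R)
    (S : E -> Y) : R := inf (concavity_bounds p S).

End Convexity.

Section LpMetric.
Context d (Om : measurableType d) (R : realType).
Variables (mu : {measure set Om -> \bar R}) (p : \bar R) (p1 : (1 <= p)%E).
Local Notation Lp := (LspaceType mu p1).
Implicit Types f g h : Lp.

HB.instance Definition _ := gen_eqMixin Lp.
HB.instance Definition _ := gen_choiceMixin Lp.

Definition Lp_fun f : Om -> R := repr (f : {mfun_ mu, Om >-> measurableTypeR R}).

Definition Lp_dist f g : R := fine ('N[mu]_p [EFin \o (Lp_fun f \- Lp_fun g)%R])%E.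

Let mfunLp f : measurable_fun [set: Om] (Lp_fun f).
Proof. exact: (@measurable_funPT _ _ _ _ (repr (f : aeEqMfun _ mu))). Qed.

Let Lp_fun_finite f : finite_norm mu p (Lp_fun f).
Proof. by case: f => f [[]]. Qed.

Let Lp_fin_num f g :
  ('N[mu]_p [EFin \o (Lp_fun f \- Lp_fun g)%R] \is a fin_num)%E.
Proof.
rewrite ge0_fin_numE ?Lnorm_ge0//.
apply: (@le_lt_trans _ _
  ('N[mu]_p [EFin \o Lp_fun f] + 'N[mu]_p [EFin \o (\- Lp_fun g)%R])%E).
  by apply: eminkowski => //; exact: measurableT_comp.
apply: lte_add_pinfty; first exact: Lp_fun_finite.
by have -> := oppe_Lnorm mu (EFin \o Lp_fun g) p; exact: Lp_fun_finite.
Qed.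

Let Lp_distxx f : Lp_dist f f = 0.
Proof.
rewrite /Lp_dist (_ : _ \o _ = cst 0%E); last first.
  by apply/funext => x /=; rewrite subrr.
by rewrite Lnorm0// gt_eqF// (lt_le_trans _ p1).
Qed.

Let Lp_dist_positivity f g : Lp_dist f g = 0 -> f = g.
Proof.
move=> fg0.
have : 'N[mu]_p [EFin \o (Lp_fun f \- Lp_fun g)%R]%E = 0%E.
  by rewrite -(fineK (Lp_fin_num f g)); congr EFin.
have mfg : measurable_fun [set: Om]
      (EFin \o (Lp_fun f \- Lp_fun g)%R : Om -> \bar R).
  by apply: measurableT_comp => //; exact: measurable_funB.
move/(Lnorm_eq0_eq0 mfg (lt_le_trans lte01 p1)) => fg_ae0.
have {mfg fg_ae0}fg_ae : Lp_fun f = Lp_fun g %[ae mu].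
  apply: filterS fg_ae0 => x /= /(_ I) [] /eqP.
  by rewrite subr_eq0 => /eqP.
move: (mfunLp f) fg_ae; case: f g {fg0} => f [[cf]] [g [[cg]]] _ fg_ae.
have fg : f = g.
  rewrite -[f]reprK -[g]reprK; apply/eqmodP.
  exact/asboolP.
by subst g; rewrite (Prop_irrelevance cf cg).
Qed.

Let Lp_dist_sym f g : Lp_dist f g = Lp_dist g f.
Proof.
rewrite /Lp_dist -oppe_Lnorm; congr (fine (Lnorm _ _ _)).
by apply/funext => x /=; rewrite opprB.
Qed.

Let Lp_dist_triangle g f h : Lp_dist f h <= Lp_dist f g + Lp_dist g h.
Proof.
rewrite /Lp_dist -fineD// fine_le ?fin_numD ?Lp_fin_num//.
rewrite [X in Lnorm _ _ (EFin \o X)](_ : _ = ((Lp_fun f \- Lp_fun g) \+ (Lp_fun g \- Lp_fun h))).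
  by apply: eminkowski => //; exact: measurable_funB.
by apply/funext => x /=; rewrite addrA subrK.
Qed.

HB.instance Definition _ := isMetric.Build R Lp
  Lp_distxx Lp_dist_positivity Lp_dist_sym Lp_dist_triangle.

End LpMetric.

(* A closed vector sublattice of L_p(mu), with the operations of L_p(mu)
   computed almost everywhere on representatives.  For p < +oo the factorization
   theorem is stated with Z the whole of L_p(mu).  For p = +oo this would be
   false: the identity of c_0 has both constants equal to 1, while the balls
   B(2 e_n, 1) of c_0 meet pairwise and have no common point, which prevents it
   from factoring through some L_oo(mu) with two 1-Lipschitz maps.  There
   L_oo(mu) space has to be read as an M-space, that is, a closed sublattice of
   some L_oo(mu). *)
Definition closed_sublattice d (Om : measurableType d) (R : realType)
    (mu : {measure set Om -> \bar R}) (p : \bar R) (p1 : (1 <= p)%E)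
    (Z : set (LspaceType mu p1)) : Prop :=
  [/\ closed Z,
      Z !=set0,
      forall (a : R) f g h, Z f -> Z g ->
        Lp_fun h = (fun t => a * Lp_fun f t + Lp_fun g t) %[ae mu] -> Z h &
      forall f g h, Z f -> Z g ->
        Lp_fun h = (fun t => Num.max (Lp_fun f t) (Lp_fun g t)) %[ae mu] ->
        Z h].

(* Main.v *)
(** Let [p = r] be finite and write [u (+) v = (u^r + v^r)^(1/r)] for [u, v >= 0].
    Convexity and concavity together say that
    [sum_j l'_j (d(S v_j, S v'_j) / K2)^r <= sum_i l_i (K1 d(x_i, x'_i))^r] as soon
    as [(sum_j l'_j |v_j - v'_j|^r)^(1/r)] is below
    [(sum_i l_i |T x_i - T x'_i|^r)^(1/r)].  A Hahn-Banach sandwich argument gives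
    [N >= 0], defined on the positive part of the ideal [I] generated by the
    [T x - T x'], with [N (u (+) v) = N u + N v], [N (c u) = c^r N u],
    [N |T x - T x'| <= (K1 d(x, x'))^r] and
    [(d(S v, S v') / K2)^r <= N |v - v'|].

    The functional [N^(1/r)] is an abstract L_r-seminorm, which is represented
    concretely.  Well-order the generators [e_x] of [I]; then [N u] is the sum of
    the contributions [Psi_x] of the principal bands met in that order.  On the
    ideal of [e_x] the lattice homomorphisms [phi] with [phi e_x = 1] determine
    the order, and a Dini argument shows that [Psi_x] is a Daniell integral of
    [phi |-> phi(u)^r].  On the disjoint union of these spectra one obtains a map
    [J : I -> L_r] with dense range such that [|J u - J v|^r] has integral
    [N |u - v|]; [T1] is [J o T] up to a translation, and [S] extends from the
    range of [J] by completeness of [Y].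

    For [p = +oo] the gauge of the finite joins of the [l |T x - T x'|] with
    [l d(x, x') <= 1] is attained on the lattice homomorphisms that it dominates,
    which embeds [I] as a sublattice of a space of bounded functions. *)

From HB Require Import structures.
Require Import Defs.
From mathcomp Require Import all_boot all_order all_algebra.
From mathcomp Require Import all_classical all_reals all_analysis.
From mathcomp Require Import measurable_realfun lra ring.
From mathcomp Require wochoice.

Set Implicit Arguments.
Unset Strict Implicit.
Unset Printing Implicit Defensive.

Import Order.TTheory GRing.Theory Num.Theory.
Import numFieldNormedType.Exports.

Local Open Scope classical_set_scope.
Local Open Scope ring_scope.

(** Neither map is linear, so only differences of values enter, and the weights in the two
    definitions are what turns the hypotheses into statements about a convex cone, to which
    Hahn-Banach applies. The obstacle is that [I] has in general no order unit and may carry no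
    nonzero real lattice homomorphism at all: for [p = 1] and [T] the identity of [L_1] of an
    atomless measure, [I] is all of [L_1]. So no spectrum of the whole of [I] can serve. A principal
    ideal has a unit, and on it a Hahn-Banach argument for maxitive functionals replaces the
    compactness of the spectrum. The price is threefold: an element is seen on a piece only through
    its truncations at multiples of the unit; there may be uncountably many pieces, so that the
    measure need not be sigma-finite; and a representing function is computed along a countable list
    of pieces, two suitable lists giving the same function only almost everywhere. All formulas are
    therefore established at almost every point, on a list common to the elements involved. *)

Ltac max_lra := repeat match goal with
 | |- context [Order.max ?a ?b] =>
     lazymatch a with context [Order.max _ _] => fail | context [Order.min _ _] => fail | _ =>
     lazymatch b with context [Order.max _ _] => fail | context [Order.min _ _] => fail | _ =>
     case: (leP a b) => ? end end
 | |- context [Order.min ?a ?b] =>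
     lazymatch a with context [Order.max _ _] => fail | context [Order.min _ _] => fail | _ =>
     lazymatch b with context [Order.max _ _] => fail | context [Order.min _ _] => fail | _ =>
     case: (leP a b) => ? end end
 end; lra.

(** * Calculus in Riesz spaces *)

Section RieszSpace.
Context {R : realType} {E : banachLatticeType R}.
Implicit Types (u v w x y z e g : E) (a b c : R).

Lemma lat_trans y x z : lat_le x y -> lat_le y z -> lat_le x z.
Proof. exact: lat_le_trans. Qed.

Lemma lat_le_add u v w z : lat_le u v -> lat_le w z -> lat_le (u + w) (v + z).
Proof.
move=> uv wz; apply: (lat_trans (y := v + w)); first exact: lat_leD2r.
by rewrite ![v + _]addrC; exact: lat_leD2r.
Qed.

Lemma lat_subr_ge0 u v : lat_le 0 (v - u) = lat_le u v.
Proof.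
by apply/idP/idP => [/(lat_leD2r u)|/(lat_leD2r (- u))];
  rewrite ?add0r ?subrK ?subrr.
Qed.

Lemma lat_le_scale a u v : 0 <= a -> lat_le u v -> lat_le (a *: u) (a *: v).
Proof.
move=> a0 uv; rewrite -lat_subr_ge0 -scalerBr; apply: lat_scale_ge0 => //.
by rewrite lat_subr_ge0.
Qed.

Lemma lat_le_opp u v : lat_le (- u) (- v) = lat_le v u.
Proof. by rewrite -lat_subr_ge0 opprK addrC lat_subr_ge0. Qed.

Lemma lat_joinl u v : lat_le u (lat_join u v).
Proof. by have := lat_le_refl (lat_join u v); rewrite lat_joinP => /andP[]. Qed.

Lemma lat_joinr u v : lat_le v (lat_join u v).
Proof. by have := lat_le_refl (lat_join u v); rewrite lat_joinP => /andP[]. Qed.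

Lemma lat_meetl u v : lat_le (lat_meet u v) u.
Proof. by have := lat_le_refl (lat_meet u v); rewrite lat_meetP => /andP[]. Qed.

Lemma lat_meetr u v : lat_le (lat_meet u v) v.
Proof. by have := lat_le_refl (lat_meet u v); rewrite lat_meetP => /andP[]. Qed.

Lemma lat_eq u v : lat_le u v -> lat_le v u -> u = v.
Proof. by move=> uv vu; apply: lat_le_anti; rewrite uv. Qed.

Lemma lat_joinDr u v w : lat_join u v + w = lat_join (u + w) (v + w).
Proof.
apply: lat_eq; last first.
  by rewrite lat_joinP !lat_leD2r ?lat_joinl ?lat_joinr.
have -> : lat_join (u + w) (v + w) = lat_join (u + w) (v + w) - w + w.
  by rewrite subrK.
apply: lat_leD2r; rewrite lat_joinP.
have := lat_joinl (u + w) (v + w); have := lat_joinr (u + w) (v + w).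
by move=> /(lat_leD2r (- w)) + /(lat_leD2r (- w)); rewrite !addrK => -> ->.
Qed.

Lemma lat_joinZ a u v : 0 < a ->
  a *: lat_join u v = lat_join (a *: u) (a *: v).
Proof.
move=> a0; apply: lat_eq; last first.
  by rewrite lat_joinP !lat_le_scale ?lat_joinl ?lat_joinr// ltW.
have -> : lat_join (a *: u) (a *: v) =
    a *: (a^-1 *: lat_join (a *: u) (a *: v)).
  by rewrite scalerA mulfV ?scale1r ?gt_eqF.
apply: lat_le_scale; first exact: ltW.
have ai : 0 <= a^-1 by rewrite invr_ge0 ltW.
have := lat_le_scale ai (lat_joinl (a *: u) (a *: v)).
have := lat_le_scale ai (lat_joinr (a *: u) (a *: v)).
by rewrite !scalerA mulVf ?gt_eqF// !scale1r lat_joinP => -> ->.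
Qed.

Lemma lat_meetE u v : lat_meet u v = - lat_join (- u) (- v).
Proof.
apply: lat_eq.
  rewrite -[lat_meet _ _]opprK lat_le_opp lat_joinP !lat_le_opp.
  by rewrite lat_meetl lat_meetr.
have N w z : lat_le (- w) z = lat_le (- z) w by rewrite -lat_le_opp opprK.
by rewrite lat_meetP (N _ u) (N _ v) lat_joinl lat_joinr.
Qed.

Lemma lat_absP u v : lat_le (lat_abs u) v = lat_le u v && lat_le (- v) u.
Proof.
by rewrite /lat_abs lat_joinP -[lat_le (- v) u]lat_le_opp opprK.
Qed.

Lemma lat_le_abs u : lat_le u (lat_abs u).
Proof. exact: lat_joinl. Qed.

Lemma lat_ge0_half u : lat_le (- u) u -> lat_le 0 u.
Proof.
rewrite -lat_subr_ge0 opprK => h.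
have -> : u = 2^-1 *: (u + u).
  by rewrite -(mulr2n u) -(scaler_nat 2 u) scalerA mulVf ?scale1r// pnatr_eq0.
by apply: lat_scale_ge0 => //; rewrite invr_ge0.
Qed.

Lemma lat_abs_ge0 u : lat_le 0 (lat_abs u).
Proof.
apply/lat_ge0_half/(lat_trans (y := u)); last exact: lat_joinl.
by rewrite -[X in lat_le _ X]opprK lat_le_opp; exact: lat_joinr.
Qed.

Lemma lat_abs_pos u : lat_le 0 u -> lat_abs u = u.
Proof.
move=> u0; apply: lat_eq; last exact: lat_joinl.
rewrite /lat_abs lat_joinP lat_le_refl /=; apply: (lat_trans (y := 0)) => //.
by rewrite -oppr0 lat_le_opp.
Qed.

Lemma lat_abs_norm u : `|lat_abs u| = `|u|.
Proof.
by apply/le_anti/andP; split; apply: lat_norm_le;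
  rewrite -/(lat_abs _) -/(lat_abs _) (lat_abs_pos (lat_abs_ge0 _));
  exact: lat_le_refl.
Qed.

Lemma lat_le_norm u v : lat_le 0 u -> lat_le u v -> `|u| <= `|v|.
Proof.
move=> u0 uv; apply: lat_norm_le; rewrite -!/(lat_abs _) !lat_abs_pos//.
exact: (lat_trans u0).
Qed.

Lemma lat_absB u v : lat_abs (u - v) = lat_abs (v - u).
Proof.
by rewrite /lat_abs !opprB; apply: lat_eq; rewrite lat_joinP lat_joinr lat_joinl.
Qed.

(* The positive part of [u - v] is dominated by [|u - u'|] when [u' <= v], so
   the order is closed for the norm. *)
Lemma lat_le_closed u v :
  (forall eps, 0 < eps -> exists2 u', lat_le u' v & `|u - u'| <= eps) ->
  lat_le u v.
Proof.
move=> H; have : `|lat_join (u - v) 0| <= 0.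
  apply/ler_addgt0Pr => eps eps0; rewrite add0r.
  have [u' u'v /(le_trans _)] := H _ eps0; apply.
  rewrite -[leRHS]lat_abs_norm; apply: lat_le_norm; first exact: lat_joinr.
  rewrite lat_joinP lat_abs_ge0 andbT; apply: lat_trans (lat_le_abs _).
  by rewrite ![u - _]addrC; apply: lat_leD2r; rewrite lat_le_opp.
rewrite normr_le0 => /eqP H0.
by rewrite -lat_subr_ge0 -lat_le_opp oppr0 opprB -H0 lat_joinl.
Qed.

(** The norm is monotone, so the positive part of [u], which lies below every [eps *: e], has norm
    0. *)
Lemma lat_archimedean u e : lat_le 0 e ->
  (forall eps, 0 < eps -> lat_le u (eps *: e)) -> lat_le u 0.
Proof.
move=> e0 H; have : `|lat_join u 0| <= 0.
  apply/ler_addgt0Pr => eps eps0; rewrite add0r.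
  have d0 : 0 < eps / (1 + `|e|) by rewrite divr_gt0// ltr_wpDr.
  apply: (@le_trans _ _ `|(eps / (1 + `|e|)) *: e|).
    apply: lat_le_norm; first exact: lat_joinr.
    by rewrite lat_joinP H//= lat_scale_ge0// ltW.
  rewrite normrZ (ger0_norm (ltW d0)) -mulrA ler_piMr ?(ltW eps0)//.
  by rewrite mulrC ler_pdivrMr ?mul1r ?lerDr ?ltr_wpDr.
by rewrite normr_le0 => /eqP <-; exact: lat_joinl.
Qed.

Definition ideal e : set E :=
  [set u | exists2 c, 0 <= c & lat_le (lat_abs u) (c *: e)].

Lemma idealP e u c : 0 <= c -> lat_le u (c *: e) -> lat_le (- (c *: e)) u ->
  ideal e u.
Proof. by move=> c0 h1 h2; exists c => //; rewrite lat_absP h1. Qed.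

Lemma idealE e u : ideal e u ->
  exists c, [/\ 0 <= c, lat_le u (c *: e) & lat_le (- (c *: e)) u].
Proof. by move=> [c c0]; rewrite lat_absP => /andP[? ?]; exists c. Qed.

Lemma ideal_le e u v : ideal e v -> lat_le (lat_abs u) (lat_abs v) -> ideal e u.
Proof. by move=> [c c0 vc] uv; exists c => //; exact: lat_trans uv vc. Qed.

Lemma ideal_pos_le e u v : ideal e v -> lat_le 0 u -> lat_le u v -> ideal e u.
Proof.
move=> ev u0 uv; apply: ideal_le ev _; rewrite !lat_abs_pos//.
exact: lat_trans uv.
Qed.

Lemma ideal_abs e u : ideal e (lat_abs u) <-> ideal e u.
Proof.
by split=> h; apply: ideal_le h _; rewrite (lat_abs_pos (lat_abs_ge0 _));
  exact: lat_le_refl.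
Qed.

Lemma ideal0 e : ideal e 0.
Proof. by exists 0 => //; rewrite scale0r lat_abs_pos lat_le_refl. Qed.

Lemma ideal_self e : lat_le 0 e -> ideal e e.
Proof. by move=> e0; exists 1 => //; rewrite scale1r lat_abs_pos ?lat_le_refl. Qed.

Lemma idealD e u v : ideal e u -> ideal e v -> ideal e (u + v).
Proof.
move=> /idealE[a [a0 u1 u2]] /idealE[b [b0 v1 v2]].
apply: (@idealP _ _ (a + b)); first exact: addr_ge0.
  by rewrite scalerDl; exact: lat_le_add.
by rewrite scalerDl opprD; exact: lat_le_add.
Qed.

Lemma idealN e u : ideal e u -> ideal e (- u).
Proof.
move=> /idealE[a [a0 u1 u2]]; apply: (@idealP _ _ a) => //.
  by rewrite -lat_le_opp opprK.
by rewrite lat_le_opp.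
Qed.

Lemma idealB e u v : ideal e u -> ideal e v -> ideal e (u - v).
Proof. by move=> eu ev; apply: idealD => //; exact: idealN. Qed.

Lemma idealZ e a u : ideal e u -> ideal e (a *: u).
Proof.
have H b : 0 <= b -> ideal e u -> ideal e (b *: u).
  move=> b0 /idealE[c [c0 u1 u2]]; apply: (@idealP _ _ (b * c)).
  - exact: mulr_ge0.
  - by rewrite -scalerA; exact: lat_le_scale.
  - by rewrite -scalerA -scalerN; exact: lat_le_scale.
move=> eu; have [/H|/ltW] := leP 0 a; first exact.
by rewrite -oppr_ge0 => /H/(_ eu)/idealN; rewrite scaleNr opprK.
Qed.

Lemma ideal_join e u v : ideal e u -> ideal e v -> ideal e (lat_join u v).
Proof.
move=> /idealE[a [a0 u1 u2]] /idealE[b [b0 v1 v2]].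
have ae : lat_le 0 (a *: e) by exact/lat_ge0_half/(lat_trans u2 u1).
have be : lat_le 0 (b *: e) by exact/lat_ge0_half/(lat_trans v2 v1).
have a_ab : lat_le (a *: e) ((a + b) *: e).
  by rewrite scalerDl -lat_subr_ge0 addrAC subrr add0r.
have b_ab : lat_le (b *: e) ((a + b) *: e).
  by rewrite scalerDl -lat_subr_ge0 addrK.
apply: (@idealP _ _ (a + b)); first exact: addr_ge0.
  by rewrite lat_joinP (lat_trans u1 a_ab) (lat_trans v1 b_ab).
apply: (lat_trans (y := u)); last exact: lat_joinl.
by apply: lat_trans u2; rewrite lat_le_opp.
Qed.

Lemma ideal_meet e u v : ideal e u -> ideal e v -> ideal e (lat_meet u v).
Proof.
by move=> eu ev; rewrite lat_meetE; apply/idealN/ideal_join; exact: idealN.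
Qed.

Lemma ideal_sum e (I : Type) (r : seq I) (F : I -> E) :
  (forall i, ideal e (F i)) -> ideal e (\sum_(i <- r) F i).
Proof.
move=> H; elim/big_ind : _ => //; [exact: ideal0|exact: idealD].
Qed.

Lemma ideal_trans e g u : ideal g e -> ideal e u -> ideal g u.
Proof.
move=> /idealE[a [a0 e1 e2]] /idealE[c [c0 u1 u2]]; apply: (@idealP _ _ (c * a)).
- exact: mulr_ge0.
- by rewrite -scalerA; apply: (lat_trans u1); exact: lat_le_scale.
- rewrite -scalerA; apply: lat_trans u2; rewrite lat_le_opp.
  exact: lat_le_scale.
Qed.

End RieszSpace.

(** * Minimal sublinear functionals *)

Section MinimalSublinear.
Context {R : realType} {T : Type}.
Variables (D : set T) (add : T -> T -> T) (sc : R -> T -> T).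
Variables (B : T -> R -> Prop) (J : T -> T -> T -> Prop).
Implicit Types (u v w j : T) (s t c : R) (q : T -> R).

Hypotheses (Dadd : forall u v, D u -> D v -> D (add u v))
  (Dsc : forall c u, 0 < c -> D u -> D (sc c u)).
Hypotheses
  (addA : forall u v w, D u -> D v -> D w ->
     add u (add v w) = add (add u v) w)
  (addC : forall u v, D u -> D v -> add u v = add v u)
  (scD : forall c u v, 0 < c -> D u -> D v ->
     sc c (add u v) = add (sc c u) (sc c v))
  (scA : forall s t u, 0 < s -> 0 < t -> D u -> sc s (sc t u) = sc (s * t) u)
  (sc1 : forall u, D u -> sc 1 u = u)
  (Dsc2 : forall s t u, 0 < s -> 0 < t -> D u ->
     sc (s + t) u = add (sc s u) (sc t u)).
Hypotheses (Bex : forall u, D u -> exists c, B u c)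
  (Jadd : forall u v j w, D u -> D v -> D j -> D w -> J u v j ->
     J (add u w) (add v w) (add j w)).

(* [B u c] records lower bounds [c] that the increments of [q] in the
   direction [u] must respect, [J u v j] triples on which [q] is maxitive. *)
Definition sublinear_on q := [/\
  forall u v, D u -> D v -> q (add u v) <= q u + q v,
  forall c u, 0 < c -> D u -> q (sc c u) = c * q u,
  forall u z c, D u -> D z -> B u c -> q z + c <= q (add z u) &
  forall u v j, D u -> D v -> D j -> J u v j -> q j = Num.max (q u) (q v)].

Let addCA u v w : D u -> D v -> D w -> add u (add v w) = add v (add u w).
Proof. by move=> *; rewrite addA// (addC (u := u))// addA. Qed.

Let addACA u v w j : D u -> D v -> D w -> D j ->
  add (add u v) (add w j) = add (add u w) (add v j).
Proof.
by move=> *; rewrite -addA ?(addCA (u := v))// ?addA//; do ?exact: Dadd.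
Qed.

Let shift q w u : set R := [set q (add u (sc t w)) - t * q w | t in [set t | 0 < t]].

(** The usual device for the Hahn-Banach theorem: this functional lies below [q], and its value at
    [u] is at most [q (u + w) - q w]. If [q] is minimal, the two coincide and
    [q u + q w <= q (u + w)]. *)
Definition directional q w u : R := inf (shift q w u).

Section Directional.
Variables (q : T -> R) (w : T).
Hypotheses (Dw : D w) (sq : sublinear_on q).

Let shift_n0 u : shift q w u !=set0.
Proof. by exists (q (add u (sc 1 w)) - 1 * q w); exists 1 => //=. Qed.

Let shift_lb u : D u -> has_lbound (shift q w u).
Proof.
move=> Du; have [c Bc] := Bex Du; case: sq => _ qsc qB _.
exists c => _ [t t0 <-]; rewrite lerBrDl -qsc// addC//; last exact: Dsc.
by apply: qB => //; exact: Dsc.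
Qed.

Let inf_shift u : D u -> has_inf (shift q w u).
Proof. by move=> Du; split => //; exact: shift_lb. Qed.

Lemma directional_le u t : D u -> 0 < t ->
  directional q w u <= q (add u (sc t w)) - t * q w.
Proof. by move=> Du t0; apply: ge_inf; [exact: shift_lb|exists t]. Qed.

Let directional_ge u c : D u ->
  (forall t, 0 < t -> c <= q (add u (sc t w)) - t * q w) ->
  c <= directional q w u.
Proof. by move=> Du H; apply: lb_le_inf => // _ [t t0 <-]; exact: H. Qed.

Let directional_lt u eps : D u -> 0 < eps -> exists2 t, 0 < t &
  q (add u (sc t w)) - t * q w < directional q w u + eps.
Proof.
move=> Du e0; have [_ [t t0 <-] h] := inf_adherent e0 (inf_shift Du).
by exists t.
Qed.

Lemma directional_leq u : D u -> directional q w u <= q u.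
Proof.
move=> Du; apply: le_trans (directional_le Du ltr01) _.
case: sq => qD _ _ _; rewrite sc1// mul1r lerBlDr; exact: qD.
Qed.

(* The difference quotient defining [directional] is nonincreasing in [t]. *)
Let shift_anti u s t : D u -> 0 < s -> s <= t ->
  q (add u (sc t w)) - t * q w <= q (add u (sc s w)) - s * q w.
Proof.
move=> Du s0; rewrite le_eqVlt => /predU1P[->//|st].
have [d d0 ->] : exists2 d, 0 < d & t = s + d.
  by exists (t - s); rewrite ?subr_gt0// addrC subrK.
case: sq => qD qsc _ _; rewrite Dsc2// addA//; try exact: Dsc.
have /= := qD (add u (sc s w)) (sc d w) (Dadd Du (Dsc s0 Dw)) (Dsc d0 Dw).
rewrite qsc//; lra.
Qed.

Lemma directional_sublinear : sublinear_on (directional q w).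
Proof.
have [qD qsc qB qJ] := sq; split.
- move=> u v Du Dv; apply/ler_addgt0Pr => eps e0.
  have e2 : 0 < eps / 2 by rewrite divr_gt0.
  have [s s0 hs] := directional_lt Du e2; have [t t0 ht] := directional_lt Dv e2.
  have := directional_le (Dadd Du Dv) (addr_gt0 s0 t0).
  rewrite Dsc2// addACA//; try exact: Dsc.
  have := qD _ _ (Dadd Du (Dsc s0 Dw)) (Dadd Dv (Dsc t0 Dw)); lra.
- move=> c u c0 Du; apply/le_anti/andP; split.
    rewrite -ler_pdivrMl//; apply: directional_ge => // t t0.
    have Dtw := Dsc t0 Dw; have Dutw := Dadd Du Dtw.
    rewrite ler_pdivrMl// mulrBr -(qsc _ _ c0 Dutw) scD// scA// mulrA.
    by apply: directional_le; [exact: Dsc|exact: mulr_gt0].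
  apply: directional_ge; first exact: Dsc.
  move=> t t0; have ct : 0 < t / c by rewrite divr_gt0.
  have := directional_le Du ct; rewrite -(ler_pM2l c0) => /le_trans; apply.
  have Dtw := Dsc ct Dw; have Dutw := Dadd Du Dtw.
  by rewrite mulrBr -(qsc _ _ c0 Dutw) scD// scA// [c * (_ * q w)]mulrA [c * (t / c)]mulrC divfK// gt_eqF.
- move=> u z c Du Dz Bc; apply: directional_ge; first exact: Dadd.
  move=> t t0; have := directional_le Dz t0.
  have -> : add (add z u) (sc t w) = add (add z (sc t w)) u.
    by rewrite -!addA ?(addC (v := u))//; exact: Dsc.
  have := qB _ _ _ Du (Dadd Dz (Dsc t0 Dw)) Bc; lra.
- move=> u v j Du Dv Dj Jj.
  have H t : 0 < t -> q (add j (sc t w)) =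
      Num.max (q (add u (sc t w))) (q (add v (sc t w))).
    by move=> t0; apply: qJ (Jadd _ _ _ _ Jj) => //; do ?apply: Dadd => //; exact: Dsc.
  apply/le_anti/andP; split.
    apply/ler_addgt0Pr => eps e0.
    have [s s0 hs] := directional_lt Du e0; have [t t0 ht] := directional_lt Dv e0.
    (* The quotients at [u] and at [v] are nonincreasing in the parameter, so one large parameter
       serves both and the maximum passes to the infimum. *)
    have m0 : 0 < Num.max s t by rewrite lt_max s0.
    have sm : s <= Num.max s t by rewrite le_max lexx.
    have tm : t <= Num.max s t by rewrite le_max lexx orbT.
    have := directional_le Dj m0; rewrite H//.
    have := shift_anti Du s0 sm; have := shift_anti Dv t0 tm.
    move: (Num.max s t) => m.
    case: (leP (q (add u (sc m w))) (q (add v (sc m w)))) => ?;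
      case: (leP (directional q w u) (directional q w v)) => ?; lra.
  rewrite ge_max; apply/andP; split; apply: directional_ge => // t t0;
    [have := directional_le Du t0|have := directional_le Dv t0];
    rewrite H// => /le_trans; apply; rewrite lerD2r le_max lexx ?orbT//.
Qed.

End Directional.

(** The cone [D] is not supposed to contain a zero at which to start the increment; starting at [u]
    itself gives [q u + c <= q (u + u) = 2 q u]. *)
Lemma sublinear_lb q u c : sublinear_on q -> D u -> B u c -> c <= q u.
Proof.
case=> _ qsc qB _ Du Bc; have := qB _ _ _ Du Du Bc.
have -> : add u u = sc (1 + 1) u by rewrite Dsc2// sc1.
rewrite qsc// ?addr_gt0//; lra.
Qed.

(** Zorn's lemma yields a minimal functional: the bounds [B] keep the infimum of a chain finite, and
    all four conditions survive it because two members of a chain are comparable. Minimality against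
    [directional] then gives superadditivity. *)
Lemma exists_additive_minorant q0 : sublinear_on q0 -> exists q,
  [/\ sublinear_on q, forall u, D u -> q u <= q0 u &
      forall u v, D u -> D v -> q (add u v) = q u + q v].
Proof.
move=> sq0.
pose P q := sublinear_on q /\ forall u, D u -> q u <= q0 u.
pose V := {q : T -> R | P q}.
(* The order is reversed, so that a maximal element for [r] is a minimal functional. *)
pose r (a b : V) := `[< forall u, D u -> sval b u <= sval a u >].
have [||A totA|[q [sq qq0]] qmax] := @ZL_preorder V (exist _ q0 (conj sq0 (fun _ _ => lexx _))) r.
- by move=> a; apply/asboolP.
- move=> b a c /asboolP ab /asboolP bc; apply/asboolP => u Du.
  by apply: le_trans (ab _ Du); exact: bc.
- have [[a0 Aa0]|A0] := pselect (exists a, A a); last first.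
    exists (exist _ q0 (conj sq0 (fun _ _ => lexx _))) => s As; exfalso.
    by apply: A0; exists s.
  pose S u : set R := [set sval a u | a in A].
  have S0 u : S u !=set0 by exists (sval a0 u); exists a0.
  have Slb u : D u -> has_lbound (S u).
    move=> Du; have [c Bc] := Bex Du; exists c => _ [a Aa <-].
    by apply: sublinear_lb Bc => //; case: (svalP a).
  pose qi u := inf (S u).
  have qi_le a u : A a -> D u -> qi u <= sval a u.
    by move=> Aa Du; apply: ge_inf; [exact: Slb|exists a].
  have qi_lt u eps : D u -> 0 < eps -> exists2 a, A a & sval a u < qi u + eps.
    move=> Du e0; have [_ [a Aa <-] h] := inf_adherent e0 (conj (S0 u) (Slb _ Du)).
    by exists a.
  have qi_ge u c : (forall a, A a -> c <= sval a u) -> c <= qi u.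
    by move=> H; apply: lb_le_inf => // _ [a Aa <-]; exact: H.
  have dir a b : A a -> A b -> exists2 d, A d &
      forall u, D u -> sval d u <= sval a u /\ sval d u <= sval b u.
    move=> Aa Ab; have [/asboolP ab|/asboolP ba] := totA _ _ Aa Ab.
      by exists b => // u Du; split => //; exact: ab.
    by exists a => // u Du; split => //; exact: ba.
  have sqi : sublinear_on qi.
    split.
    + move=> u v Du Dv; apply/ler_addgt0Pr => eps e0.
      have e2 : 0 < eps / 2 by rewrite divr_gt0.
      have [a Aa ha] := qi_lt _ _ Du e2; have [b Ab hb] := qi_lt _ _ Dv e2.
      have [d Ad hd] := dir _ _ Aa Ab.
      have := qi_le _ _ Ad (Dadd Du Dv).
      have [[dD _ _ _] _] := svalP d.
      have := dD _ _ Du Dv; have [+ _] := hd _ Du; have [_ +] := hd _ Dv; lra.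
    + move=> c u c0 Du; apply/le_anti/andP; split.
        rewrite -ler_pdivrMl//; apply: qi_ge => a Aa; rewrite ler_pdivrMl//.
        have [[_ asc _ _] _] := svalP a; rewrite -asc//.
        by apply: qi_le => //; exact: Dsc.
      apply: qi_ge => a Aa; have [[_ asc _ _] _] := svalP a.
      by rewrite asc// ler_pM2l//; exact: qi_le.
    + move=> u z c Du Dz Bc; apply: qi_ge => a Aa.
      have [[_ _ aB _] _] := svalP a; apply: le_trans (aB _ _ _ Du Dz Bc).
      by rewrite lerD2r; exact: qi_le.
    + move=> u v j Du Dv Dj Jj; apply/le_anti/andP; split.
        apply/ler_addgt0Pr => eps e0.
        have [a Aa ha] := qi_lt _ _ Du e0; have [b Ab hb] := qi_lt _ _ Dv e0.
        have [d Ad hd] := dir _ _ Aa Ab.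
        have := qi_le _ _ Ad Dj.
        have [[_ _ _ dJ] _] := svalP d; rewrite (dJ _ _ _ Du Dv Dj Jj).
        have [+ _] := hd _ Du; have [_ +] := hd _ Dv.
        case: (leP (sval d u) (sval d v)) => ?; case: (leP (qi u) (qi v)) => ?; lra.
      apply: qi_ge => a Aa; have [[_ _ _ aJ] _] := svalP a.
      rewrite (aJ _ _ _ Du Dv Dj Jj) ge_max !le_max.
      by rewrite qi_le//= qi_le// orbT.
  have Pqi : P qi.
    split=> // u Du; apply: le_trans (qi_le _ _ Aa0 Du) _.
    by have [_] := svalP a0; apply.
  by exists (exist _ qi Pqi) => a Aa; apply/asboolP => u Du; exact: qi_le.
exists q; split=> // u w Du Dw; apply/le_anti/andP; split.
  by have [qD _ _ _] := sq; exact: qD.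
have Pd : P (directional q w).
  split; first exact: directional_sublinear.
  by move=> v Dv; apply: le_trans (qq0 _ Dv); exact: directional_leq.
have /asboolP/(_ u Du)/= := qmax (exist _ _ Pd)
  (asboolT (fun v Dv => directional_leq Dw sq Dv)).
have := directional_le Dw sq Du ltr01; rewrite sc1// mul1r; lra.
Qed.

End MinimalSublinear.

(** * Lattice homomorphisms *)

Section LatticeHomomorphisms.
Context {R : realType} {E : banachLatticeType R}.
Implicit Types (D : set E) (u v w e g : E) (a b c : R) (phi : E -> R).

Definition lat_subspace D := [/\ forall u v, D u -> D v -> D (u + v),
  forall a u, D u -> D (a *: u) &
  forall u v, D u -> D v -> D (lat_join u v)].

Definition lat_hom D phi := [/\
  forall u v, D u -> D v -> phi (u + v) = phi u + phi v,
  forall a u, D u -> phi (a *: u) = a * phi u &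
  forall u v, D u -> D v -> phi (lat_join u v) = Num.max (phi u) (phi v)].

Lemma ideal_subspace e : lat_subspace (ideal e).
Proof.
by split=> [u v|a u|u v]; [exact: idealD|exact: idealZ|exact: ideal_join].
Qed.

(* A minimal maxitive sublinear functional is linear, hence a lattice
   homomorphism. *)
Lemma exists_lat_hom D (q : E -> R) u0 : lat_subspace D ->
  (forall u v, D u -> D v -> q (u + v) <= q u + q v) ->
  (forall c u, 0 < c -> D u -> q (c *: u) = c * q u) ->
  (forall u v, D u -> D v -> q (lat_join u v) = Num.max (q u) (q v)) ->
  D u0 ->
  exists2 phi, lat_hom D phi & (forall u, D u -> phi u <= q u) /\ phi u0 = q u0.
Proof.
move=> [DD DZ DJ] qD qZ qJ Du0.
have DN u : D u -> D (- u) by rewrite -scaleN1r; exact: DZ.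
have D0 : D 0 by rewrite -(scale0r u0); exact: DZ.
have q00 : q 0 = 0.
  have := qZ 2 0 (ltr0Sn _ _) D0; rewrite scaler0; lra.
(* In a vector space the increment bound is subadditivity read backwards:
   [q z <= q (z + u) + q (- u)]. *)
pose B u c := c = - q (- u); pose J u v j := j = lat_join u v.
have h1 u v w : D u -> D v -> D w -> u + (v + w) = u + v + w by rewrite addrA.
have h2 u v : D u -> D v -> u + v = v + u by rewrite addrC.
have h3 c u v : 0 < c -> D u -> D v -> c *: (u + v) = c *: u + c *: v.
  by rewrite scalerDr.
have h4 s t u : 0 < s -> 0 < t -> D u -> s *: (t *: u) = (s * t) *: u.
  by rewrite scalerA.
have h5 u : D u -> 1 *: u = u by rewrite scale1r.
have h6 s t u : 0 < s -> 0 < t -> D u -> (s + t) *: u = s *: u + t *: u.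
  by rewrite scalerDl.
have h7 u : D u -> exists c, B u c by eexists.
have h8 u v j w : D u -> D v -> D j -> D w -> J u v j ->
    J (u + w) (v + w) (j + w) by move=> _ _ _ _ ->; rewrite /J lat_joinDr.
have DZ' c u : 0 < c -> D u -> D (c *: u) by move=> _; exact: DZ.
have sq : sublinear_on D +%R *:%R B J q.
  split=> // [u z c Du Dz ->|u v j Du Dv _ ->]; last exact: qJ.
  by rewrite lerBlDr; apply: le_trans (qD _ _ (DD _ _ Dz Du) (DN _ Du)); rewrite addrK.
(* The minorant is taken below [directional q u0] rather than [q]: this forces
   [phi (- u0) <= q 0 - q u0], whence equality at [u0]. *)
have sq1 := directional_sublinear DD DZ' h1 h2 h3 h4 h6 h7 h8 Du0 sq.
have [phi [[pD pZ pB pJ] phi_le phiD]] :=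
  exists_additive_minorant DD DZ' h1 h2 h3 h4 h5 h6 h7 h8 sq1.
have phi_leq u : D u -> phi u <= q u.
  move=> Du; apply: le_trans (phi_le _ Du) _.
  by apply: (@directional_leq R E D +%R *:%R B J).
have phi0 : phi 0 = 0 by have := phiD _ _ D0 D0; rewrite addr0; lra.
have phiN u : D u -> phi (- u) = - phi u.
  move=> Du; have := phiD _ _ Du (DN _ Du); rewrite subrr phi0; lra.
exists phi; first split=> // [a u Du|u v Du Dv].
- have [a0|a0|->] := ltgtP a 0; last by rewrite scale0r phi0 mul0r.
    rewrite -[a]opprK scaleNr phiN ?pZ ?oppr_gt0//; last exact: DZ.
    by rewrite !mulNr.
  exact: pZ.
- by apply: pJ => //; exact: DJ.
split=> //; apply/le_anti; rewrite phi_leq//=.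
have := phi_le _ (DN _ Du0).
have := directional_le DZ' h2 h7 Du0 sq (DN _ Du0) ltr01.
rewrite scale1r addNr q00 phiN//; lra.
Qed.

Lemma lat_homB D phi u v : lat_subspace D -> lat_hom D phi -> D u -> D v ->
  phi (u - v) = phi u - phi v.
Proof.
move=> [DD DZ DJ] [hD hZ hJ] Du Dv.
by rewrite hD// -scaleN1r ?hZ ?mulN1r//; exact: DZ.
Qed.

Lemma lat_hom_le D phi u v : lat_hom D phi -> D u -> D v -> lat_le u v ->
  phi u <= phi v.
Proof.
move=> [_ _ hJ] Du Dv uv; have := hJ _ _ Du Dv.
have -> : lat_join u v = v.
  by apply: lat_eq; [rewrite lat_joinP uv lat_le_refl|exact: lat_joinr].
by move=> ->; rewrite le_max lexx.
Qed.

(** A substitute for the compactness of the set of normalized homomorphisms. The infimum of the [c]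
    with [v <= c *: e + m *: z n] is a maxitive sublinear functional of [v]; it is at most 0 at each
    [z n], at most 1 at [e], at most -1 at [- e], and at least [d] at [w] by hypothesis. A
    homomorphism below it that agrees with it at [w] has the required properties. *)
Lemma exists_lat_hom_compact e (z : nat -> E) w (d : R) :
  lat_le 0 e -> (forall n, ideal e (z n)) -> (forall n, lat_le 0 (z n)) ->
  (forall n m, (n <= m)%N -> lat_le (z n) (z m)) -> ideal e w -> 0 < d ->
  (forall n c m, 0 <= m -> lat_le w (c *: e + m *: z n) -> d <= c) ->
  exists2 phi, lat_hom (ideal e) phi &
    [/\ phi e = 1, forall n, phi (z n) = 0 & d <= phi w].
Proof.
move=> e0 ez z0 zz ew d0 H.
pose S v : set R := [set c | exists n m, 0 <= m /\ lat_le v (c *: e + m *: z n)].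
have Sn v : ideal e v -> S v !=set0.
  move=> /idealE[c [_ vc _]]; exists c, 0%N, 0; split => //.
  by rewrite scale0r addr0.
(* A bound [c < - b] would put [e], hence also [w], below a multiple of some [z n]; the hypothesis
   with coefficient 0 at [e] would then give [d <= 0]. *)
have Slb v b : lat_le (- (b *: e)) v -> lbound (S v) (- b).
  move=> bv c [n [m [m0 h]]]; rewrite leNgt; apply/negP => cb.
  have k0 : 0 < - b - c by rewrite subr_gt0.
  have ez' : lat_le e ((m / (- b - c)) *: z n).
    have := lat_trans bv h; rewrite -[lat_le (- _) _]lat_subr_ge0 opprK.
    rewrite addrAC -scalerDl => /(lat_le_scale (ltW (_ : 0 < (- b - c)^-1))).
    rewrite invr_gt0 => /(_ k0); rewrite scaler0 scalerDr !scalerA.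
    have -> : (- b - c)^-1 * (c + b) = -1.
      by rewrite -[c + b]opprK opprD [- c - b]addrC mulrN mulVf// gt_eqF.
    by rewrite scaleN1r addrC lat_subr_ge0 mulrC.
  have [a [a0 wa _]] := idealE ew.
  have /(H n 0) : lat_le w (0 *: e + (a * (m / (- b - c))) *: z n).
    rewrite scale0r add0r -scalerA; apply: lat_trans wa _; exact: lat_le_scale.
  by rewrite mulr_ge0 ?divr_ge0 ?(ltW k0)// => /(_ isT); rewrite leNgt d0.
have Sinf v : ideal e v -> has_inf (S v).
  by move=> ev; split; [exact: Sn|have /idealE[b [_ _ /Slb]] := ev; exists (- b)].
pose q v := inf (S v).
have q_le v c n m : ideal e v -> 0 <= m -> lat_le v (c *: e + m *: z n) -> q v <= c.
  by move=> ev m0 h; apply: ge_inf; [case: (Sinf _ ev)|exists n, m].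
have q_lt v eps : ideal e v -> 0 < eps -> exists c n m,
    [/\ 0 <= m, lat_le v (c *: e + m *: z n) & c < q v + eps].
  move=> ev eps0; have [c [n [m [m0 h1]]] h2] := inf_adherent eps0 (Sinf _ ev).
  by exists c, n, m.
have z_le c m n m' n' : 0 <= m -> m <= m' -> (n <= n')%N ->
    lat_le (c *: e + m *: z n) (c *: e + m' *: z n').
  move=> m0 mm' nn'; apply: lat_le_add; first exact: lat_le_refl.
  apply: (lat_trans (y := m *: z n')); first exact/lat_le_scale/zz.
  by rewrite -lat_subr_ge0 -scalerBl lat_scale_ge0// subr_ge0.
have e_le c c' m n : c <= c' -> lat_le (c *: e + m *: z n) (c' *: e + m *: z n).
  move=> cc; apply: lat_le_add; last exact: lat_le_refl.
  by rewrite -lat_subr_ge0 -scalerBl lat_scale_ge0// subr_ge0.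
have qD u v : ideal e u -> ideal e v -> q (u + v) <= q u + q v.
  move=> eu ev; apply/ler_addgt0Pr => eps eps0.
  have e2 : 0 < eps / 2 by rewrite divr_gt0.
  have [c1 [n1 [m1 [m10 h1 l1]]]] := q_lt _ _ eu e2.
  have [c2 [n2 [m2 [m20 h2 l2]]]] := q_lt _ _ ev e2.
  have : q (u + v) <= c1 + c2; last by lra.
  apply: (q_le _ _ (maxn n1 n2) (m1 + m2)); [exact: idealD|exact: addr_ge0|].
  rewrite scalerDl scalerDl addrACA; apply: lat_le_add.
    by apply: lat_trans h1 _; apply: z_le => //; rewrite leq_maxl.
  by apply: lat_trans h2 _; apply: z_le => //; rewrite leq_maxr.
have qZ1 c u : 0 < c -> ideal e u -> q (c *: u) <= c * q u.
  move=> c0 eu; rewrite -ler_pdivrMl//; apply/ler_addgt0Pr => eps eps0.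
  have [c1 [n1 [m1 [m10 h1 l1]]]] := q_lt _ _ eu eps0.
  rewrite ler_pdivrMl//; apply: (@le_trans _ _ (c * c1)); last first.
    by rewrite ler_pM2l// ltW.
  apply: (q_le _ _ n1 (c * m1)); [exact: idealZ|by rewrite mulr_ge0// ltW|].
  by rewrite -!scalerA -scalerDr; exact: lat_le_scale (ltW c0) h1.
have qZ c u : 0 < c -> ideal e u -> q (c *: u) = c * q u.
  move=> c0 eu; apply/le_anti; rewrite qZ1//=.
  rewrite -ler_pdivlMl//; have ci : 0 < c^-1 by rewrite invr_gt0.
  have := qZ1 _ _ ci (idealZ c eu).
  by rewrite scalerA mulVf ?gt_eqF// scale1r.
have qmono u v : ideal e u -> ideal e v -> lat_le u v -> q u <= q v.
  move=> eu ev uv; apply/ler_addgt0Pr => eps eps0.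
  have [c1 [n1 [m1 [m10 h1 l1]]]] := q_lt _ _ ev eps0.
  apply: le_trans (ltW l1); apply: (q_le _ _ n1 m1) => //.
  exact: lat_trans uv h1.
have qJ u v : ideal e u -> ideal e v -> q (lat_join u v) = Num.max (q u) (q v).
  move=> eu ev; have euv := ideal_join eu ev; apply/le_anti/andP; split.
    apply/ler_addgt0Pr => eps eps0.
    have [c1 [n1 [m1 [m10 h1 l1]]]] := q_lt _ _ eu eps0.
    have [c2 [n2 [m2 [m20 h2 l2]]]] := q_lt _ _ ev eps0.
    apply: (@le_trans _ _ (Num.max c1 c2)).
      apply: (q_le _ _ (maxn n1 n2) (m1 + m2)) => //; first exact: addr_ge0.
      rewrite lat_joinP; apply/andP; split.
        apply: lat_trans h1 _; apply: (lat_trans (z_le c1 _ _ (m1 + m2) (maxn n1 n2) _ _ _)) => //.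
        - by rewrite lerDl.
        - by rewrite leq_maxl.
        - by apply: e_le; rewrite le_max lexx.
      apply: lat_trans h2 _; apply: (lat_trans (z_le c2 _ _ (m1 + m2) (maxn n1 n2) _ _ _)) => //.
      - by rewrite lerDr.
      - by rewrite leq_maxr.
      - by apply: e_le; rewrite le_max lexx orbT.
    case: (leP c1 c2) => ?; case: (leP (q u) (q v)) => ?; lra.
  by rewrite ge_max !qmono//; [exact: lat_joinr|exact: lat_joinl].
have ee := ideal_self e0.
have [phi hphi [phi_le phiw]] := exists_lat_hom (ideal_subspace e) qD qZ qJ ew.
have [pD pZ pJ] := hphi.
have phiN u : ideal e u -> phi (- u) = - phi u.
  by move=> eu; rewrite -scaleN1r pZ// mulN1r.
exists phi => //; split.
- apply/le_anti/andP; split.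
    apply: le_trans (phi_le _ ee) _; apply: (q_le _ _ 0%N 0) => //.
    by rewrite scale1r scale0r addr0 lat_le_refl.
  rewrite -lerN2 -phiN//; apply: le_trans (phi_le _ (idealN ee)) _.
  apply: (q_le _ _ 0%N 0) => //; first exact: idealN.
  by rewrite scale0r addr0 scaleN1r lat_le_refl.
- move=> n; apply/le_anti/andP; split.
    apply: le_trans (phi_le _ (ez n)) _; apply: (q_le _ _ n 1) => //.
    by rewrite scale1r scale0r add0r lat_le_refl.
  rewrite -oppr_le0 -phiN//; apply: le_trans (phi_le _ (idealN (ez n))) _.
  apply: (q_le _ _ n 0) => //; first exact: idealN.
  by rewrite !scale0r addr0 -oppr0 lat_le_opp.
- rewrite phiw; apply: lb_le_inf; first exact: Sn.
  by move=> c [n [m [m0 h]]]; exact: H h.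
Qed.

(** With the zero sequence for [z], the preceding lemma produces a homomorphism with
    [phi (u - v) >= eps] as soon as [u - v <= eps *: e] fails. From here on, inequalities in a
    principal ideal are checked on real numbers. *)
Lemma ideal_ler e u v : lat_le 0 e -> ideal e u -> ideal e v ->
  (forall phi, lat_hom (ideal e) phi -> phi u <= phi v) -> lat_le u v.
Proof.
move=> e0 eu ev H; rewrite -lat_subr_ge0 -lat_le_opp oppr0 opprB.
apply: (lat_archimedean e0) => eps eps0; apply: contrapT => /negP uve.
have [|||||||phi hphi [_ _]] := @exists_lat_hom_compact e (fun=> 0) (u - v) eps.
- by [].
- by move=> _; exact: ideal0.
- by move=> _; exact: lat_le_refl.
- by move=> *; exact: lat_le_refl.
- exact: idealB.
- by [].
- move=> _ c m m0; rewrite scaler0 addr0 => h; rewrite leNgt; apply/negP => ce.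
  move/negP: uve; apply; apply: lat_trans h _.
  by rewrite -lat_subr_ge0 -scalerBl lat_scale_ge0// subr_ge0 ltW.
rewrite (lat_homB (ideal_subspace e))//; have := H _ hphi; lra.
Qed.

Lemma ideal_eqr e u v : lat_le 0 e -> ideal e u -> ideal e v ->
  (forall phi, lat_hom (ideal e) phi -> phi u = phi v) -> u = v.
Proof.
by move=> e0 eu ev H; apply: lat_eq; apply: (ideal_ler e0) => // phi /H ->.
Qed.

End LatticeHomomorphisms.

(** * Krivine's functional calculus *)

Section HomogeneousFunctions.
Context {R : realType} {n : nat}.
Implicit Types (f g h : 'rV[R]_n -> R) (s t : 'rV[R]_n) (a eps : R).

Local Notation H := (@homogeneous_functions R n).

(** The l1 norm is chosen because the functional calculus sends it to [\sum_j |v_j|], the order unit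
    in which the errors of approximation are measured. *)
Definition sum_norm t : R := \sum_(j < n) `|t 0 j|.

Lemma homogeneous_at0 f : H f -> f 0 = 0.
Proof. by move=> [_ /(_ 0 0 (lexx _))]; rewrite scaler0 mul0r. Qed.

Lemma homogeneous_comb a f g : H f -> H g -> H (fun t => a * f t + g t).
Proof.
move=> [fc fh] [gc gh]; split; last by move=> b t b0; rewrite fh// gh//; ring.
move=> t; apply: (@continuousD R R^o _ (fun t => a * f t) g); last exact: gc.
apply: (@continuousM R _ (fun=> a) f); last exact: fc.
exact: cst_continuous.
Qed.

Lemma homogeneous_max f g : H f -> H g -> H (fun t => Num.max (f t) (g t)).
Proof.
move=> [fc fh] [gc gh]; split; last by move=> b t b0; rewrite fh// gh// maxr_pMr.
by move=> t; apply: continuous_max; [exact: fc|exact: gc].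
Qed.

Lemma homogeneous_coord j : H (fun t => t 0 j).
Proof. by split=> [t|a t _]; [exact: coord_continuous|rewrite mxE]. Qed.

Lemma homogeneous0 : H (fun=> 0).
Proof. by split=> [|a t _]; [exact: cst_continuous|rewrite mulr0]. Qed.

Lemma sum_norm_ge0 t : 0 <= sum_norm t.
Proof. exact: sumr_ge0. Qed.

Lemma sum_norm0 t : sum_norm t = 0 -> t = 0.
Proof.
move=> /eqP; rewrite psumr_eq0// => /allP h; apply/rowP => j; rewrite mxE.
by apply/eqP; rewrite -normr_eq0; apply: h; rewrite mem_index_enum.
Qed.

Lemma norm_le_sum_norm t : `|t| <= sum_norm t.
Proof.
rewrite [leLHS]/Num.norm/= mx_normrE; apply/bigmax_leP; split.
  exact: sum_norm_ge0.
move=> [i j] _ /=; rewrite ord1 /sum_norm (bigD1 j)//= lerDl; exact: sumr_ge0.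
Qed.

(* Lattice form of the Stone-Weierstrass theorem: the functions
   [f s * N t + C * sum_j |t_j - s_j N t|] peak at [s] on the sphere [N = 1],
   so that a finite infimum of them approximates [f] from above. *)
Lemma homogeneous_density (A : set ('rV[R]_n -> R)) :
  (forall f, A f -> H f) ->
  A (fun=> 0) -> (forall j, A (fun t => t 0 j)) ->
  (forall a f g, A f -> A g -> A (fun t => a * f t + g t)) ->
  (forall f g, A f -> A g -> A (fun t => Num.max (f t) (g t))) ->
  (forall f, H f -> (forall eps, 0 < eps -> exists2 g, A g &
     forall t, `|f t - g t| <= eps * sum_norm t) -> A f) ->
  forall f, H f -> A f.
Proof.
move=> AH A0 Acoord Acomb Amax Aclosed f Hf; apply: Aclosed => // eps eps0.
have [fc fh] := Hf.
have AZ a g : A g -> A (fun t => a * g t).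
  move=> Ag; have := Acomb a _ _ Ag A0.
  by congr A; apply/funext => t; rewrite addr0.
have AD g h : A g -> A h -> A (fun t => g t + h t).
  move=> Ag Ah; have := Acomb 1 _ _ Ag Ah.
  by congr A; apply/funext => t; rewrite mul1r.
have Aabs g : A g -> A (fun t => `|g t|).
  move=> Ag; have := Amax _ _ Ag (AZ (-1) _ Ag); congr A; apply/funext => t.
  by rewrite mulN1r; case: (leP 0 (g t)) => g0;
    rewrite ?(ger0_norm g0) ?(ltr0_norm g0); case: leP => //; lra.
have Asum (F : 'I_n -> 'rV[R]_n -> R) : (forall j, A (F j)) ->
    A (fun t => \sum_(j < n) F j t).
  move=> AF; elim: (index_enum _) => [|j l IH].
    by move: A0; congr A; apply/funext => t; rewrite big_nil.
  have := AD _ _ (AF j) IH; congr A; apply/funext => t; by rewrite big_cons.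
have AN : A sum_norm by apply: Asum => j; exact/Aabs.
have Amin g h : A g -> A h -> A (fun t => Num.min (g t) (h t)).
  move=> Ag Ah; have := AZ (-1) _ (Amax _ _ (AZ (-1) _ Ag) (AZ (-1) _ Ah)).
  congr A; apply/funext => t; rewrite !mulN1r.
  by case: (leP (g t)) => ?; case: leP => ?; lra.
pose dist s t : R := \sum_(j < n) `|t 0 j - s 0 j * sum_norm t|.
have Adist s : A (dist s).
  apply: Asum => j; apply: Aabs; have := Acomb (- s 0 j) _ _ AN (Acoord j).
  by congr A; apply/funext => t; rewrite addrC mulNr.
pose K := [set t : 'rV[R]_n | sum_norm t = 1].
have Ncont : continuous sum_norm by have [] := AH _ AN.
have Kcompact : compact K.
  apply: bounded_closed_compact.
    exists 1; split=> // M M1 t Kt /=; apply: le_trans (ltW M1).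
    by rewrite -Kt; exact: norm_le_sum_norm.
  by apply: (@closed_comp _ _ sum_norm [set 1]) => [t _|]; [exact: Ncont|exact: closed_eq].
have [M M0 fM] : exists2 M, 0 <= M & forall t, K t -> `|f t| <= M.
  have /compact_bounded[M [_ hM]] : compact (f @` K).
    by apply: continuous_compact => //; apply: continuous_subspaceT.
  exists (`|M| + 1) => [|t Kt]; first by rewrite addr_ge0.
  by apply: (hM (`|M| + 1)); [rewrite ltr_pwDr// ler_norm|exists t].
have peak s : K s -> exists2 C, 0 <= C &
    forall t, K t -> f t - eps <= f s * sum_norm t + C * dist s t.
  move=> Ks; have /cvgrPdist_le/(_ _ eps0)/nbhs_ballP[d /= d0 fd] := fc s.
  (* Within distance [d] of [s] continuity suffices; beyond it the peak contributes at least
     [2 * M], which exceeds any oscillation of [f] on the sphere. *)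
  exists ((2 * M) / d) => [|t Kt]; first by rewrite divr_ge0 ?mulr_ge0// ltW.
  have dE : dist s t = sum_norm (t - s).
    by apply: eq_bigr => j _; rewrite Kt mulr1 !mxE.
  rewrite Kt mulr1 dE; have [dst|] := ltP (sum_norm (t - s)) d.
    have /fd/= : ball s d t.
      rewrite -ball_normE /ball_/= distrC; exact: le_lt_trans (norm_le_sum_norm _) dst.
    have : 0 <= 2 * M / d * sum_norm (t - s).
      by rewrite mulr_ge0 ?sum_norm_ge0// divr_ge0 ?mulr_ge0// ltW.
    rewrite ler_norml => + /andP[]; lra.
  move=> dst; have : 2 * M <= 2 * M / d * sum_norm (t - s).
    by rewrite mulrAC ler_pdivlMr// ler_wpM2l// mulr_ge0.
  have := fM _ Ks; have := fM _ Kt; rewrite !ler_norml => /andP[? ?] /andP[? ?]; lra.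
have /choice[C HC] : forall s, exists C, K s -> 0 <= C /\
    forall t, K t -> f t - eps <= f s * sum_norm t + C * dist s t.
  move=> s; have [Ks|nKs] := pselect (K s); last by exists 0.
  by have [C C0 hC] := peak _ Ks; exists C.
pose h s t := f s * sum_norm t + C s * dist s t.
have Ah s : A (h s).
  by have := Acomb (f s) _ _ AN (AZ (C s) _ (Adist s)).
have hs s : K s -> h s s = f s.
  move=> Ks; rewrite /h /dist big1 ?mulr0 ?addr0 ?Ks ?mulr1// => j _.
  by rewrite mulr1 subrr normr0.
pose U s := [set t | h s t - f t < eps].
have Uo s : K s -> open (U s).
  move=> Ks; apply: (@open_comp _ _ (fun t => h s t - f t) [set x | x < eps]).
    move=> t _; apply: continuousB; last exact: fc.
    by have [hc _] := AH _ (Ah s); exact: hc.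
  exact: open_lt.
have KU : K `<=` cover K U by move=> s Ks; exists s => //=; rewrite /U/= hs// subrr.
have := Kcompact; rewrite compact_cover => /(_ _ _ _ Uo KU)[D DK Kcov].
have [g Ag gf] : exists2 g, A g & forall t, K t -> `|f t - g t| <= eps.
  case: D DK Kcov => l; rewrite /mem/= => ul DK Kcov.
  case: l ul DK Kcov => [ul DK Kcov|s l ul DK Kcov].
    by exists (fun=> 0) => // t /Kcov[].
  have DK' s' : s' \in s :: l -> K s' by move=> /DK/set_mem.
  have [g Ag [gl gu]] : exists2 g, A g &
      (forall t, K t -> f t - eps <= g t) /\
      forall s' t, s' \in s :: l -> g t <= h s' t.
    elim: l s DK' {ul DK Kcov} => [|s' l IH] s DK'.
      exists (h s) => //; split=> [t Kt|s' t].
        by apply: (HC s _).2 => //; apply: DK'; rewrite inE.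
      by rewrite inE => /eqP ->.
    have [|g Ag [gl gu]] := IH s'.
      by move=> s'' s''l; apply: DK'; rewrite inE s''l orbT.
    exists (fun t => Num.min (h s t) (g t)); first exact: Amin.
    split=> [t Kt|s'' t].
      rewrite le_min gl// andbT; apply: (HC s _).2 => //.
      by apply: DK'; rewrite inE eqxx.
    rewrite inE ge_min => /predU1P[->|s''l]; first by rewrite lexx.
    by rewrite gu ?orbT.
  exists g => // t Kt; have [s' /= s'l s't] := Kcov _ Kt.
  have := gu s' t s'l; have := gl _ Kt; move: s't; rewrite /U/= ler_norml; lra.
exists g => // t; have [t0|t0] := eqVneq (sum_norm t) 0.
  by rewrite (sum_norm0 t0) !homogeneous_at0 ?subrr ?normr0 ?mulr_ge0 ?sum_norm_ge0 ?(ltW eps0)//; exact: AH.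
have tp : 0 < sum_norm t by rewrite lt_def t0 sum_norm_ge0.
have [_ gh] := AH _ Ag; have [_ Nh] := AH _ AN.
pose t' := (sum_norm t)^-1 *: t.
have -> : f t - g t = sum_norm t * (f t' - g t').
  rewrite mulrBr -fh -?gh ?sum_norm_ge0//.
  by rewrite scalerA mulfV// scale1r.
rewrite normrM (ger0_norm (ltW tp)) mulrC ler_pM2r//; apply: gf.
by rewrite /K/= Nh ?invr_ge0 ?sum_norm_ge0// mulVf.
Qed.

End HomogeneousFunctions.

(** * Evaluation rules for lattice homomorphisms, and completeness of principal ideals *)

Section LatHomTheory.
Context {R : realType} {E : banachLatticeType R}.
Implicit Types (D : set E) (u v w e g : E) (a b c : R) (phi : E -> R).
Variables (D : set E) (phi : E -> R).
Hypotheses (sD : lat_subspace D) (hphi : lat_hom D phi).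

Lemma lat_homD u v : D u -> D v -> phi (u + v) = phi u + phi v.
Proof. by case: hphi => h _ _; exact: h. Qed.

Lemma lat_homZ a u : D u -> phi (a *: u) = a * phi u.
Proof. by case: hphi => _ h _; exact: h. Qed.

Lemma lat_homJ u v : D u -> D v ->
  phi (lat_join u v) = Num.max (phi u) (phi v).
Proof. by case: hphi => _ _ h; exact: h. Qed.

Lemma lat_homN u : D u -> phi (- u) = - phi u.
Proof. by move=> Du; rewrite -scaleN1r lat_homZ// mulN1r. Qed.

Lemma lat_hom_abs u : D u -> phi (lat_abs u) = `|phi u|.
Proof.
move=> Du; case: sD => _ DZ _.
rewrite /lat_abs lat_homJ ?lat_homN//; last by rewrite -scaleN1r; exact: DZ.
by case: (leP 0 (phi u)) => h; rewrite ?(ger0_norm h) ?(ltr0_norm h);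
  case: leP => //; lra.
Qed.

Lemma lat_hom_meet u v : D u -> D v ->
  phi (lat_meet u v) = Num.min (phi u) (phi v).
Proof.
move=> Du Dv; case: sD => _ DZ DJ.
have DN w : D w -> D (- w) by rewrite -scaleN1r; exact: DZ.
rewrite lat_meetE lat_homN ?lat_homJ ?lat_homN//; try exact: DN.
  by case: (leP (phi u) (phi v)) => ?; case: leP => ?; lra.
by apply: DJ; exact: DN.
Qed.

Lemma lat_hom0 : D 0 -> phi 0 = 0.
Proof. by move=> D0; have := lat_homZ 0 D0; rewrite scale0r mul0r. Qed.

Lemma lat_hom_ge0 u : D u -> lat_le 0 u -> 0 <= phi u.
Proof.
move=> Du u0; case: sD => _ DZ _.
have D0 : D 0 by rewrite -(scale0r u); exact: DZ.
by rewrite -(lat_hom0 D0); exact: lat_hom_le hphi D0 Du u0.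
Qed.

Lemma lat_hom_sum (I : Type) (r : seq I) (F : I -> E) : D 0 ->
  (forall i, D (F i)) -> phi (\sum_(i <- r) F i) = \sum_(i <- r) phi (F i).
Proof.
move=> D0 DF; case: sD => DD _ _; elim: r => [|i r IH].
  by rewrite !big_nil lat_hom0.
rewrite !big_cons lat_homD ?IH//.
by elim/big_ind : _ => //; exact: DD.
Qed.

End LatHomTheory.

Lemma lat_hom_norm_le {R : realType} {E : banachLatticeType R} (e u : E) (a : R) :
  lat_le 0 e -> ideal e u -> 0 <= a ->
  (forall phi, lat_hom (ideal e) phi -> `|phi u| <= a * phi e) ->
  `|u| <= a * `|e|.
Proof.
move=> e0 eu a0 H; have se := @ideal_subspace _ _ e.
rewrite -[leLHS]lat_abs_norm.
have -> : a * `|e| = `|a *: e| by rewrite normrZ ger0_norm.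
apply: lat_le_norm; first exact: lat_abs_ge0.
have ee := ideal_self e0.
apply: (ideal_ler e0); [exact/ideal_abs|exact: idealZ|move=> phi hphi].
by rewrite (lat_hom_abs se hphi)// (lat_homZ hphi)// H.
Qed.

(** A sequence that is Cauchy for the order-unit norm of [e] is Cauchy for the norm of [E], and
    since the order is closed the estimates in terms of [e] pass to the limit. *)
Lemma order_unit_complete {R : realType} {E : banachLatticeType R} (e : E)
    (W : nat -> E) (r : nat -> R) : lat_le 0 e -> (forall k, ideal e (W k)) ->
  (forall k, 0 < r k) -> (forall k l, (k <= l)%N -> r l <= r k) ->
  (forall eps, 0 < eps -> exists k, r k <= eps) ->
  (forall k l phi, lat_hom (ideal e) phi ->
     `|phi (W k) - phi (W l)| <= (r k + r l) * phi e) ->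
  exists2 w, ideal e w & forall k phi, lat_hom (ideal e) phi ->
    `|phi w - phi (W k)| <= 2 * r k * phi e.
Proof.
move=> e0 eW r0 rle rlim WW; have se := @ideal_subspace _ _ e.
have ee := ideal_self e0.
have nW k l : `|W k - W l| <= (r k + r l) * `|e|.
  apply: lat_hom_norm_le => //; [exact: idealB|by rewrite addr_ge0// ltW|].
  by move=> phi hphi; rewrite (lat_homB se hphi)//; exact: WW.
have small eps : 0 < eps -> exists k, 2 * r k * `|e| < eps.
  move=> eps0; have d0 : 0 < 2 * (1 + `|e|) by rewrite mulr_gt0// ltr_wpDr.
  have [k rk] := rlim _ (divr_gt0 eps0 d0); exists k.
  have : r k * (2 * (1 + `|e|)) <= eps by rewrite -ler_pdivlMr.
  have := r0 k; lra.
have cW : cauchy (W @ \oo).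
  apply: cauchy_exP => eps /small[k hk]; exists (W k), k => // l /= kl.
  rewrite -ball_normE /ball_/=; apply: le_lt_trans (nW k l) (le_lt_trans _ hk).
  by rewrite ler_wpM2r// mulr_natl mulr2n lerD2l rle.
have Ww : W @ \oo --> lim (W @ \oo) by apply/cauchy_cvgP.
set w := lim (W @ \oo) in Ww.
have close k eps : 0 < eps -> exists2 l, (k <= l)%N & `|w - W l| <= eps.
  move=> eps0; move/cvgrPdist_le : Ww => /(_ _ eps0)[m _ hm].
  by exists (maxn k m); [exact: leq_maxl|apply: hm => /=; exact: leq_maxr].
have rkl k l : (k <= l)%N -> r k + r l <= 2 * r k by move=> /rle; lra.
have phiee phi : lat_hom (ideal e) phi -> 0 <= phi e.
  by move=> hphi; exact: (lat_hom_ge0 (@ideal_subspace R E e) hphi ee e0).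
have wle k : lat_le w (W k + (2 * r k) *: e).
  apply: lat_le_closed => eps /(close k)[l kl wl]; exists (W l) => //.
  apply: (ideal_ler e0) => //; first by apply/idealD/idealZ.
  move=> phi hphi; rewrite (lat_homD hphi) ?(lat_homZ hphi)//; last exact: idealZ.
  have := WW k l _ hphi; rewrite ler_norml => /andP[+ _].
  have := ler_wpM2r (phiee _ hphi) (rkl _ _ kl); lra.
have wge k : lat_le (- w) (- W k + (2 * r k) *: e).
  apply: lat_le_closed => eps /(close k)[l kl wl].
  exists (- W l); last by rewrite opprK addrC distrC.
  apply: (ideal_ler e0); [exact: idealN|by apply: idealD; [exact: idealN|exact: idealZ]|].
  move=> phi hphi; rewrite (lat_homD hphi) ?(lat_homZ hphi) ?(lat_homN hphi)//;
    [|exact: idealN|exact: idealZ].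
  have := WW k l _ hphi; rewrite ler_norml => /andP[_].
  have := ler_wpM2r (phiee _ hphi) (rkl _ _ kl); lra.
have ew : ideal e w.
  have [b [b0 h1 h2]] := idealE (eW 0%N).
  have r00 := r0 0%N.
  apply: (@idealP _ _ _ _ (b + 2 * r 0%N)); first by rewrite addr_ge0// mulr_ge0// ltW.
    by apply: lat_trans (wle 0%N) _; rewrite scalerDl; exact: lat_leD2r.
  rewrite -lat_le_opp opprK; apply: lat_trans (wge 0%N) _; rewrite scalerDl.
  by apply: lat_leD2r; rewrite -lat_le_opp opprK.
exists w => // k phi hphi.
have := lat_hom_le hphi ew _ (wle k); have := lat_hom_le hphi (idealN ew) _ (wge k).
rewrite !(lat_homD hphi) ?(lat_homZ hphi) ?(lat_homN hphi)//;
  try exact: idealN; try exact: idealZ.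
rewrite ler_norml => /(_ (idealD (idealN (eW k)) (idealZ _ ee))) h1.
move=> /(_ (idealD (eW k) (idealZ _ ee))) h2; apply/andP; lra.
Qed.

Lemma sum_abs_ideal {R : realType} {E : banachLatticeType R} {n} (v : 'I_n -> E) :
  lat_le 0 (\sum_(j < n) lat_abs (v j)) /\
  forall j, ideal (\sum_(j < n) lat_abs (v j)) (v j).
Proof.
have s0 (P : pred 'I_n) : lat_le 0 (\sum_(j < n | P j) lat_abs (v j)).
  elim/big_ind : _ => [|x y x0 y0|j _]; first exact: lat_le_refl.
    by rewrite -(addr0 0); exact: lat_le_add.
  exact: lat_abs_ge0.
split=> [|j]; first exact: s0.
exists 1 => //; rewrite scale1r (bigD1 j)//= -[X in lat_le X _]addr0.
by apply: lat_le_add; [exact: lat_le_refl|exact: s0].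
Qed.

Section FunctionalCalculus.
Context {R : realType} {E : banachLatticeType R} {n : nat}.
Implicit Types (f g : 'rV[R]_n -> R) (v : 'I_n -> E) (e : E) (phi : E -> R).
Implicit Types (tau : ('rV[R]_n -> R) -> E).

Local Notation H := (@homogeneous_functions R n).

Lemma homogeneous_sum_norm : H (@sum_norm R n).
Proof.
rewrite /sum_norm; elim: (index_enum _) => [|j l IH].
  by under eq_fun do rewrite big_nil; exact: homogeneous0.
under eq_fun do rewrite big_cons.
have -> : (fun t : 'rV[R]_n => `|t 0 j| + \sum_(i <- l) `|t 0 i|) =
    (fun t => 1 * Num.max (t 0 j) (-1 * t 0 j + 0) + \sum_(i <- l) `|t 0 i|).
  apply/funext => t; rewrite mul1r mulN1r addr0; congr (_ + _).
  by case: (leP 0 (t 0 j)) => h; rewrite ?(ger0_norm h) ?(ltr0_norm h);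
    case: leP => //; lra.
apply: homogeneous_comb IH; apply: homogeneous_max; first exact: homogeneous_coord.
by apply: homogeneous_comb homogeneous0; exact: homogeneous_coord.
Qed.

Lemma lat_hom_restrict (D D' : set E) phi : D' `<=` D -> lat_hom D phi ->
  lat_hom D' phi.
Proof. by move=> DD [h1 h2 h3]; split=> *; [apply: h1|apply: h2|apply: h3]; exact: DD. Qed.

(** Density is applied to the functions realized by some element of the ideal of [\sum_j |v_j|];
    their closedness is [order_unit_complete]. One [w] serves every [e] because the ideal of such an
    [e] contains this one, to which homomorphisms restrict. *)
Lemma calculus_exists v f : H f -> exists w, forall e phi, lat_le 0 e ->
  (forall j, ideal e (v j)) -> lat_hom (ideal e) phi ->
  ideal e w /\ phi w = f (\row_j phi (v j)).
Proof.
move=> Hf; pose e := \sum_(j < n) lat_abs (v j).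
have [e0 ev] : lat_le 0 e /\ forall j, ideal e (v j) by exact: sum_abs_ideal.
have se := @ideal_subspace _ E e.
have phie phi : lat_hom (ideal e) phi -> phi e = sum_norm (\row_j phi (v j)).
  move=> hphi; rewrite /e (lat_hom_sum se hphi)//; first last.
  - by move=> j; apply/ideal_abs.
  - exact: ideal0.
  by apply: eq_bigr => j _; rewrite (lat_hom_abs se hphi)// mxE.
have [w [ew hw]] : exists w, ideal e w /\ forall phi, lat_hom (ideal e) phi ->
    phi w = f (\row_j phi (v j)).
  pose A := [set f | H f /\ exists w, ideal e w /\ forall phi,
    lat_hom (ideal e) phi -> phi w = f (\row_j phi (v j))].
  suff : A f by case.
  move: f Hf; apply: homogeneous_density => [f []//||j|a f g|f g|f Hf Af].
  - split; first exact: homogeneous0.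
    exists 0; split=> [|phi hphi]; first exact: ideal0.
    exact: lat_hom0 hphi (ideal0 e).
  - split; first exact: homogeneous_coord.
    by exists (v j); split=> // phi _; rewrite mxE.
  - move=> [Hf [w [ew hw]]] [Hg [w' [ew' hw']]].
    split; first exact: homogeneous_comb.
    exists (a *: w + w'); split; first by apply: idealD => //; exact: idealZ.
    move=> phi hphi; rewrite (lat_homD hphi)// ?(lat_homZ hphi)// ?hw ?hw'//.
    exact: idealZ.
  - move=> [Hf [w [ew hw]]] [Hg [w' [ew' hw']]].
    split; first exact: homogeneous_max.
    exists (lat_join w w'); split; first exact: ideal_join.
    by move=> phi hphi; rewrite (lat_homJ hphi)// hw// hw'.
  - split=> //.
    pose r k : R := k.+1%:R^-1.
    have r0 k : 0 < r k by rewrite invr_gt0.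
    have rle k l : (k <= l)%N -> r l <= r k.
      by move=> kl; rewrite lef_pV2 ?posrE// ler_nat.
    have /choice[W HW] : forall k, exists w, ideal e w /\ forall phi,
        lat_hom (ideal e) phi -> `|f (\row_j phi (v j)) - phi w| <= r k * phi e.
      move=> k; have [g [Hg [w [ew hw]]] fg] := Af _ (r0 k).
      by exists w; split=> // phi hphi; rewrite hw// phie.
    have eW k := (HW k).1.
    have rlim eps : 0 < eps -> exists k, r k <= eps.
      move=> eps0; have [k hk] := ltr_add_invr eps0.
      by exists k; rewrite add0r in hk; exact: ltW.
    have [|w ew hw] := order_unit_complete e0 eW r0 rle rlim.
      move=> k l phi hphi; have := (HW k).2 _ hphi; have := (HW l).2 _ hphi.
      rewrite !ler_norml => /andP[? ?] /andP[? ?]; lra.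
    exists w; split=> // phi hphi; apply/eqP; rewrite -subr_eq0 -normr_le0.
    apply/ler_addgt0Pr => eps eps0; rewrite add0r.
    have phie0 := lat_hom_ge0 se hphi (ideal_self e0) e0.
    have [|k rk] := rlim (eps / (3 * (1 + phi e))).
      by rewrite divr_gt0// mulr_gt0// ltr_wpDr.
    have {rk} : r k * (3 * (1 + phi e)) <= eps.
      by rewrite -ler_pdivlMr// mulr_gt0// ltr_wpDr.
    have := hw k _ hphi; have := (HW k).2 _ hphi; have := r0 k.
    have : 0 <= r k * phi e by rewrite mulr_ge0// ltW.
    rewrite !ler_norml => ? ? /andP[? ?] /andP[? ?] ?; lra.
exists w => g phi g0 gv hphi; have ge : ideal g e.
  by apply: ideal_sum => j; apply/ideal_abs.
have eg u : ideal e u -> ideal g u by exact: ideal_trans.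
by split; [exact: eg|apply: hw; exact: lat_hom_restrict hphi].
Qed.

Lemma krivine_hom_le v tau f g : krivine_hom v tau -> H f -> H g ->
  (forall t, f t <= g t) -> lat_le (tau f) (tau g).
Proof.
move=> [_ _ tmax _] Hf Hg fg; have := tmax _ _ Hf Hg.
have -> : (fun t => Num.max (f t) (g t)) = g.
  by apply/funext => t; apply/max_idPr.
by move=> ->; exact: lat_joinl.
Qed.

(** Agreement on the coordinates spreads to the lattice that they generate. Both maps are monotone,
    so an approximation within [eps * sum_norm] becomes an inequality up to [eps] times a fixed
    positive element, and the Archimedean property concludes. *)
Lemma krivine_hom_unique v tau tau' f : krivine_hom v tau ->
  krivine_hom v tau' -> H f -> tau f = tau' f.
Proof.
move=> ht ht' Hf; have HN := homogeneous_sum_norm.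
have [tc tlin tmax _] := ht; have [tc' tlin' tmax' _] := ht'.
have tau0 sg : krivine_hom v sg -> sg (fun=> 0) = 0.
  case=> _ /(_ (-1) _ _ homogeneous0 homogeneous0) + _ _.
  by rewrite scaleN1r addNr; under eq_fun do rewrite mulr0 addr0.
have tauN sg : krivine_hom v sg -> lat_le 0 (sg (@sum_norm R n)).
  move=> hs; rewrite -(tau0 _ hs); apply: krivine_hom_le hs homogeneous0 HN _.
  exact: sum_norm_ge0.
pose A := [set f | H f /\ tau f = tau' f].
suff : A f by case.
move: f Hf; apply: homogeneous_density => [f []//||j|a f g|f g|f Hf Af].
- by split; [exact: homogeneous0|rewrite !tau0].
- by split; [exact: homogeneous_coord|rewrite tc tc'].
- move=> [Hf ef] [Hg eg]; split; first exact: homogeneous_comb.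
  by rewrite tlin// tlin'// ef eg.
- move=> [Hf ef] [Hg eg]; split; first exact: homogeneous_max.
  by rewrite tmax// tmax'// ef eg.
- split=> //.
  have key sg sg' : krivine_hom v sg -> krivine_hom v sg' ->
      (forall g, A g -> sg g = sg' g) -> lat_le (sg f) (sg' f).
    move=> hs hs' ss.
    rewrite -lat_subr_ge0 -lat_le_opp oppr0 opprB.
    pose e := sg (@sum_norm R n) + sg' (@sum_norm R n).
    apply: (@lat_archimedean _ _ _ e).
      by rewrite -[0]addr0; apply: lat_le_add; exact: tauN.
    move=> eps eps0; have [g Ag fg] := Af _ eps0; have Hg := Ag.1.
    have h1 : lat_le (sg f) (eps *: sg (@sum_norm R n) + sg g).
      case: (hs) => _ slin _ _; rewrite -slin//.
      apply: krivine_hom_le hs Hf (homogeneous_comb _ HN Hg) _ => t.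
      by have := fg t; rewrite ler_norml; lra.
    have h2 : lat_le (sg' g) (eps *: sg' (@sum_norm R n) + sg' f).
      case: (hs') => _ slin _ _; rewrite -slin//.
      apply: krivine_hom_le hs' Hg (homogeneous_comb _ HN Hf) _ => t.
      by have := fg t; rewrite ler_norml; lra.
    rewrite -lat_subr_ge0 opprB addrA [_ + sg' f]addrC.
    rewrite lat_subr_ge0 /e scalerDr; apply: lat_trans h1 _.
    rewrite addrCA; apply: lat_le_add; first exact: lat_le_refl.
    by rewrite ss// addrC.
  by apply: lat_eq; apply: key => // g [].
Qed.

Lemma krivine_hom_exists v : exists2 tau, krivine_hom v tau &
  forall f, H f -> forall e phi, lat_le 0 e -> (forall j, ideal e (v j)) ->
    lat_hom (ideal e) phi ->
    ideal e (tau f) /\ phi (tau f) = f (\row_j phi (v j)).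
Proof.
pose e := \sum_(j < n) lat_abs (v j).
have [e0 ev] : lat_le 0 e /\ forall j, ideal e (v j) by exact: sum_abs_ideal.
have se := @ideal_subspace _ E e.
have /choice[tau htau] : forall f, exists w, H f -> forall e phi, lat_le 0 e ->
    (forall j, ideal e (v j)) -> lat_hom (ideal e) phi ->
    ideal e w /\ phi w = f (\row_j phi (v j)).
  move=> f; have [Hf|nHf] := pselect (H f); last by exists 0.
  by have [w hw] := calculus_exists v Hf; exists w.
have etau f : H f -> ideal e (tau f).
  (* The zero functional is a lattice homomorphism, which is enough to extract the membership. *)
  move=> Hf; apply: (htau f Hf e (fun=> 0) e0 ev _).1.
  by split=> *; rewrite ?addr0 ?mulr0 ?maxxx.
have ptau f phi : H f -> lat_hom (ideal e) phi ->
    phi (tau f) = f (\row_j phi (v j)).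
  by move=> Hf hphi; apply: (htau f Hf e phi e0 ev hphi).2.
exists tau => //; split.
- move=> j; have Hj := homogeneous_coord j.
  apply: (ideal_eqr e0) => //; first exact: etau.
  by move=> phi hphi; rewrite ptau// mxE.
- move=> a f g Hf Hg; have Hc := homogeneous_comb a Hf Hg.
  have eaf : ideal e (a *: tau f) by apply: idealZ; exact: etau.
  apply: (ideal_eqr e0); [exact: etau|by apply: idealD => //; exact: etau|].
  move=> phi hphi; rewrite ptau// (lat_homD hphi)//; last exact: etau.
  by rewrite (lat_homZ hphi) ?ptau//; exact: etau.
- move=> f g Hf Hg; have Hm := homogeneous_max Hf Hg.
  apply: (ideal_eqr e0); [exact: etau|by apply: ideal_join; exact: etau|].
  by move=> phi hphi; rewrite ptau// (lat_homJ hphi) ?ptau//; exact: etau.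
- move=> f g Hf Hg.
  have Hm : H (fun t => Num.min (f t) (g t)).
    have -> : (fun t => Num.min (f t) (g t)) =
        (fun t => -1 * Num.max (-1 * f t + 0) (-1 * g t + 0) + 0).
      apply/funext => t; rewrite !mulN1r !addr0.
      by case: (leP (f t)) => ?; case: leP => ?; lra.
    by apply: homogeneous_comb homogeneous0; apply: homogeneous_max;
      apply: homogeneous_comb homogeneous0.
  apply: (ideal_eqr e0); [exact: etau|by apply: ideal_meet; exact: etau|].
  by move=> phi hphi; rewrite ptau// (lat_hom_meet se hphi) ?ptau//; exact: etau.
Qed.

(** All later uses of the functional calculus go through this rule: homomorphisms commute with
    it. *)
Lemma krivineP v f e phi : H f -> lat_le 0 e -> (forall j, ideal e (v j)) ->
  lat_hom (ideal e) phi ->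
  ideal e (krivine v f) /\ phi (krivine v f) = f (\row_j phi (v j)).
Proof.
move=> Hf e0 ev hphi; have [tau ht tauE] := krivine_hom_exists v.
suff -> : krivine v f = tau f by exact: tauE.
rewrite /krivine; case: xgetP => [w _ [sg hs <-]|/(_ (tau f))[]]; last by exists tau.
exact: krivine_hom_unique hs ht Hf.
Qed.

End FunctionalCalculus.

(** * Daniell integration *)

Section DaniellOuterMeasure.
Context {R : realType} {T : Type}.
Variables (C : set (T -> R)) (Phi : (T -> R) -> R).
Implicit Types (f g h : T -> R) (A : set T) (c eps : R).

(** The positive cone of a Stone lattice of bounded functions. Continuity [Phi_smooth] is asked only
    along sequences that reach 0 at each point, as [max (f - F k) 0] does when [f <= 1] and [F k]
    reaches 1 on the support of [f]. By [dan_ind] every support lies in a set whose indicator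
    belongs to [C], which makes passage to complements possible. *)
Record daniell_integral : Prop := DaniellIntegral {
  dan0 : C (fun=> 0) ;
  dan_ge0 : forall f t, C f -> 0 <= f t ;
  danD : forall f g, C f -> C g -> C (fun t => f t + g t) ;
  danB : forall f g, C f -> C g -> C (fun t => Num.max (f t - g t) 0) ;
  danZ : forall c f, 0 <= c -> C f -> C (fun t => c * f t) ;
  dan_min1 : forall f, C f -> C (fun t => Num.min (f t) 1) ;
  dan_dom : forall f, C f -> exists M, forall t, f t <= M ;
  dan_ind : forall f, C f -> exists2 h, C h &
    forall t, (h t = 0 \/ h t = 1) /\ (f t != 0 -> h t = 1) ;
  Phi_ge0 : forall f, C f -> 0 <= Phi f ;
  PhiD : forall f g, C f -> C g -> Phi (fun t => f t + g t) = Phi f + Phi g ;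
  PhiZ : forall c f, 0 <= c -> C f -> Phi (fun t => c * f t) = c * Phi f ;
  Phi_smooth : forall h : nat -> T -> R, (forall k, C (h k)) ->
    (forall k t, h k.+1 t <= h k t) -> (forall t, exists k, h k t = 0) ->
    forall eps, 0 < eps -> exists k, Phi (h k) <= eps }.

Hypothesis dan : daniell_integral.

Lemma dan_eq f g : C f -> f =1 g -> C g.
Proof. by move=> Cf /funext <-. Qed.

Lemma dan_min f g : C f -> C g -> C (fun t => Num.min (f t) (g t)).
Proof.
move=> Cf Cg; apply: dan_eq (danB dan Cf (danB dan Cf Cg)) _ => t /=.
have := dan_ge0 dan t Cf; have := dan_ge0 dan t Cg.
max_lra.
Qed.

Lemma dan_sub f g : C f -> C g -> (forall t, g t <= f t) ->
  C (fun t => f t - g t).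
Proof.
move=> Cf Cg gf; apply: dan_eq (danB dan Cf Cg) _ => t /=.
by have := gf t; max_lra.
Qed.

Lemma Phi_sub f g : C f -> C g -> (forall t, g t <= f t) ->
  Phi (fun t => f t - g t) = Phi f - Phi g.
Proof.
move=> Cf Cg gf; have := PhiD dan (dan_sub Cf Cg gf) Cg.
have -> : (fun t => f t - g t + g t) = f by apply/funext => t; rewrite subrK.
lra.
Qed.

Lemma Phi_le f g : C f -> C g -> (forall t, g t <= f t) -> Phi g <= Phi f.
Proof.
move=> Cf Cg gf; have := Phi_ge0 dan (dan_sub Cf Cg gf); rewrite Phi_sub//; lra.
Qed.

Lemma Phi0 : Phi (fun=> 0) = 0.
Proof.
have := PhiD dan (dan0 dan) (dan0 dan).
have -> : (fun t : T => 0 + 0 : R) = (fun=> 0) by apply/funext => t; rewrite addr0.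
lra.
Qed.

Lemma dan_sum n (F : nat -> T -> R) : (forall k, C (F k)) ->
  C (fun t => \sum_(k < n) F k t) /\
  Phi (fun t => \sum_(k < n) F k t) = \sum_(k < n) Phi (F k).
Proof.
move=> CF; elim: n => [|n [IH1 IH2]].
  under eq_fun do rewrite big_ord0.
  by rewrite big_ord0 Phi0; split => //; exact: dan0.
under eq_fun do rewrite big_ord_recr/=.
by rewrite big_ord_recr/= -IH2; split; [exact: danD|exact: PhiD].
Qed.

Definition dan_cover A (F : nat -> T -> R) := [/\ forall k, C (F k),
  forall k t, F k t <= F k.+1 t & forall t, A t -> exists k, 1 <= F k t].

Lemma dan_cover_le A F : dan_cover A F ->
  forall k l t, (k <= l)%N -> F k t <= F l t.
Proof.
case=> _ Fk _ k l t; elim: l => [|l IH]; first by rewrite leqn0 => /eqP ->.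
rewrite leq_eqVlt => /predU1P[->//|/IH/le_trans]; apply; exact: Fk.
Qed.

Definition dan_bounds A : set R :=
  [set c | exists2 F, dan_cover A F & forall k, Phi (F k) <= c].

Definition dan_outer A : \bar R := ereal_inf (EFin @` dan_bounds A).

Lemma dan_outer_le A F c : dan_cover A F -> (forall k, Phi (F k) <= c) ->
  (dan_outer A <= c%:E)%E.
Proof. by move=> AF Fc; apply: ereal_inf_lbound; exists c => //; exists F. Qed.

Lemma dan_outer_ge A (l : \bar R) :
  (forall F c, dan_cover A F -> (forall k, Phi (F k) <= c) -> (l <= c%:E)%E) ->
  (l <= dan_outer A)%E.
Proof. by move=> H; apply: le_ereal_inf_tmp => _ [c [F AF Fc] <-]; exact: H AF Fc. Qed.

Lemma dan_outer_ge0 A : (0 <= dan_outer A)%E.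
Proof.
apply: dan_outer_ge => F c [CF _ _] Fc; rewrite lee_fin.
by apply: le_trans (Fc 0%N); exact: Phi_ge0.
Qed.

Lemma dan_outer0 : dan_outer set0 = 0%E.
Proof.
apply/le_anti; rewrite dan_outer_ge0 andbT.
apply: (@dan_outer_le _ (fun _ _ => 0)) => [|k]; last by rewrite Phi0.
by split => // k; exact: dan0.
Qed.

Lemma le_dan_outer : {homo dan_outer : A B / A `<=` B >-> (A <= B)%E}.
Proof.
move=> A B AB; apply: dan_outer_ge => F c [CF Fk BF] Fc.
by apply: dan_outer_le Fc; split=> // t /AB; exact: BF.
Qed.

Lemma dan_outer_adherent A eps : (dan_outer A < +oo)%E -> 0 < eps ->
  exists F, dan_cover A F /\ forall k, ((Phi (F k))%:E <= dan_outer A + eps%:E)%E.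
Proof.
move=> Afin eps0; have Afin' : dan_outer A \is a fin_num.
  by rewrite ge0_fin_numE// dan_outer_ge0.
have [_ [c [F AF Fc] <-] cA] := lb_ereal_inf_adherent eps0 Afin'.
by exists F; split=> // k; apply: le_trans (ltW cA); rewrite lee_fin.
Qed.

Lemma dan_outer_sigma_subadditive : sigma_subadditive dan_outer.
Proof.
move=> A; have [->|] := eqVneq (\sum_(i <oo) dan_outer (A i))%E +oo%E.
  by rewrite leey.
rewrite -ltey => Afin.
have Ai i : (dan_outer (A i) < +oo)%E.
  have h := @nneseries_lim_ge _ (dan_outer \o A) xpredT 0%N i.+1 _.
  apply: le_lt_trans Afin; apply: le_trans (h _); last first.
    by move=> *; exact: dan_outer_ge0.
  rewrite big_nat_recr//= leeDr//.
  by apply: sume_ge0 => *; exact: dan_outer_ge0.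
apply/lee_addgt0Pr => eps eps0.
have /choice[F HF] : forall i, exists F, dan_cover (A i) F /\ forall k,
    ((Phi (F k))%:E <= dan_outer (A i) + (eps / (2 ^ i.+1)%:R)%:E)%E.
  by move=> i; apply: dan_outer_adherent => //; rewrite divr_gt0// ltr0n expn_gt0.
(* A diagonal sum: each stage involves finitely many functions, so it stays in [C], and it still
   increases with [k]. *)
pose G k t := \sum_(i < k.+1) F i k t.
have CG k : C (G k) /\ Phi (G k) = \sum_(i < k.+1) Phi (F i k).
  by apply: (dan_sum k.+1 (F := fun i => F i k)) => i; have [[]] := HF i.
have FF i k l t : (k <= l)%N -> F i k t <= F i l t.
  exact: (dan_cover_le (HF i).1).
have sumfin : (\sum_(i <oo) dan_outer (A i))%E \is a fin_num.
  by rewrite ge0_fin_numE//; apply: nneseries_ge0 => *; exact: dan_outer_ge0.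
have -> : (\sum_(i <oo) dan_outer (A i) + eps%:E =
   (fine (\sum_(i <oo) dan_outer (A i)) + eps)%:E)%E by rewrite EFinD fineK.
apply: (@dan_outer_le _ G).
  split=> [k|k t|t [i _ Ait]]; first exact: (CG k).1.
    rewrite /G [leRHS]big_ord_recr/= -[leLHS]addr0 lerD//.
      by apply: ler_sum => i _; apply: FF.
    by apply: (dan_ge0 dan); have [[]] := HF k.+1.
  have [[CF Fk /(_ _ Ait)[k Fikt]] _] := HF i.
  exists (maxn i k); rewrite /G.
  have ik : (i < (maxn i k).+1)%N by rewrite ltnS leq_maxl.
  rewrite (bigD1 (Ordinal ik))//= -[leLHS]addr0 lerD//.
    by apply: le_trans Fikt _; apply: FF; exact: leq_maxr.
  by apply: sumr_ge0 => j _; apply: (dan_ge0 dan); have [[]] := HF j.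
move=> k; rewrite (CG k).2 -lee_fin EFinD fineK// -sumEFin.
apply: (@le_trans _ _ (\sum_(0 <= i < k.+1)
    (dan_outer (A i) + (eps / (2 ^ i.+1)%:R)%:E))%E).
  by rewrite big_mkord; apply: lee_sum => i _; have [_] := HF i; apply.
apply: le_trans (epsilon_trick _ _ (ltW eps0)); last first.
  by move=> i; exact: dan_outer_ge0.
apply: nneseries_lim_ge => i _ _; apply: adde_ge0; first exact: dan_outer_ge0.
by rewrite lee_fin divr_ge0// ltW.
Qed.

(** These sets play the part of the open sets: they are measurable, and the sets [c < f t] with [f]
    in [C] are among them. *)
Definition dan_open A := exists g : nat -> T -> R, [/\ forall k, C (g k),
  forall k t, g k t <= g k.+1 t, forall t, A t -> exists k, 1 <= g k t &
  forall t k, ~ A t -> g k t = 0].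

(** A cover [F] of [X] splits: the functions [min (F k) (g k)] cover [X] inside [A], and
    [F k - min (F k) (g l)] with one fixed [l] cover [X] outside [A], where [g l] vanishes. If some
    [Phi (min (F k) (g l))] is within [eps] of the supremum of all such values, the two costs add up
    to at most [c + eps]. *)
Lemma dan_open_caratheodory A X : dan_open A ->
  (dan_outer (X `&` A) + dan_outer (X `&` ~` A) <= dan_outer X)%E.
Proof.
move=> [g [Cg gk gA gA0]]; apply: dan_outer_ge => F c XF Fc.
have [CF Fk FX] := XF.
have gg k l t : (k <= l)%N -> g k t <= g l t.
  elim: l => [|l IH]; first by rewrite leqn0 => /eqP ->.
  by rewrite leq_eqVlt => /predU1P[->//|/IH/le_trans]; apply; exact: gk.
have FF := dan_cover_le XF.
pose mn k l t := Num.min (F k t) (g l t).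
have Cmn k l : C (mn k l) by exact: dan_min.
pose S : set R := [set x | exists k l, x = Phi (mn k l)].
have mnc k l : Phi (mn k l) <= c.
  by apply: le_trans (Fc k); apply: Phi_le => // t; rewrite ge_min lexx.
have infS : has_sup S.
  by split; [exists (Phi (mn 0%N 0%N)), 0%N, 0%N|exists c => _ [k [l ->]]].
have Sub k l : Phi (mn k l) <= sup S.
  by apply: ub_le_sup; [case: infS|exists k, l].
have h1 : (dan_outer (X `&` A) <= (sup S)%:E)%E.
  apply: (@dan_outer_le _ (fun k => mn k k)) => [|k]; last exact: Sub.
  split=> // [k t|t [/FX[k Fkt] /gA[l glt]]].
    by rewrite /mn; have := Fk k t; have := gk k t; max_lra.
  exists (maxn k l); rewrite le_min (le_trans Fkt) ?FF ?leq_maxl//.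
  by rewrite (le_trans glt)// gg// leq_maxr.
suff h2 : (dan_outer (X `&` ~` A) <= (c - sup S)%:E)%E.
  by apply: le_trans (leeD h1 h2) _; rewrite -EFinD subrKC.
apply/lee_addgt0Pr => eps eps0.
have [_ [k0 [l0 ->]] hS] := sup_adherent eps0 infS.
rewrite -EFinD; apply: (@dan_outer_le _ (fun k t => Num.max (F k t - g l0 t) 0)).
  split=> [k|k t|t [/FX[k Fkt] At]]; first exact: danB.
    by have := Fk k t; max_lra.
  by exists k; rewrite gA0// subr0; max_lra.
move=> k; pose l := maxn k k0.
have -> : (c - sup S + eps = c - (sup S - eps)) by ring.
have <- : (fun t => F k t - mn k l0 t) = (fun t => Num.max (F k t - g l0 t) 0).
  by apply/funext => t; rewrite /mn; max_lra.
apply: (@le_trans _ _ (Phi (fun t => F l t - mn l l0 t))).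
  apply: Phi_le; [apply: dan_sub => // t|apply: dan_sub => // t|move=> t];
    rewrite /mn ?ge_min ?lexx//.
  by have := FF k l t (leq_maxl _ _); max_lra.
rewrite Phi_sub//; last by move=> t; rewrite /mn ge_min lexx.
rewrite lerB// (le_trans (ltW hS))//; apply: Phi_le => // t.
by rewrite /mn; have := FF k0 l t (leq_maxr _ _); max_lra.
Qed.

Lemma dan_trunc c f : 0 <= c -> C f -> C (fun t => Num.min (f t) c).
Proof.
rewrite le_eqVlt => /predU1P[<-|c0] Cf.
  apply: dan_eq (dan0 dan) _ => t; apply/esym/min_idPr; exact: (dan_ge0 dan).
have ci : 0 <= c^-1 by rewrite invr_ge0 ltW.
apply: dan_eq (danZ dan (ltW c0) (dan_min1 dan (danZ dan ci Cf))) _ => t /=.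
by rewrite minr_pMr ?(ltW c0)// mulr1 mulrA mulfV ?mul1r// gt_eqF.
Qed.

Lemma dan_open_gt f c : 0 <= c -> C f -> dan_open [set t | c < f t].
Proof.
move=> c0 Cf; pose h t := f t - Num.min (f t) c.
have Ch : C h.
  by apply: dan_sub => //; [exact: dan_trunc|move=> t; rewrite ge_min lexx].
exists (fun k t => Num.min (k%:R * h t) 1).
have h0 t : 0 <= h t by exact: (dan_ge0 dan).
split=> [k|k t|t/=|t k /negP/=].
- by apply: (dan_min1 dan); exact: danZ.
- have : k%:R * h t <= k.+1%:R * h t by rewrite ler_wpM2r// ler_nat.
  by max_lra.
- move=> cf; have hp : 0 < h t by rewrite /h; max_lra.
  have [k hk] := ltr_add_invr hp; exists k.+1; rewrite le_min lexx andbT.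
  by rewrite mulrC -ler_pdivrMr// mul1r -[leLHS]add0r ltW.
- rewrite -leNgt => fc; have -> : h t = 0 by rewrite /h; max_lra.
  by rewrite mulr0; max_lra.
Qed.

Lemma dan_outer_le_Phi A f : C f -> (forall t, A t -> 1 <= f t) ->
  (dan_outer A <= (Phi f)%:E)%E.
Proof. by move=> Cf Af; apply: (@dan_outer_le _ (fun=> f)) => //; split=> // t /Af; exists 0%N. Qed.

(** The continuity of [Phi] enters here: for a cover [F] of [A], the functions [max (f - F k) 0]
    decrease and reach 0 at every point. *)
Lemma Phi_le_dan_outer A f : C f -> (forall t, f t <= 1) ->
  (forall t, ~ A t -> f t = 0) -> ((Phi f)%:E <= dan_outer A)%E.
Proof.
move=> Cf f1 fA; apply: dan_outer_ge => F c AF Fc; rewrite lee_fin.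
have [CF Fk FA] := AF.
apply/ler_addgt0Pr => eps eps0.
have [||k hk] := Phi_smooth dan (fun k => danB dan Cf (CF k)) _ _ eps0.
- by move=> k t; have := Fk k t; max_lra.
- move=> t; have [/FA[k Fkt]|/fA ft0] := pselect (A t).
    by exists k; have := f1 t; max_lra.
  by exists 0%N; rewrite ft0; have := dan_ge0 dan t (CF 0%N); max_lra.
have Cfk := danB dan Cf (CF k).
have : Phi f <= Phi (fun t => F k t + Num.max (f t - F k t) 0).
  by apply: Phi_le => //; [exact: danD|move=> t; max_lra].
by rewrite PhiD//; have := Fc k; lra.
Qed.

Lemma dan_outer_measure : exists mu : {outer_measure set T -> \bar R},
  forall A, mu A = dan_outer A.
Proof.
pose mu : {outer_measure set T -> \bar R} := HB.pack dan_outer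
  (isOuterMeasure.Build R T dan_outer dan_outer0 dan_outer_ge0 le_dan_outer
    dan_outer_sigma_subadditive).
by exists mu.
Qed.

End DaniellOuterMeasure.

(** * The Caratheodory measure, its integral, and density *)

Section DaniellIntegral.
Context {R : realType} {T : pointedType}.
Variables (C : set (T -> R)) (Phi : (T -> R) -> R).
Hypothesis dan : daniell_integral C Phi.
Variable mu : {outer_measure set T -> \bar R}.
Hypothesis muE : forall A, mu A = dan_outer C Phi A.
Implicit Types (f g h : T -> R) (c eps : R).

Local Notation U := (caratheodory_type mu).
Local Notation mes := (mu : set U -> \bar R).

Let dan_open_measurable (A : set U) : dan_open C A -> measurable A.
Proof.
move=> oA; apply: le_caratheodory_measurable => X; rewrite !muE.
exact: dan_open_caratheodory.
Qed.

Lemma dan_measurable_gt f c : 0 <= c -> C f -> measurable ([set t | c < f t] : set U).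
Proof. by move=> c0 Cf; exact/dan_open_measurable/(dan_open_gt dan). Qed.

Lemma dan_measurable_fun f : C f -> measurable_fun [set: U] (f : U -> R).
Proof.
move=> Cf; apply: (measurability (@RGenOInfty.G R)).
  exact: RGenOInfty.measurableE.
move=> _ [_ [x ->] <-]; rewrite setTI.
have -> : f @^-1` `]x, +oo[ = [set t | x < f t].
  by apply/seteqP; split => t /=; rewrite in_itv/= andbT.
have [x0|x0] := leP 0 x; first exact: dan_measurable_gt.
rewrite (_ : [set t | _] = setT); first exact: measurableT.
by apply/seteqP; split => // t _ /=; apply: lt_le_trans x0 _; exact: (dan_ge0 dan).
Qed.

Let indic_gt c f t : \1_([set t | c < f t]) t = (c < f t)%R%:R :> R.
Proof.
by rewrite indicE; congr (_%:R); congr nat_of_bool; apply/idP/idP; rewrite inE.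
Qed.

Let integral f := (\int[mes]_(t in setT) (f t)%:E)%E.

(** Layer cake with layers [fk k] of height [d = 1 / (n + 1)]. Since [fk k] equals [d] on [A k.+1],
    the measure of [A k.+1] is at most [(n + 1) * Phi (fk k)]. The integral of [f] is at most [d]
    times the sum of the measures of the [A k]; the shift of the index leaves over the lowest set
    [A 0], which costs [d * Phi h]. *)
Let integral_le n f h : C f -> C h -> (forall t, f t <= 1) ->
  (forall t, f t != 0 -> h t = 1) ->
  (integral f <= (Phi f + n.+1%:R^-1 * Phi h)%:E)%E.
Proof.
move=> Cf Ch f1 fh.
have [q [d [d0 q_0 qS qn dE]]] : exists (q : nat -> R) d, [/\ 0 < d, q 0%N = 0,
    forall k, q k.+1 = q k + d, q n.+1 = 1 & d = n.+1%:R^-1].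
  exists (fun k => k%:R / n.+1%:R), n.+1%:R^-1; split=> //.
  - by rewrite mul0r.
  - by move=> k; rewrite -natr1 mulrDl mul1r.
  - by rewrite mulfV// pnatr_eq0.
have q0 k : 0 <= q k.
  by elim: k => [|k IH]; rewrite ?q_0// qS addr_ge0// ltW.
pose m (k : nat) t := Num.min (f t) (q k).
pose fk (k : nat) t := m k.+1 t - m k t.
pose A (k : nat) : set U := [set t | q k < f t].
have Cm k : C (m k) by exact: (dan_trunc dan).
have mm k t : m k t <= m k.+1 t by rewrite /m qS; max_lra.
have Cfk k : C (fk k) by exact: (dan_sub dan).
have fE : f = (fun t => \sum_(k < n.+1) fk k t).
  apply/funext => t; rewrite -(big_mkord xpredT (fun k => fk k t)).
  rewrite telescope_sumr// /m qn q_0 (min_idPl (f1 t)).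
  have := dan_ge0 dan t Cf; max_lra.
have mA k : measurable (A k) by exact: dan_measurable_gt.
have muA0 : (mes (A 0%N) <= (Phi h)%:E)%E.
  rewrite muE; apply: (@dan_outer_le_Phi _ _ C Phi (A 0%N) h Ch) => t; rewrite /A/= q_0 => ft0.
  by rewrite fh// gt_eqF.
have muA k : (mes (A k.+1) <= (n.+1%:R * Phi (fk k))%:E)%E.
  rewrite muE -(PhiZ dan)//; apply: dan_outer_le_Phi; first exact: (danZ dan).
  move=> t; rewrite /A/= /fk /m qS => h1.
  by rewrite mulrC -ler_pdivrMr// mul1r -dE; move: h1; max_lra.
apply: (@le_trans _ _ (\sum_(k < n.+1) (d)%:E * mes (A k)))%E.
  have -> : (\sum_(k < n.+1) (d)%:E * mes (A k) =
      \int[mes]_(t in setT) (\sum_(k < n.+1) (d)%:E * (\1_(A k) t)%:E))%E.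
    rewrite ge0_integral_sum//.
    - apply: eq_bigr => k _; rewrite ge0_integralZl_EFin//.
      + by rewrite integral_indic// setIT.
      + by apply/measurable_EFinP; exact: measurable_indic.
      + exact: ltW.
    - move=> k; apply: measurable_funeM.
      by apply/measurable_EFinP; exact: measurable_indic.
    - by move=> k t _; rewrite mule_ge0// lee_fin ?ltW.
  apply: ge0_le_integral => //.
  - by move=> t _; rewrite lee_fin; exact: (dan_ge0 dan).
  - by apply/measurable_EFinP; exact: dan_measurable_fun.
  - apply: emeasurable_sum => k; apply: measurable_funeM.
    by apply/measurable_EFinP; exact: measurable_indic.
  - move=> t _; rewrite [in leLHS]fE.
    under [leRHS]eq_bigr do rewrite -EFinM.
    rewrite sumEFin lee_fin; apply: ler_sum => k _.
    rewrite /fk /m qS indic_gt.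
    by case: (ltP (q k) (f t)) => ?; rewrite ?mulr1 ?mulr0; max_lra.
rewrite big_ord_recl/=.
apply: (@le_trans _ _ ((d * Phi h)%:E + \sum_(k < n) (Phi (fk k))%:E))%E.
  apply: leeD; first by rewrite EFinM lee_wpmul2l// lee_fin ltW.
  apply: lee_sum => k _.
  have -> : (Phi (fk k))%:E = ((d)%:E * (n.+1%:R * Phi (fk k))%:E)%E.
    by rewrite -EFinM mulrA dE mulVf ?mul1r// pnatr_eq0.
  by rewrite lee_wpmul2l ?muA// lee_fin ltW.
rewrite -dE sumEFin -EFinD lee_fin addrC lerD2r.
rewrite [in leRHS]fE (dan_sum dan _ Cfk).2 big_ord_recr/= lerDl.
exact: (Phi_ge0 dan).
Qed.

Let integral_le1 f : C f -> (forall t, f t <= 1) -> (integral f <= (Phi f)%:E)%E.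
Proof.
move=> Cf f1; have [h Ch hf] := dan_ind dan Cf.
apply/lee_addgt0Pr => eps eps0; have Ph := Phi_ge0 dan Ch.
have d0 : 0 < eps / (1 + Phi h) by rewrite divr_gt0// ltr_wpDr.
have [n hn] := ltr_add_invr d0.
apply: le_trans (@integral_le n f h Cf Ch f1 _) _; first by move=> t /(hf t).2.
rewrite -EFinD lee_fin lerD2l; rewrite add0r in hn.
apply: (@le_trans _ _ (eps / (1 + Phi h) * Phi h)).
  by rewrite ler_wpM2r// ltW.
by rewrite -mulrA ler_piMr ?(ltW eps0)// mulrC ler_pdivrMr ?mul1r ?lerDr ?ltr_wpDr.
Qed.

(** The upper bound applied to [h - g], with [h] an indicator in [C] above [g], yields the lower
    bound for [g], because the integral of [h] is at least [Phi h]. A general [f] is first scaled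
    below 1. *)
Lemma dan_integral f : C f -> integral f = (Phi f)%:E.
Proof.
move=> Cf.
have H1 g : C g -> (forall t, g t <= 1) -> integral g = (Phi g)%:E.
  move=> Cg g1; apply/le_anti; rewrite integral_le1//=.
  have [h Ch hg] := dan_ind dan Cg.
  have gh t : g t <= h t.
    have [[ht|ht] hgt] := hg t; last by rewrite ht.
    rewrite ht; have [->//|/hgt] := eqVneq (g t) 0; rewrite ht => /esym/eqP.
    by rewrite oner_eq0.
  have h1 t : h t <= 1 by have [[->|->] _] := hg t.
  have Chg := dan_sub dan Ch Cg gh.
  have : (integral h <= (Phi h - Phi g)%:E + integral g)%E.
    have -> : integral h = (integral (fun t => h t - g t)%R + integral g)%E.
      rewrite /integral -ge0_integralD//.
      - by apply: eq_integral => t _; rewrite -EFinD subrK.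
      - by move=> t _; rewrite lee_fin; exact: (dan_ge0 dan t Chg).
      - by apply/measurable_EFinP; exact: dan_measurable_fun.
      - by move=> t _; rewrite lee_fin (dan_ge0 dan).
      - by apply/measurable_EFinP; exact: dan_measurable_fun.
    rewrite leeD2r// -(Phi_sub dan)//; apply: integral_le1 => // t.
    by rewrite lerBlDr; apply: le_trans (h1 t) _; rewrite lerDl (dan_ge0 dan).
  have : ((Phi h)%:E <= integral h)%E.
    pose B : set U := [set t | 0 < h t].
    have mB : measurable B by exact: dan_measurable_gt.
    have -> : integral h = mes B.
      rewrite -[B]setIT -integral_indic//; apply: eq_integral => t _.
      by rewrite indic_gt; have [[->|->] _] := hg t; rewrite ?ltxx ?ltr01.
    rewrite muE; apply: (Phi_le_dan_outer dan) => // t /negP; rewrite -leNgt => h0.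
    by apply/le_anti; rewrite h0 (dan_ge0 dan).
  move=> a1 a2; have := le_trans a1 a2.
  have ig : integral g \is a fin_num.
    rewrite ge0_fin_numE; first exact: le_lt_trans (integral_le1 Cg g1) (ltry _).
    by apply: integral_ge0 => t _; rewrite lee_fin (dan_ge0 dan).
  by rewrite -(fineK ig) -EFinD !lee_fin; lra.
have [M fM] := dan_dom dan Cf.
pose M' := `|M| + 1.
have M0 : 0 < M' by rewrite ltr_wpDl.
have CM : C (fun t => M'^-1 * f t) by apply: (danZ dan) => //; rewrite invr_ge0 ltW.
have fE t : f t = M' * (M'^-1 * f t) by rewrite mulrA mulfV ?mul1r// gt_eqF.
have -> : integral f = (M'%:E * integral (fun t => M'^-1 * f t)%R)%E.
  rewrite /integral -ge0_integralZl_EFin//; last by rewrite ltW.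
  - by apply: eq_integral => t _; rewrite -EFinM -fE.
  - by move=> t _; rewrite lee_fin; exact: (dan_ge0 dan t CM).
  - by apply/measurable_EFinP; exact: dan_measurable_fun.
rewrite H1//.
  by rewrite -EFinM -(PhiZ dan)// ?ltW//; congr (EFin (Phi _)); apply/funext => t; rewrite -fE.
move=> t; rewrite mulrC ler_pdivrMr// mul1r; apply: le_trans (fM t) _.
by rewrite (le_trans (ler_norm _))// lerDl.
Qed.

Lemma dan_dense (A : set U) eps : measurable A -> (mes A < +oo)%E -> 0 < eps ->
  exists f, [/\ C f, forall t, f t <= 1 &
    (\int[mes]_(t in setT) (`|f t - \1_A t|)%:E <= eps%:E)%E].
Proof.
move=> mA Afin eps0; have e3 : 0 < eps / 3 by rewrite divr_gt0.
have Afin' : (dan_outer C Phi A < +oo)%E by rewrite -muE.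
have [F [[CF Fk FA] Fc]] := dan_outer_adherent dan Afin' e3.
pose G k t := Num.min (F k t) 1.
have CG k : C (G k) by exact: (dan_min1 dan).
have G0 k t : 0 <= G k t by exact: (dan_ge0 dan).
have G1 k t : G k t <= 1 by rewrite ge_min lexx orbT.
have mG k : measurable_fun setT (G k : U -> R) by exact: dan_measurable_fun.
have iG k : (integral (G k) <= mes A + (eps / 3)%:E)%E.
  rewrite dan_integral// muE; apply: le_trans (Fc k); rewrite lee_fin.
  by apply: (Phi_le dan) => // t; rewrite ge_min lexx.
have Anum : mes A \is a fin_num by rewrite ge0_fin_numE// measure_ge0.
have mGA k : measurable_fun setT (fun t : U => (G k t * \1_A t)%:E).
  apply/measurable_EFinP; apply: measurable_funM => //; exact: measurable_indic.
have GA0 k t : (0 <= (G k t * \1_A t)%:E)%E by rewrite lee_fin mulr_ge0.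
have [k hk] : exists k, (mes A - (eps / 3)%:E <=
    \int[mes]_(t in setT) (G k t * \1_A t)%:E)%E.
  have : (\int[mes]_(t in setT) (G k t * \1_A t)%:E)%E @[k --> \oo] --> mes A.
    have -> : mes A = (\int[mes]_(t in setT) (limn (fun k => (G k t * \1_A t)%:E)))%E.
      rewrite -[A in LHS]setIT -integral_indic//; apply: eq_integral => t _.
      apply/esym/cvg_lim => //; apply: cvg_near_cst.
      rewrite indicE; have [/set_mem At|At] := boolP (t \in A); last first.
        by near=> k; rewrite mulr0.
      have [k Fkt] := FA _ At; exists k => // l /= kl; rewrite mulr1.
      rewrite /G; congr EFin; apply/min_idPr; apply: le_trans Fkt _.
      elim: l kl => [|l IH]; first by rewrite leqn0 => /eqP ->.
      by rewrite leq_eqVlt => /predU1P[->//|/IH/le_trans]; apply; exact: Fk.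
    apply: cvg_monotone_convergence => // t _ k l kl; rewrite lee_fin ler_wpM2r//.
    elim: l kl => [|l IH]; first by rewrite leqn0 => /eqP ->.
    rewrite leq_eqVlt => /predU1P[->//|/IH/le_trans]; apply.
    by have := Fk l t; rewrite /G; max_lra.
  move=> cvgA; have lt : (mes A - (eps / 3)%:E < mes A)%E.
    by rewrite -(fineK Anum) -EFinB lte_fin ltrBlDr ltrDl.
  have /cvgA[k _ /(_ k (leqnn _))] : nbhs (mes A) [set y | mes A - (eps / 3)%:E < y]%E.
    by apply: open_nbhs_nbhs; split => //; exact: open_ereal_gt_ereal.
  by exists k; exact: ltW.
exists (G k); split=> //.
have mI : measurable_fun setT (fun t : U => (\1_A t : R)) by exact: measurable_indic.
set I := (X in (X <= _)%E).
(* For [0 <= G <= 1] one has [|G - 1_A| + 2 G 1_A = G + 1_A]. One third of [eps] is lost on the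
   integral of [G k], and two thirds on the doubled integral of [G k] over [A]. *)
have : (I + 2%:E * \int[mes]_(t in setT) (G k t * \1_A t)%:E = integral (G k) + mes A)%E.
  rewrite -[A in RHS]setIT -[X in (_ = _ + X)%E]integral_indic//.
  rewrite /I /integral -ge0_integralZl_EFin// -!ge0_integralD//.
  - apply: eq_integral => t _; rewrite -EFinM -!EFinD; congr EFin.
    have := G0 k t; have := G1 k t; rewrite indicE; case: (t \in A) => /=.
      by move=> g1 g0; rewrite mulr1 ler0_norm ?subr_le0//; lra.
    by move=> g1 g0; rewrite subr0 mulr0 ger0_norm//; lra.
  - by move=> t _; rewrite lee_fin.
  - exact/measurable_EFinP.
  - exact/measurable_EFinP.
  - by apply/measurable_EFinP; apply: measurableT_comp => //; exact: measurable_funB.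
  - by move=> t _; rewrite mule_ge0// GA0.
  - exact: measurable_funeM.
have iGfin : integral (G k) \is a fin_num by rewrite dan_integral.
have iGAfin : (\int[mes]_(t in setT) (G k t * \1_A t)%:E)%E \is a fin_num.
  rewrite ge0_fin_numE; last by apply: integral_ge0 => t _.
  apply: le_lt_trans Afin; rewrite -[A in leRHS]setIT -integral_indic//.
  apply: ge0_le_integral => //; first exact/measurable_EFinP.
  by move=> t _; rewrite lee_fin ler_piMl.
move: (iG k) hk; clearbody I.
rewrite -(fineK Anum) -(fineK iGfin) -(fineK iGAfin) -EFinM.
case: I => [I| |]//; rewrite -!EFinD -?EFinB !lee_fin => + + [].
by lra.
Unshelve. all: by end_near. Qed.

End DaniellIntegral.

(** * Concavification of a Banach lattice *)

Section PowerSums.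
Context {R : realType}.
Implicit Types (r s t a b : R).

Lemma powRK r a : 0 < r -> 0 <= a -> (a `^ r) `^ r^-1 = a.
Proof. by move=> r0 a0; rewrite -powRrM mulfV ?powRr1// gt_eqF. Qed.

Lemma powRVK r a : 0 < r -> 0 <= a -> (a `^ r^-1) `^ r = a.
Proof. by move=> r0 a0; rewrite -powRrM mulVf ?powRr1// gt_eqF. Qed.

Lemma powR_le r a b : 0 < r -> 0 <= a -> 0 <= b -> (a `^ r <= b `^ r) = (a <= b).
Proof.
move=> r0 a0 b0; apply/idP/idP => [|ab].
  by move=> /(ge0_ler_powR (ltW (_ : 0 < r^-1))); rewrite !nnegrE !powR_ge0 !powRK// invr_gt0; exact.
by apply: ge0_ler_powR; rewrite ?nnegrE// ltW.
Qed.

Lemma powR_max r a b : 0 < r -> 0 <= a -> 0 <= b ->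
  (Num.max a b) `^ r = Num.max (a `^ r) (b `^ r).
Proof.
move=> r0 a0 b0; case: (leP a b) => ab; first by rewrite (max_idPr _)// powR_le.
by rewrite (max_idPl _)// powR_le// ltW.
Qed.

Lemma powR_min r a b : 0 < r -> 0 <= a -> 0 <= b ->
  (Num.min a b) `^ r = Num.min (a `^ r) (b `^ r).
Proof.
move=> r0 a0 b0; case: (leP a b) => ab; first by rewrite (min_idPl _)// powR_le.
by rewrite (min_idPr _)// powR_le// ltW.
Qed.

Lemma continuous_norm_powR r : 0 < r -> continuous (fun a : R => `|a| `^ r).
Proof.
move=> r0 a; have [->|a0] := eqVneq a 0.
  apply/cvgrPdist_le => eps eps0; rewrite normr0 powR0 ?gt_eqF//.
  have d0 : 0 < eps `^ r^-1 by exact: powR_gt0.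
  exists (eps `^ r^-1) => //= b; rewrite /ball_/= !sub0r !normrN => hb.
  rewrite ger0_norm ?powR_ge0//.
  rewrite -(powRVK r0 (ltW eps0)) powR_le ?powR_ge0//; exact: ltW.
have h : {for `|a|, continuous (fun b : R => b `^ r)}.
  apply: differentiable_continuous; apply/derivable1_diffP.
  by apply: derivable_powR; rewrite in_itv/= andbT normr_gt0.
have h1 : {for a, continuous (fun b : R => `|b|)} by exact: norm_continuous.
exact: (continuous_comp h1 h).
Qed.

Lemma psum_ge0 r n (lam a : 'I_n -> R) : 0 <= psum r%:E lam a.
Proof. exact: powR_ge0. Qed.

Lemma psum_powR r n (lam a : 'I_n -> R) : 0 < r -> (forall j, 0 <= lam j) ->
  psum r%:E lam a `^ r = \sum_(j < n) lam j * `|a j| `^ r.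
Proof.
move=> r0 lam0; rewrite /= powRVK//.
by apply: sumr_ge0 => j _; rewrite mulr_ge0// powR_ge0.
Qed.

Lemma homogeneous_psum r n (lam : 'I_n -> R) : 0 < r ->
  (forall j, 0 <= lam j) ->
  homogeneous_functions (fun t : 'rV[R]_n => psum r%:E lam (fun j => t 0 j)).
Proof.
move=> r0 lam0; split=> [t|a t a0] /=.
  have H : continuous ((fun u : 'rV[R]_n => \sum_(j < n) lam j * `|u 0 j| `^ r) : 'rV[R]_n -> R).
    elim: (index_enum _) => [|j l IH].
      by under eq_fun do rewrite big_nil; exact: cst_continuous.
    under eq_fun do rewrite big_cons.
    move=> u; apply: (@continuousD R R^o _ (fun u : 'rV[R]_n => lam j * `|u 0 j| `^ r)
      (fun u : 'rV[R]_n => \sum_(i <- l) lam i * `|u 0 i| `^ r)); last exact: IH.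
    apply: (@continuousM R _ (fun=> lam j)); first exact: cst_continuous.
    apply: (@continuous_comp _ _ _ (fun t : 'rV[R]_n => t 0 j) (fun b => `|b| `^ r)).
      exact: coord_continuous.
    exact: continuous_norm_powR.
  have -> : (fun t : 'rV[R]_n => (\sum_(j < n) lam j * `|t 0 j| `^ r) `^ r^-1) =
      (fun b => `|b| `^ r^-1) \o (fun t : 'rV[R]_n => \sum_(j < n) lam j * `|t 0 j| `^ r).
    apply/funext => u /=; rewrite ger0_norm//.
    by apply: sumr_ge0 => j _; rewrite mulr_ge0// powR_ge0.
  apply: continuous_comp; first exact: H.
  by apply: continuous_norm_powR; rewrite invr_gt0.
have -> : \sum_(j < n) lam j * `|(a *: t) 0 j| `^ r =
    a `^ r * \sum_(j < n) lam j * `|t 0 j| `^ r.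
  rewrite mulr_sumr; apply: eq_bigr => j _; rewrite mxE normrM (ger0_norm a0).
  by rewrite powRM// mulrCA.
rewrite powRM ?powR_ge0 ?powRK//.
by apply: sumr_ge0 => j _; rewrite mulr_ge0// powR_ge0.
Qed.

Definition pow_diff r (t : 'rV[R]_2) : R :=
  (Num.max (`|t 0 0| `^ r - `|t 0 1| `^ r) 0) `^ r^-1.

Lemma homogeneous_pow_diff r : 0 < r -> homogeneous_functions (pow_diff r).
Proof.
move=> r0; have nn (u : 'rV[R]_2) : 0 <= Num.max (`|u 0 0| `^ r - `|u 0 1| `^ r) 0.
  by rewrite le_max lexx orbT.
split=> [t|a t a0].
  have -> : pow_diff r = (fun b => `|b| `^ r^-1) \o
      (fun t : 'rV[R]_2 => Num.max (`|t 0 0| `^ r - `|t 0 1| `^ r) 0).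
    by apply/funext => u /=; rewrite ger0_norm.
  apply: continuous_comp; last first.
    by apply: continuous_norm_powR; rewrite invr_gt0.
  have c j (u : 'rV[R]_2) : {for u, continuous (fun t : 'rV[R]_2 => `|t 0 j| `^ r)}.
    apply: (@continuous_comp _ _ _ (fun t : 'rV[R]_2 => t 0 j) (fun b => `|b| `^ r)).
      exact: coord_continuous.
    exact: continuous_norm_powR.
  apply: continuous_max; last exact: cst_continuous.
  by apply: (@continuousB R R^o); exact: c.
rewrite /pow_diff !mxE !normrM (ger0_norm a0) !powRM// -mulrBr.
have -> : Num.max (a `^ r * (`|t 0 0| `^ r - `|t 0 1| `^ r)) 0 =
    a `^ r * Num.max (`|t 0 0| `^ r - `|t 0 1| `^ r) 0.
  by rewrite maxr_pMr ?powR_ge0// mulr0.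
by rewrite powRM ?powR_ge0 ?powRK.
Qed.

End PowerSums.

(** * Sums and differences of r-th powers in a lattice *)

Section LatticePowers.
Context {R : realType} {E : banachLatticeType R}.
Variable r : R.
Hypothesis r0 : 0 < r.
Implicit Types (u v w e g : E) (phi : E -> R).

Lemma lat_psumP n (lam : 'I_n -> R) (v : 'I_n -> E) e phi :
  (forall j, 0 <= lam j) -> lat_le 0 e -> (forall j, ideal e (v j)) ->
  lat_hom (ideal e) phi -> ideal e (lat_psum r%:E lam v) /\
  phi (lat_psum r%:E lam v) = psum r%:E lam (phi \o v).
Proof.
move=> lam0 e0 ev hphi.
have [ek ->] := krivineP (homogeneous_psum r0 lam0) e0 ev hphi.
split; first exact: ek.
by rewrite /psum; congr (_ `^ _); apply: eq_bigr => j _; rewrite mxE.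
Qed.

(* [padd u v] and [psub u v] are [(u^r + v^r)^(1/r)] and
   [((u^r - v^r)^+)^(1/r)], the addition and the truncated subtraction of the
   r-concavification of [E]. *)
Definition padd u v : E :=
  lat_psum r%:E (fun=> 1) (fun i : 'I_2 => if i == 0 then u else v).

Definition psub u v : E :=
  krivine (fun i : 'I_2 => if i == 0 then u else v) (pow_diff r).

Lemma ideal_psum n (lam : 'I_n -> R) (v : 'I_n -> E) e : (forall j, 0 <= lam j) ->
  lat_le 0 e -> (forall j, ideal e (v j)) -> ideal e (lat_psum r%:E lam v).
Proof.
move=> lam0 e0 ev; apply: (lat_psumP lam0 e0 ev (phi := fun=> 0) _).1.
by split=> *; rewrite ?addr0 ?mulr0 ?maxxx.
Qed.

Lemma ideal_padd e u v : lat_le 0 e -> ideal e u -> ideal e v ->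
  ideal e (padd u v).
Proof. by move=> e0 eu ev; apply: ideal_psum => // j; case: ifP. Qed.

Lemma ideal_psub e u v : lat_le 0 e -> ideal e u -> ideal e v ->
  ideal e (psub u v).
Proof.
move=> e0 eu ev; apply: (krivineP (homogeneous_pow_diff r0) e0 _ (phi := fun=> 0) _).1.
  by move=> j; case: ifP.
by split=> *; rewrite ?addr0 ?mulr0 ?maxxx.
Qed.

Section Evaluation.
Variables (e : E) (phi : E -> R).
Hypotheses (e0 : lat_le 0 e) (hphi : lat_hom (ideal e) phi).
Let P u := phi u `^ r.

Lemma lat_psum_powR n (lam : 'I_n -> R) (v : 'I_n -> E) :
  (forall j, 0 <= lam j) -> (forall j, ideal e (v j)) ->
  P (lat_psum r%:E lam v) = \sum_(j < n) lam j * `|phi (v j)| `^ r.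
Proof.
by move=> lam0 ev; rewrite /P (lat_psumP lam0 e0 ev hphi).2 psum_powR.
Qed.

Lemma padd_powR u v : ideal e u -> ideal e v -> lat_le 0 u -> lat_le 0 v ->
  P (padd u v) = P u + P v.
Proof.
move=> eu ev u0 v0; rewrite /padd lat_psum_powR//; last by move=> j; case: ifP.
rewrite !big_ord_recl big_ord0/= addr0 !mul1r.
by rewrite !ger0_norm// (lat_hom_ge0 (ideal_subspace e) hphi).
Qed.

Lemma psub_powR u v : ideal e u -> ideal e v -> lat_le 0 u -> lat_le 0 v ->
  P (psub u v) = Num.max (P u - P v) 0.
Proof.
move=> eu ev u0 v0; rewrite /P /psub.
have [|_ ->] := krivineP (homogeneous_pow_diff r0) e0 _ hphi
    (v := fun i : 'I_2 => if i == 0 then u else v).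
  by move=> j; case: ifP.
rewrite /pow_diff !mxE/= powRVK ?le_max ?lexx ?orbT//.
by rewrite !ger0_norm// (lat_hom_ge0 (ideal_subspace e) hphi).
Qed.

Lemma join_powR u v : ideal e u -> ideal e v -> lat_le 0 u -> lat_le 0 v ->
  P (lat_join u v) = Num.max (P u) (P v).
Proof.
move=> eu ev u0 v0; rewrite /P (lat_homJ hphi)// powR_max//;
  exact: (lat_hom_ge0 (ideal_subspace e) hphi).
Qed.

Lemma meet_powR u v : ideal e u -> ideal e v -> lat_le 0 u -> lat_le 0 v ->
  P (lat_meet u v) = Num.min (P u) (P v).
Proof.
move=> eu ev u0 v0; rewrite /P (lat_hom_meet (ideal_subspace e) hphi)// powR_min//;
  exact: (lat_hom_ge0 (ideal_subspace e) hphi).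
Qed.

Lemma scale_powR (c : R) u : 0 <= c -> ideal e u -> lat_le 0 u ->
  P (c *: u) = c `^ r * P u.
Proof.
move=> c0 eu u0; rewrite /P (lat_homZ hphi)// powRM//.
exact: (lat_hom_ge0 (ideal_subspace e) hphi).
Qed.

End Evaluation.

Lemma lat_psum_ge0 n (lam : 'I_n -> R) (v : 'I_n -> E) : (forall j, 0 <= lam j) ->
  lat_le 0 (lat_psum r%:E lam v).
Proof.
move=> lam0; pose e := \sum_(j < n) lat_abs (v j).
have [e0 ev] : lat_le 0 e /\ forall j, ideal e (v j).
  exact: (sum_abs_ideal v).
apply: (ideal_ler e0) => [||phi hphi]; [exact: ideal0|exact: ideal_psum|].
rewrite (lat_hom0 hphi (ideal0 e)) (lat_psumP lam0 e0 ev hphi).2; exact: psum_ge0.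
Qed.

Lemma padd_ge0 u v : lat_le 0 (padd u v).
Proof. exact: lat_psum_ge0. Qed.

Lemma psub_ge0 u v : lat_le 0 (psub u v).
Proof.
pose w (i : 'I_2) := if i == 0 then u else v.
have [e0 ev] := sum_abs_ideal w; set e := \sum_(j < 2) _ in e0 ev.
have [eu ev'] : ideal e u /\ ideal e v by split; [exact: (ev 0)|exact: (ev 1)].
apply: (ideal_ler e0) => [||phi hphi]; [exact: ideal0|exact: ideal_psub|].
rewrite (lat_hom0 hphi (ideal0 e)) (krivineP (homogeneous_pow_diff r0) e0 ev hphi).2.
exact: powR_ge0.
Qed.

Lemma powR_ler e u v : lat_le 0 e -> ideal e u -> ideal e v ->
  lat_le 0 u -> lat_le 0 v ->
  (forall phi, lat_hom (ideal e) phi -> phi u `^ r <= phi v `^ r) -> lat_le u v.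
Proof.
move=> e0 eu ev u0 v0 H; apply: (ideal_ler e0) => // phi hphi.
by rewrite -(powR_le r0) ?H//; exact: (lat_hom_ge0 (ideal_subspace e) hphi).
Qed.

Lemma powR_eqr e u v : lat_le 0 e -> ideal e u -> ideal e v ->
  lat_le 0 u -> lat_le 0 v ->
  (forall phi, lat_hom (ideal e) phi -> phi u `^ r = phi v `^ r) -> u = v.
Proof.
by move=> e0 eu ev u0 v0 H; apply: lat_eq; apply: (powR_ler e0) => // phi /H ->.
Qed.

End LatticePowers.

Lemma exists_ideal {R : realType} {E : banachLatticeType R} {n} (v : 'I_n -> E) :
  exists e, lat_le 0 e /\ forall j, ideal e (v j).
Proof. by eexists; exact: sum_abs_ideal. Qed.

Lemma lat_meet_ge0 {R : realType} {E : banachLatticeType R} (u v : E) :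
  lat_le 0 u -> lat_le 0 v -> lat_le 0 (lat_meet u v).
Proof. by move=> u0 v0; rewrite lat_meetP u0. Qed.

Lemma lat_join_ge0 {R : realType} {E : banachLatticeType R} (u v : E) :
  lat_le 0 u -> lat_le 0 (lat_join u v).
Proof. by move=> u0; apply: lat_trans u0 (lat_joinl _ _). Qed.

Lemma lat_add_ge0 {R : realType} {E : banachLatticeType R} (u v : E) :
  lat_le 0 u -> lat_le 0 v -> lat_le 0 (u + v).
Proof. by move=> u0 v0; rewrite -[0]addr0; exact: lat_le_add. Qed.

Lemma ideal_addl {R : realType} {E : banachLatticeType R} (u v : E) :
  lat_le 0 u -> lat_le 0 v -> ideal (u + v) u.
Proof.
move=> u0 v0; exists 1 => //; rewrite scale1r lat_abs_pos//.
by rewrite -[X in lat_le X _]addr0; apply: lat_le_add => //; exact: lat_le_refl.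
Qed.

Lemma ideal_addr {R : realType} {E : banachLatticeType R} (u v : E) :
  lat_le 0 u -> lat_le 0 v -> ideal (u + v) v.
Proof. by move=> u0 v0; rewrite addrC; exact: ideal_addl. Qed.

Lemma ideal_sum3 {R : realType} {E : banachLatticeType R} (u v w : E) :
  lat_le 0 u -> lat_le 0 v -> lat_le 0 w -> [/\ lat_le 0 (u + v + w),
    ideal (u + v + w) u, ideal (u + v + w) v & ideal (u + v + w) w].
Proof.
move=> u0 v0 w0; have uv0 := lat_add_ge0 u0 v0; split.
- exact: lat_add_ge0.
- by apply: ideal_trans (ideal_addl u0 v0); exact: ideal_addl.
- by apply: ideal_trans (ideal_addr u0 v0); exact: ideal_addl.
- exact: ideal_addr.
Qed.

Ltac lat_side := repeat first [ assumption | apply: padd_ge0 | apply: psub_ge0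
  | apply: lat_meet_ge0 | apply: lat_join_ge0 | apply: lat_scale_ge0
  | apply: lat_abs_ge0 | apply: ideal_padd | apply: ideal_psub | apply: ideal_meet
  | apply: ideal_join | apply: idealZ | apply: powR_ge0 | apply: ltW; assumption ].

Section ConcavifiedCone.
Context {R : realType} {E : banachLatticeType R}.
Variable r : R.
Hypothesis r0 : 0 < r.
Implicit Types (u v w z e g h : E) (c : R).
Local Notation padd := (padd r).
Local Notation psub := (psub r).

Lemma paddC u v : lat_le 0 u -> lat_le 0 v -> padd u v = padd v u.
Proof.
move=> u0 v0; have [e0 eu ev _] := ideal_sum3 u0 v0 v0.
apply: (powR_eqr r0 e0); lat_side => phi hphi.
rewrite !(padd_powR r0 e0 hphi); lat_side; exact: addrC.
Qed.

Lemma paddA u v w : lat_le 0 u -> lat_le 0 v -> lat_le 0 w ->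
  padd u (padd v w) = padd (padd u v) w.
Proof.
move=> u0 v0 w0; have [e0 eu ev ew] := ideal_sum3 u0 v0 w0.
apply: (powR_eqr r0 e0); lat_side => phi hphi.
by rewrite !(padd_powR r0 e0 hphi); lat_side; rewrite addrA.
Qed.

Lemma paddACA u v w z : lat_le 0 u -> lat_le 0 v -> lat_le 0 w -> lat_le 0 z ->
  padd (padd u v) (padd w z) = padd (padd u w) (padd v z).
Proof.
move=> u0 v0 w0 z0; have uv0 : lat_le 0 (padd u v) by exact: padd_ge0.
have vz0 : lat_le 0 (padd v z) by exact: padd_ge0.
rewrite paddA// -(paddA u0 v0 w0) (paddC v0 w0) (paddA u0 w0 v0) -paddA//.
exact: padd_ge0.
Qed.

Lemma padd_scale c u v : 0 <= c -> lat_le 0 u -> lat_le 0 v ->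
  c *: padd u v = padd (c *: u) (c *: v).
Proof.
move=> c0 u0 v0; have [e0 eu ev _] := ideal_sum3 u0 v0 v0.
apply: (powR_eqr r0 e0); lat_side => phi hphi.
rewrite (scale_powR r hphi); lat_side.
rewrite !(padd_powR r0 e0 hphi); lat_side.
by rewrite !(scale_powR r hphi)//; ring.
Qed.

Lemma padd_scaleD s t u : 0 <= s -> 0 <= t -> lat_le 0 u ->
  (s + t) `^ r^-1 *: u = padd (s `^ r^-1 *: u) (t `^ r^-1 *: u).
Proof.
move=> s0 t0 u0; have e0 := u0; have eu := ideal_self u0.
apply: (powR_eqr r0 e0); lat_side => phi hphi.
rewrite !(padd_powR r0 e0 hphi); lat_side.
rewrite !(scale_powR r hphi) ?powR_ge0// !powRVK// ?addr_ge0//; ring.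
Qed.

Lemma padd_le u u' v v' : lat_le 0 u -> lat_le 0 v -> lat_le u u' ->
  lat_le v v' -> lat_le (padd u v) (padd u' v').
Proof.
move=> u0 v0 uu vv; have u'0 := lat_trans u0 uu; have v'0 := lat_trans v0 vv.
have [e0 eu ev _] := ideal_sum3 u'0 v'0 v'0.
have eu' := ideal_pos_le eu u0 uu; have ev' := ideal_pos_le ev v0 vv.
apply: (powR_ler r0 e0); lat_side => phi hphi.
rewrite !(padd_powR r0 e0 hphi); lat_side.
have ge0 w : ideal (u' + v' + v') w -> lat_le 0 w -> 0 <= phi w.
  exact: (lat_hom_ge0 (ideal_subspace _) hphi).
by apply: lerD; rewrite powR_le ?ge0//; exact: (lat_hom_le hphi).
Qed.

Lemma padd_geL u v : lat_le 0 u -> lat_le 0 v -> lat_le u (padd u v).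
Proof.
move=> u0 v0; have [e0 eu ev _] := ideal_sum3 u0 v0 v0.
apply: (powR_ler r0 e0); lat_side => phi hphi.
by rewrite !(padd_powR r0 e0 hphi); lat_side; rewrite lerDl powR_ge0.
Qed.

Lemma padd0 u : lat_le 0 u -> padd u 0 = u.
Proof.
move=> u0; have e0 := u0; have eu := ideal_self u0; have ez := ideal0 u.
apply: (powR_eqr r0 e0); lat_side => phi hphi.
rewrite !(padd_powR r0 e0 hphi); lat_side; last exact: lat_le_refl.
by rewrite (lat_hom0 hphi)// powR0 ?addr0// gt_eqF.
Qed.

Lemma padd_psub u v : lat_le 0 u -> lat_le u v -> padd u (psub v u) = v.
Proof.
move=> u0 uv; have v0 := lat_trans u0 uv.
have [e0 eu ev _] := ideal_sum3 u0 v0 v0.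
apply: (powR_eqr r0 e0); lat_side => phi hphi.
rewrite !(padd_powR r0 e0 hphi); lat_side.
rewrite !(psub_powR r0 e0 hphi); lat_side.
have : phi u `^ r <= phi v `^ r.
  rewrite powR_le//; first exact: (lat_hom_le hphi).
    exact: (lat_hom_ge0 (ideal_subspace _) hphi).
  exact: (lat_hom_ge0 (ideal_subspace _) hphi).
max_lra.
Qed.

(** Both terms lie below [padd u v]. This compares ordinary sums of generators with the sums to
    which [N] is adapted; the size of the constant is immaterial, since only the generated ideals
    matter. *)
Lemma add_le_padd u v : lat_le 0 u -> lat_le 0 v ->
  lat_le (u + v) (2 *: padd u v).
Proof.
move=> u0 v0; have [e0 eu ev _] := ideal_sum3 u0 v0 v0.
apply: (ideal_ler e0) => [||phi hphi]; lat_side; first exact: idealD.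
rewrite (lat_homD hphi)// (lat_homZ hphi); lat_side.
have H w : ideal (u + v + v) w -> lat_le 0 w -> lat_le w (padd u v) ->
    phi w <= phi (padd u v).
  by move=> ew w0 h; apply: (lat_hom_le hphi) => //; lat_side.
have := H _ eu u0 (padd_geL u0 v0).
have /(H _ ev v0) : lat_le v (padd u v) by rewrite paddC//; exact: padd_geL.
lra.
Qed.

Section Families.
Context {J : Type}.
Variables (vec : J -> E) (cost : J -> R).
Hypothesis cost0 : forall j, 0 <= cost j.

Definition pfamily (g : E) (c : R) := exists n (idx : 'I_n -> J) (lam : 'I_n -> R),
  [/\ forall i, 0 <= lam i, g = lat_psum r%:E lam (vec \o idx) &
      c = \sum_(i < n) lam i * cost (idx i)].

Lemma pfamily_ge0 g c : pfamily g c -> lat_le 0 g /\ 0 <= c.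
Proof.
move=> [n [idx [lam [lam0 -> ->]]]]; split; first exact: lat_psum_ge0.
by apply: sumr_ge0 => i _; rewrite mulr_ge0.
Qed.

Lemma pfamily0 : pfamily 0 0.
Proof.
have f0 (A : Type) (i : 'I_0) : A by case: i.
exists 0%N, (f0 J), (f0 R); split=> [[]//||]; last by rewrite big_ord0.
have [e [e0 ev]] := exists_ideal (vec \o f0 J : 'I_0 -> E).
have z : lat_le (0 : E) 0 by exact: lat_le_refl.
have p0 : lat_le 0 (lat_psum r%:E (f0 R : 'I_0 -> R) (vec \o f0 J)).
  by apply: lat_psum_ge0 => // -[].
have ep : ideal e (lat_psum r%:E (f0 R : 'I_0 -> R) (vec \o f0 J)).
  by apply: ideal_psum => // -[].
apply: (powR_eqr r0 e0) => //; first exact: ideal0.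
move=> phi hphi; rewrite (lat_psum_powR r0 e0 hphi)//; last by case.
by rewrite big_ord0 (lat_hom0 hphi (ideal0 _)) powR0// gt_eqF.
Qed.

Lemma pfamily1 j : pfamily (lat_abs (vec j)) (cost j).
Proof.
exists 1%N, (fun=> j), (fun=> 1); split=> //; last by rewrite big_ord1 mul1r.
have e0 := lat_abs_ge0 (vec j); have ee := ideal_self e0.
have ev : ideal (lat_abs (vec j)) (vec j) by apply/ideal_abs.
have p0 : lat_le 0 (lat_psum r%:E (fun _ : 'I_1 => 1) (vec \o (fun=> j))).
  exact: lat_psum_ge0.
apply: (powR_eqr r0 e0) => //; first exact: ideal_psum.
move=> phi hphi; rewrite (lat_psum_powR r0 e0 hphi)// big_ord1 mul1r.
by rewrite (lat_hom_abs (ideal_subspace _) hphi).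
Qed.

Lemma pfamilyD g c g' c' : pfamily g c -> pfamily g' c' ->
  pfamily (padd g g') (c + c').
Proof.
move=> [n [idx [lam [lam0 -> ->]]]] [n' [idx' [lam' [lam'0 -> ->]]]].
pose cat (A : Type) (f : 'I_n -> A) (f' : 'I_n' -> A) (i : 'I_(n + n')) :=
  match fintype.split i with inl k => f k | inr k => f' k end.
have catl A f f' i : cat A f f' (lshift n' i) = f i by rewrite /cat (unsplitK (inl _ i)).
have catr A f f' i : cat A f f' (rshift n i) = f' i by rewrite /cat (unsplitK (inr _ i)).
have catP (A : Type) (Q : A -> Prop) f f' : (forall i, Q (f i)) ->
    (forall i, Q (f' i)) -> forall i, Q (cat A f f' i).
  by move=> h h' i; rewrite /cat; case: fintype.split.
exists (n + n')%N, (cat _ idx idx'), (cat _ lam lam'); split.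
- exact: (catP _ (fun x => 0 <= x)).
- pose v := vec \o idx; pose v' := vec \o idx'.
  have vE : vec \o cat _ idx idx' = cat _ v v'.
    by apply/funext => i /=; rewrite /cat; case: fintype.split.
  rewrite vE -/v -/v'.
  have [e [e0 ev]] := exists_ideal (cat _ v v').
  have ev1 i : ideal e (v i) by have := ev (lshift n' i); rewrite catl.
  have ev2 i : ideal e (v' i) by have := ev (rshift n i); rewrite catr.
  have l0 : forall i, 0 <= cat _ lam lam' i by exact: (catP _ (fun x => 0 <= x)).
  have e1 : ideal e (lat_psum r%:E lam v) by exact: ideal_psum.
  have e2 : ideal e (lat_psum r%:E lam' v') by exact: ideal_psum.
  have p1 : lat_le 0 (lat_psum r%:E lam v) by exact: lat_psum_ge0.
  have p2 : lat_le 0 (lat_psum r%:E lam' v') by exact: lat_psum_ge0.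
  apply: (powR_eqr r0 e0).
  - exact: ideal_padd.
  - exact: ideal_psum.
  - exact: padd_ge0.
  - exact: lat_psum_ge0.
  move=> phi hphi; rewrite (padd_powR r0 e0 hphi)//.
  rewrite !(lat_psum_powR r0 e0 hphi)// big_split_ord/=.
  by congr (_ + _); apply: eq_bigr => i _; rewrite ?catl ?catr.
- rewrite big_split_ord/=.
  by congr (_ + _); apply: eq_bigr => i _; rewrite ?catl ?catr.
Qed.

Lemma pfamilyZ a g c : 0 <= a -> pfamily g c -> pfamily (a `^ r^-1 *: g) (a * c).
Proof.
move=> a0 [n [idx [lam [lam0 -> ->]]]].
exists n, idx, (fun i => a * lam i); split.
- by move=> i; rewrite mulr_ge0.
- have [e [e0 ev]] := exists_ideal (vec \o idx).
  have al0 i : 0 <= a * lam i by rewrite mulr_ge0.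
  have e1 : ideal e (lat_psum r%:E lam (vec \o idx)) by exact: ideal_psum.
  have p1 : lat_le 0 (lat_psum r%:E lam (vec \o idx)) by exact: lat_psum_ge0.
  apply: (powR_eqr r0 e0).
  + exact: idealZ.
  + exact: ideal_psum.
  + by apply: lat_scale_ge0 => //; exact: powR_ge0.
  + exact: lat_psum_ge0.
  move=> phi hphi; rewrite (scale_powR r hphi) ?powR_ge0// powRVK//.
  rewrite !(lat_psum_powR r0 e0 hphi)// mulr_sumr.
  by apply: eq_bigr => i _; rewrite mulrA.
- by rewrite mulr_sumr; apply: eq_bigr => i _; rewrite mulrA.
Qed.

End Families.

End ConcavifiedCone.

(** * A sandwich theorem *)

Section Sandwich.
Context {R : realType} {E : banachLatticeType R}.
Variable r : R.
Hypothesis r0 : 0 < r.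
Context {J1 J2 : Type}.
Variables (vec1 : J1 -> E) (cost1 : J1 -> R) (vec2 : J2 -> E) (cost2 : J2 -> R).
Hypotheses (cost10 : forall j, 0 <= cost1 j) (cost20 : forall j, 0 <= cost2 j).
Implicit Types (u v w e g h : E) (c : R).
Local Notation padd := (padd r).
Local Notation fam1 := (pfamily r vec1 cost1).
Local Notation fam2 := (pfamily r vec2 cost2).

Definition pdominated : set E :=
  [set u | lat_le 0 u /\ exists g c, fam1 g c /\ lat_le u g].

Hypothesis fam12 : forall g c h c', fam1 g c -> fam2 h c' -> lat_le h g ->
  c' <= c.

(* [inf (bounds u)] is sublinear for [padd], is at most [c] at [g] whenever
   [fam1 g c], and grows by at least [c'] when [h] is added, whenever
   [fam2 h c']; a minimal such functional is additive. *)
Let bounds u : set R := [set x | exists g c h c',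
  [/\ fam1 g c, fam2 h c', lat_le (padd u h) g & x = c - c']].

Let q u := inf (bounds u).

Let bounds_n0 u : pdominated u -> bounds u !=set0.
Proof.
move=> [u0 [g [c [gc ug]]]]; exists (c - 0), g, c, 0, 0; split=> //.
- exact: pfamily0.
- by rewrite padd0.
Qed.

Let bounds_lb u : lat_le 0 u -> lbound (bounds u) 0.
Proof.
move=> u0 x [g [c [h [c' [gc hc' ug ->]]]]]; rewrite subr_ge0.
apply: (fam12 gc hc'); apply: lat_trans ug.
have [h0 _] := pfamily_ge0 r0 cost20 hc'.
by rewrite paddC//; exact: padd_geL.
Qed.

Let bounds_inf u : pdominated u -> has_inf (bounds u).
Proof. by move=> Du; split; [exact: bounds_n0|exists 0; exact: bounds_lb Du.1]. Qed.

Let q_le u g c h c' : pdominated u -> fam1 g c -> fam2 h c' ->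
  lat_le (padd u h) g -> q u <= c - c'.
Proof.
move=> Du gc hc' ug; apply: ge_inf; first by case: (bounds_inf Du).
by exists g, c, h, c'.
Qed.

Let q_lt u eps : pdominated u -> 0 < eps -> exists g c h c',
  [/\ fam1 g c, fam2 h c', lat_le (padd u h) g & c - c' < q u + eps].
Proof.
move=> Du eps0.
have [_ [g [c [h [c' [gc hc' ug ->]]]]] lt] := inf_adherent eps0 (bounds_inf Du).
by exists g, c, h, c'.
Qed.

Let q_ge u x : pdominated u -> (forall g c h c', fam1 g c -> fam2 h c' ->
  lat_le (padd u h) g -> x <= c - c') -> x <= q u.
Proof.
move=> Du H; apply: lb_le_inf; first exact: bounds_n0.
by move=> _ [g [c [h [c' [gc hc' ug ->]]]]]; exact: H ug.
Qed.

Let DD u v : pdominated u -> pdominated v -> pdominated (padd u v).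
Proof.
move=> [u0 [g [c [gc ug]]]] [v0 [g' [c' [gc' vg]]]]; split; first exact: padd_ge0.
by exists (padd g g'), (c + c'); split; [exact: pfamilyD|exact: padd_le].
Qed.

Let DZ c u : 0 < c -> pdominated u -> pdominated (c `^ r^-1 *: u).
Proof.
move=> c0 [u0 [g [c' [gc ug]]]]; have cr : 0 <= c `^ r^-1 by exact: powR_ge0.
split; first exact: lat_scale_ge0.
exists (c `^ r^-1 *: g), (c * c'); split; first exact: (pfamilyZ r0 (ltW c0) gc).
exact: lat_le_scale.
Qed.

(** The bound 0 makes the functional nondecreasing, hence [N] nonnegative; the bounds from the
    second family make [N] dominate [cost2]. *)
Let B u c := c = 0 \/ fam2 u c.

Let q_sublinear : sublinear_on pdominated padd (fun c u => c `^ r^-1 *: u) B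
  (fun _ _ _ => False) q.
Proof.
split=> [u v Du Dv|c u c0 Du|u z c Du Dz Bc|//].
- apply/ler_addgt0Pr => eps eps0; have e2 : 0 < eps / 2 by rewrite divr_gt0.
  have [g [c [h [c' [gc hc' ug l1]]]]] := q_lt Du e2.
  have [g1 [c1 [h1 [c1' [gc1 hc1' ug1 l2]]]]] := q_lt Dv e2.
  have [h0 _] := pfamily_ge0 r0 cost20 hc'; have [h10 _] := pfamily_ge0 r0 cost20 hc1'.
  have [u0 _] := Du; have [v0 _] := Dv.
  have := q_le (DD Du Dv) (pfamilyD r0 gc gc1) (pfamilyD r0 hc' hc1').
  have -> : padd (padd u v) (padd h h1) = padd (padd u h) (padd v h1).
    exact: paddACA.
  move=> /(_ (padd_le r0 (padd_ge0 r0 _ _) (padd_ge0 r0 _ _) ug ug1)); lra.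
- have H c' u' : 0 < c' -> pdominated u' -> q (c' `^ r^-1 *: u') <= c' * q u'.
    move=> c'0 Du'; have cr : 0 <= c' `^ r^-1 by exact: powR_ge0.
    rewrite -ler_pdivrMl//; apply: q_ge => // g a h a' ga ha' ug.
    have [h0 _] := pfamily_ge0 r0 cost20 ha'.
    rewrite ler_pdivrMl// mulrBr.
    apply: (q_le (DZ c'0 Du') (pfamilyZ r0 (ltW c'0) ga) (pfamilyZ r0 (ltW c'0) ha')).
    by rewrite -padd_scale//; [exact: lat_le_scale|exact: Du'.1].
  apply/le_anti; rewrite H//=.
  have ci : 0 < c^-1 by rewrite invr_gt0.
  rewrite -ler_pdivlMl//.
  have e1 : c^-1 `^ r^-1 * c `^ r^-1 = 1.
    by rewrite -powRM ?(ltW ci) ?(ltW c0)// mulVf ?powR1// gt_eqF.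
  by have := H _ _ ci (DZ c0 Du); rewrite scalerA e1 scale1r.
- apply: q_ge; first exact: DD.
  move=> g a h a' ga ha' ug; have [h0 _] := pfamily_ge0 r0 cost20 ha'.
  have [u0 _] := Du; have [z0 _] := Dz; case: Bc => [->|uc].
    rewrite addr0; apply: (q_le Dz ga ha'); apply: lat_trans ug.
    by apply: padd_le => //; [exact: padd_geL|exact: lat_le_refl].
  rewrite -lerBrDr -addrA -opprD; apply: (q_le Dz ga (pfamilyD r0 ha' uc)).
  by move: ug; rewrite -paddA// (paddC r0 u0 h0).
Qed.

Theorem pfamily_sandwich : exists N : E -> R, [/\
  forall u, pdominated u -> 0 <= N u,
  forall u v, pdominated u -> pdominated v -> N (padd u v) = N u + N v,
  forall c u, 0 < c -> pdominated u -> N (c `^ r^-1 *: u) = c * N u,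
  forall j, N (lat_abs (vec1 j)) <= cost1 j &
  forall j, pdominated (lat_abs (vec2 j)) -> cost2 j <= N (lat_abs (vec2 j))].
Proof.
have [||||||||||N [[_ NZ NB _] Nq NA]] :=
    @exists_additive_minorant R E pdominated padd (fun c u => c `^ r^-1 *: u) B
      (fun _ _ _ => False) _ _ _ _ _ _ _ _ _ _ q q_sublinear.
- exact: DD.
- exact: DZ.
- by move=> u v w [u0 _] [v0 _] [w0 _]; exact: paddA.
- by move=> u v [u0 _] [v0 _]; exact: paddC.
- by move=> c u v c0 [u0 _] [v0 _]; rewrite padd_scale//; exact: powR_ge0.
- by move=> s t u s0 t0 _; rewrite scalerA powRM// ltW.
- by move=> u _; rewrite powR1 scale1r.
- by move=> s t u s0 t0 [u0 _]; rewrite padd_scaleD// ltW.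
- by move=> u _; exists 0; left.
- by [].
have abs0 (v : E) : lat_le 0 (lat_abs v) by exact: lat_abs_ge0.
exists N; split=> //.
- move=> u Du; have := NB _ _ _ Du Du (or_introl erefl); rewrite NA//; lra.
- move=> j; have gj := pfamily1 r0 vec1 cost1 j.
  have Dj : pdominated (lat_abs (vec1 j)).
    by split=> //; exists (lat_abs (vec1 j)), (cost1 j); split; rewrite ?lat_le_refl.
  apply: le_trans (Nq _ Dj) _; rewrite -[leRHS]subr0.
  apply: (q_le Dj gj (pfamily0 r0 vec2 cost2)).
  by rewrite padd0// lat_le_refl.
- move=> j Dj; have hj := pfamily1 r0 vec2 cost2 j.
  have := NB _ _ _ Dj Dj (or_intror hj); rewrite NA//; lra.
Qed.

End Sandwich.

(** * Transfinite decomposition into principal bands *)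

Section Generated.
Context {R : realType} {E : banachLatticeType R} {X : Type}.
Variable e : X -> E.
Hypothesis e_ge0 : forall x, lat_le 0 (e x).
Implicit Types (A B : set X) (u v g h : E).

Inductive generated A : E -> Prop :=
| generated0 : generated A 0
| generated_add x g : A x -> generated A g -> generated A (e x + g).

Definition generated_ideal A : set E :=
  [set u | exists2 g, generated A g & ideal g u].

Lemma generated_ge0 A g : generated A g -> lat_le 0 g.
Proof. by elim=> [|x h Ax _ h0]; [exact: lat_le_refl|exact: lat_add_ge0]. Qed.

Lemma generatedD A g h : generated A g -> generated A h -> generated A (g + h).
Proof.
move=> gA hA; elim: gA => [|x k Ax _ IH]; first by rewrite add0r.
by rewrite -addrA; exact: generated_add.
Qed.

Lemma generated_sub A B g : A `<=` B -> generated A g -> generated B g.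
Proof. by move=> AB; elim=> [|x h /AB Bx _ IH]; [exact: generated0|exact: generated_add]. Qed.

Lemma generatedMn A g n : generated A g -> generated A (n%:R *: g).
Proof.
move=> gA; elim: n => [|n IH]; first by rewrite scale0r; exact: generated0.
by rewrite -natr1 scalerDl scale1r; exact: generatedD.
Qed.

Lemma generated1 A x : A x -> generated A (e x).
Proof. by move=> Ax; rewrite -[e x]addr0; apply: generated_add => //; exact: generated0. Qed.

Lemma generated_ideal_le A u : generated_ideal A u ->
  exists2 g, generated A g & lat_le (lat_abs u) g.
Proof.
move=> [g gA [c c0 uc]]; exists ((Num.bound c)%:R *: g); first exact: generatedMn.
apply: lat_trans uc _; rewrite -lat_subr_ge0 -scalerBl.
apply: lat_scale_ge0; last exact: generated_ge0 gA.
by rewrite subr_ge0 ltW// archi_boundP.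
Qed.

Lemma generated_common A u v : generated_ideal A u -> generated_ideal A v ->
  exists g, [/\ generated A g, lat_le 0 g, ideal g u & ideal g v].
Proof.
move=> [g gA gu] [h hA hv]; exists (g + h).
have g0 := generated_ge0 gA; have h0 := generated_ge0 hA; split.
- exact: generatedD.
- exact: lat_add_ge0.
- by apply: ideal_trans gu; exact: ideal_addl.
- by apply: ideal_trans hv; exact: ideal_addr.
Qed.

Lemma generated_ideal_sub A B : A `<=` B -> generated_ideal A `<=` generated_ideal B.
Proof. by move=> AB u [g gA gu]; exists g => //; exact: generated_sub gA. Qed.

Lemma generated_in A g : generated A g -> generated_ideal A g.
Proof. by move=> gA; exists g => //; exact/ideal_self/(generated_ge0 gA). Qed.

Lemma generated_ideal_subspace A : lat_subspace (generated_ideal A).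
Proof.
split=> [u v Au Av|a u [g gA gu]|u v Au Av].
- have [g [gA g0 gu gv]] := generated_common Au Av; exists g => //; exact: idealD.
- by exists g => //; exact: idealZ.
- have [g [gA g0 gu gv]] := generated_common Au Av; exists g => //; exact: ideal_join.
Qed.

Lemma generated_ideal_pos_le A u v : generated_ideal A v -> lat_le 0 u ->
  lat_le u v -> generated_ideal A u.
Proof. by move=> [g gA gv] u0 uv; exists g => //; exact: ideal_pos_le uv. Qed.

Lemma generated_ideal_abs A u : generated_ideal A u -> generated_ideal A (lat_abs u).
Proof. by move=> [g gA gu]; exists g => //; exact/ideal_abs. Qed.

Definition generated_pos A : set E :=
  [set u | lat_le 0 u /\ generated_ideal A u].

End Generated.

Section BandDecomposition.
Context {R : realType} {E : banachLatticeType R} {X : eqType}.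
Variable r : R.
Hypothesis r0 : 0 < r.
Variable e : X -> E.
Hypothesis e_ge0 : forall x, lat_le 0 (e x).
Implicit Types (A B : set X) (u v w g h : E) (x y z : X) (F : seq X).
Local Notation padd := (padd r).
Local Notation psub := (psub r).
Local Notation D := (generated_pos e setT).

Variable N : E -> R.
Hypotheses (N_ge0 : forall u, D u -> 0 <= N u)
  (N_add : forall u v, D u -> D v -> N (padd u v) = N u + N v)
  (N_scale : forall c u, 0 < c -> D u -> N (c `^ r^-1 *: u) = c * N u).

Lemma pos_padd A u v : generated_pos e A u -> generated_pos e A v ->
  generated_pos e A (padd u v).
Proof.
move=> [u0 Au] [v0 Av]; split; first exact: padd_ge0.
have [g [gA g0 gu gv]] := generated_common e_ge0 Au Av.
by exists g => //; exact: ideal_padd.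
Qed.

Lemma pos_psub A u v : generated_pos e A u -> generated_pos e A v ->
  generated_pos e A (psub u v).
Proof.
move=> [u0 Au] [v0 Av]; split; first exact: psub_ge0.
have [g [gA g0 gu gv]] := generated_common e_ge0 Au Av.
by exists g => //; exact: ideal_psub.
Qed.

Lemma pos_le A u v : generated_pos e A v -> lat_le 0 u -> lat_le u v ->
  generated_pos e A u.
Proof. by move=> [v0 Av] u0 uv; split=> //; exact: generated_ideal_pos_le uv. Qed.

Lemma pos_meet A B u v : generated_pos e A u -> generated_pos e B v ->
  generated_pos e A (lat_meet u v).
Proof.
move=> Au [v0 _]; apply: pos_le (Au) _ (lat_meetl _ _).
by apply: lat_meet_ge0 => //; case: Au.
Qed.

Lemma pos_scale A c u : 0 <= c -> generated_pos e A u -> generated_pos e A (c *: u).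
Proof.
move=> c0 [u0 [g gA gu]]; split; first exact: lat_scale_ge0.
by exists g => //; exact: idealZ.
Qed.

Lemma pos_join A u v : generated_pos e A u -> generated_pos e A v ->
  generated_pos e A (lat_join u v).
Proof.
move=> [u0 Au] [v0 Av]; split; first exact: lat_join_ge0.
by case: (generated_ideal_subspace e_ge0 A) => _ _; apply.
Qed.

Lemma pos_gen A g : generated e A g -> generated_pos e A g.
Proof. by move=> gA; split; [exact: generated_ge0 gA|exact: generated_in]. Qed.

Lemma pos_sub A B : A `<=` B -> generated_pos e A `<=` generated_pos e B.
Proof. by move=> AB u [u0 Au]; split=> //; exact: generated_ideal_sub Au. Qed.

Lemma posT A u : generated_pos e A u -> D u.
Proof. exact: pos_sub. Qed.

Lemma pos_elem x n : generated_pos e [set x] (n%:R *: e x).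
Proof. by apply: pos_gen; apply: generatedMn; exact: generated1. Qed.

Lemma N_mono u v : D u -> D v -> lat_le u v -> N u <= N v.
Proof.
move=> Du Dv uv; rewrite -(padd_psub r0 Du.1 uv) N_add//; last exact: pos_psub.
by rewrite lerDl N_ge0//; exact: pos_psub.
Qed.

Lemma N0 : N 0 = 0.
Proof.
have D0 : D 0 by apply: pos_gen; exact: generated0.
by have := N_add D0 D0; rewrite padd0//; [lra|exact: lat_le_refl].
Qed.

(* The part of [N u] carried by the band generated by the [e x] with [x] in
   [A]. *)
Definition band_part A u : R := sup [set N (lat_meet u g) | g in generated e A].

Let band_n0 A u : [set N (lat_meet u g) | g in generated e A] !=set0.
Proof. by exists (N (lat_meet u 0)), 0 => //; exact: generated0. Qed.

Lemma meet_N_le A u h : D u -> generated_pos e A h -> N (lat_meet u h) <= N u.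
Proof.
move=> Du Ah; apply: N_mono => //; last exact: lat_meetl.
exact: pos_meet Du Ah.
Qed.

Let band_ub A u : D u -> ubound [set N (lat_meet u g) | g in generated e A] (N u).
Proof. by move=> Du _ [g gA <-]; exact: meet_N_le Du (pos_gen gA). Qed.

Let band_sup A u : D u -> has_sup [set N (lat_meet u g) | g in generated e A].
Proof. by move=> Du; split=> //; exists (N u); exact: band_ub. Qed.

Lemma band_part_le A u : D u -> band_part A u <= N u.
Proof. by move=> Du; apply: ge_sup => //; exact: band_ub. Qed.

Lemma band_part_ge A u h : D u -> generated_pos e A h ->
  N (lat_meet u h) <= band_part A u.
Proof.
move=> Du Ah; have [g gA] := generated_ideal_le e_ge0 Ah.2.
rewrite (lat_abs_pos Ah.1) => hg.
have := ub_le_sup (band_sup A Du).2 (_ : _ (N (lat_meet u g))).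
move=> /(_ (ex_intro2 _ _ g gA erefl)); apply: le_trans.
apply: N_mono; [exact: pos_meet Du Ah|exact: pos_meet Du (pos_gen gA)|].
by rewrite lat_meetP lat_meetl; apply: lat_trans hg; exact: lat_meetr.
Qed.

Lemma band_part_lt A u eps : D u -> 0 < eps ->
  exists2 g, generated e A g & band_part A u - eps < N (lat_meet u g).
Proof.
move=> Du eps0; have [_ [g gA <-] h] := sup_adherent eps0 (band_sup A Du).
by exists g.
Qed.

Lemma lat_meet_idl u v : lat_le u v -> lat_meet u v = u.
Proof.
by move=> uv; apply: lat_eq; [exact: lat_meetl|rewrite lat_meetP lat_le_refl].
Qed.

Lemma band_part_id A u : generated_pos e A u -> band_part A u = N u.
Proof.
move=> Au; have Du := posT Au; apply/le_anti; rewrite band_part_le//=.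
by have := band_part_ge Du Au; rewrite lat_meet_idl// lat_le_refl.
Qed.

Lemma band_part_sub A B u : A `<=` B -> D u -> band_part A u <= band_part B u.
Proof.
move=> AB Du; apply: ge_sup => // _ [g gA <-].
exact: band_part_ge Du (pos_gen (generated_sub AB gA)).
Qed.

Lemma band_part_ge0 A u : D u -> 0 <= band_part A u.
Proof.
move=> Du; apply: le_trans (band_part_ge Du (pos_gen (generated0 e A))).
by apply: N_ge0; exact: pos_meet Du (pos_gen (generated0 e setT)).
Qed.

(** With (+) for [padd], one inequality comes from [(u (+) v) /\ g <= (u /\ g) (+) (v /\ g)] and the
    other from [(u /\ g) (+) (v /\ h) <= (u (+) v) /\ (g (+) h)], where [g (+) h] is again available
    as a bound. *)
Lemma band_partD A u v : D u -> D v ->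
  band_part A (padd u v) = band_part A u + band_part A v.
Proof.
move=> Du Dv; have Duv := pos_padd Du Dv; apply/le_anti/andP; split.
  apply: ge_sup => // _ [g gA <-]; have Ag := pos_gen gA.
  apply: le_trans (lerD (band_part_ge Du Ag) (band_part_ge Dv Ag)).
  have Dug := pos_meet Du Ag; have Dvg := pos_meet Dv Ag.
  rewrite -N_add//; apply: N_mono; [exact: pos_meet Duv Ag|exact: pos_padd|].
  have [u0 _] := Du; have [v0 _] := Dv; have [g0 _] := Ag.
  have [k0 ku kv kg] := ideal_sum3 u0 v0 g0.
  apply: (powR_ler r0 k0); lat_side => phi hphi.
  rewrite (meet_powR r0 hphi); lat_side; rewrite !(padd_powR r0 k0 hphi); lat_side.
  rewrite !(meet_powR r0 hphi); lat_side.
  have := powR_ge0 (phi u) r; have := powR_ge0 (phi v) r.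
  have := powR_ge0 (phi g) r; max_lra.
apply/ler_addgt0Pr => eps eps0; have e2 : 0 < eps / 2 by rewrite divr_gt0.
have [g gA hg] := band_part_lt A Du e2; have [h hA hh] := band_part_lt A Dv e2.
have Dug := pos_meet Du (pos_gen gA); have Dvh := pos_meet Dv (pos_gen hA).
have Agh := pos_padd (pos_gen gA) (pos_gen hA).
have := band_part_ge Duv Agh.
have : N (padd (lat_meet u g) (lat_meet v h)) <= N (lat_meet (padd u v) (padd g h)).
  apply: N_mono; [exact: pos_padd|exact: pos_meet Duv Agh|].
  rewrite lat_meetP !padd_le//; try exact: lat_meetl; try exact: lat_meetr;
    by [case: Dug|case: Dvh].
rewrite N_add//; lra.
Qed.

Lemma band_partZ A c u : 0 < c -> D u ->
  band_part A (c `^ r^-1 *: u) = c * band_part A u.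
Proof.
have H c' u' : 0 < c' -> D u' -> band_part A (c' `^ r^-1 *: u') <= c' * band_part A u'.
  move=> c0 Du; have k0 : 0 < c' `^ r^-1 by exact: powR_gt0.
  apply: ge_sup => // _ [g gA <-].
  have Ag := pos_gen gA; have ki : 0 <= (c' `^ r^-1)^-1 by rewrite invr_ge0 ltW.
  have Akg := pos_scale ki Ag.
  have -> : lat_meet (c' `^ r^-1 *: u') g =
      c' `^ r^-1 *: lat_meet u' ((c' `^ r^-1)^-1 *: g).
    rewrite !lat_meetE [RHS]scalerN lat_joinZ// !scalerN scalerA mulfV ?gt_eqF//.
    by rewrite scale1r.
  by rewrite N_scale//; [rewrite ler_pM2l//; exact: band_part_ge|exact: pos_meet Du Akg].
move=> c0 Du; apply/le_anti; rewrite H//=.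
have ci : 0 < c^-1 by rewrite invr_gt0.
have e1 : c^-1 `^ r^-1 * c `^ r^-1 = 1.
  by rewrite -powRM ?(ltW ci) ?(ltW c0)// mulVf ?powR1// gt_eqF.
rewrite -ler_pdivlMl//; have := H _ _ ci (pos_scale (powR_ge0 c r^-1) Du).
by rewrite scalerA e1 scale1r.
Qed.

(** Inclusion-exclusion, from the scalar identity [min u g + min u h = min u (max g h) + min (min u
    h) g]. It separates the contribution of one generator from that of the generators before it. *)
Lemma N_modular u g h : D u -> D g -> D h ->
  N (lat_meet u g) + N (lat_meet u h) =
  N (lat_meet u (lat_join g h)) + N (lat_meet (lat_meet u h) g).
Proof.
move=> Du Dg Dh; have Dug := pos_meet Du Dg; have Duh := pos_meet Du Dh.
have Dgh := pos_join Dg Dh; have Dugh := pos_meet Du Dgh.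
have Duhg := pos_meet Duh Dg.
rewrite -!N_add//; congr N.
have [u0 _] := Du; have [g0 _] := Dg; have [h0 _] := Dh.
have [k0 ku kg kh] := ideal_sum3 u0 g0 h0.
apply: (powR_eqr r0 k0); lat_side => phi hphi.
rewrite !(padd_powR r0 k0 hphi); lat_side.
rewrite !(meet_powR r0 hphi); lat_side.
rewrite (join_powR r0 hphi); lat_side.
max_lra.
Qed.


(** * Jumps along a well-order of the generators *)

Section WellOrder.
Variable le : rel X.
Hypotheses (le_refl : reflexive le) (le_trans' : transitive le)
  (le_anti' : antisymmetric le) (le_total' : total le).
Hypothesis wo_ind : forall P : X -> Prop,
  (forall x, (forall y, le y x -> y != x -> P y) -> P x) -> forall x, P x.

Local Notation below x := [set y | le y x && (y != x)].
Local Notation upto x := [set y | le y x].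

(* For [u] in the ideal of [e x] this is the jump at [x] of the nondecreasing
   function [x |-> band_part (upto x) u]. *)
Definition band_comp x u : R := N u - band_part (below x) u.

Let cut x n u := lat_meet u (n%:R *: e x).

Let Dcut x n u : D u -> D (cut x n u).
Proof. by move=> Du; exact: pos_meet Du (posT (pos_elem x n)). Qed.

Lemma band_comp_ge0 x u : D u -> 0 <= band_comp x u.
Proof. by move=> Du; rewrite subr_ge0 band_part_le. Qed.

Lemma band_compD x u v : D u -> D v ->
  band_comp x (padd u v) = band_comp x u + band_comp x v.
Proof. by move=> Du Dv; rewrite /band_comp N_add// band_partD//; ring. Qed.

Lemma band_compZ x c u : 0 < c -> D u ->
  band_comp x (c `^ r^-1 *: u) = c * band_comp x u.
Proof. by move=> c0 Du; rewrite /band_comp N_scale// band_partZ//; ring. Qed.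

Lemma band_comp_mono x u v : D u -> D v -> lat_le u v ->
  band_comp x u <= band_comp x v.
Proof.
move=> Du Dv uv; rewrite -(padd_psub r0 Du.1 uv) band_compD//; last exact: pos_psub.
by rewrite lerDl band_comp_ge0//; exact: pos_psub.
Qed.

Lemma band_comp0 x u : generated_pos e (below x) u -> band_comp x u = 0.
Proof. by move=> xu; rewrite /band_comp band_part_id// subrr. Qed.

(** [N_modular] for some [g] nearly filling the band of [below x] and [h = n%:R *: e x]: the overlap
    is at most the part of [cut x n u] in that band, and subtracting this part is what [band_comp]
    does. *)
Let step_le x n u : D u ->
  band_part (below x) u + band_comp x (cut x n u) <= band_part (upto x) u.
Proof.
move=> Du; have Dc := Dcut x n Du; apply/ler_addgt0Pr => eps eps0.
have [g gx hg] := band_part_lt (below x) Du eps0.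
have bu : below x `<=` upto x by move=> y /= /andP[].
have gu := pos_sub bu (pos_gen gx).
have eu : generated_pos e (upto x) (n%:R *: e x).
  by apply: pos_sub (pos_elem x n) => _ /= ->.
have := N_modular Du (posT gu) (posT eu).
have := band_part_ge Du (pos_join gu eu).
have := band_part_ge Dc (pos_gen gx).
rewrite /band_comp -/(cut x n u); lra.
Qed.

Let generated_upto x g : generated e (upto x) g ->
  exists h n, generated e (below x) h /\ lat_le g (h + n%:R *: e x).
Proof.
elim=> [|y k /= yx _ [h [n [hx kh]]]].
  exists 0, 0%N; split; first exact: generated0.
  by rewrite scale0r addr0 lat_le_refl.
have [->|yx'] := eqVneq y x.
  exists h, n.+1; split=> //; rewrite -natr1 scalerDl scale1r addrA.
  by rewrite [e x + k]addrC; exact: lat_leD2r.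
exists (e y + h), n; split; first by apply: generated_add => //=; rewrite yx yx'.
by rewrite -addrA; apply: lat_le_add kh; exact: lat_le_refl.
Qed.

Let step_ge x u eps : D u -> 0 < eps -> exists n,
  band_part (upto x) u <= band_part (below x) u + band_comp x (cut x n u) + eps.
Proof.
move=> Du eps0; have e2 : 0 < eps / 2 by rewrite divr_gt0.
have [k kx hk] := band_part_lt (upto x) Du e2.
have [g [m [gx kg]]] := generated_upto kx.
(* A sum lies below the join of the doubled terms, hence [n = 2 m] and the two copies of [g] in [G];
   the summand [g'] makes the overlap of [cut x n u] with [G] nearly equal to [band_part (below x)]
   of it. *)
pose n := (m + m)%N; have Dc := Dcut x n Du.
have [g' gx' hg'] := band_part_lt (below x) Dc e2.
pose G := g + g + g'.
have Gx : generated e (below x) G by do 2?apply: generatedD.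
have PG := pos_gen Gx; have Pe := pos_elem x n.
have PJ := pos_join (posT PG) (posT Pe).
have g0 := generated_ge0 e_ge0 gx; have g'0 := generated_ge0 e_ge0 gx'.
have kle : lat_le k (lat_join G (n%:R *: e x)).
  apply: lat_trans kg _; have me0 : lat_le 0 (m%:R *: e x) by exact: lat_scale_ge0.
  have [k0 kg0 ke kg'] := ideal_sum3 g0 me0 g'0.
  have -> : n%:R *: e x = m%:R *: e x + m%:R *: e x by rewrite natrD scalerDl.
  move: kg0 ke kg' k0 me0; move: (m%:R *: e x) => f kg0 ke kg' k0 me0.
  have ff : ideal (g + f + g') (f + f) by exact: idealD.
  have gg : ideal (g + f + g') (g + g) by exact: idealD.
  have gG : ideal (g + f + g') G by exact: idealD.
  apply: (ideal_ler k0) => [||phi hphi]; [exact: idealD|exact: ideal_join|].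
  rewrite (lat_homJ hphi)// /G !(lat_homD hphi)//.
  have := lat_hom_ge0 (ideal_subspace _) hphi kg' g'0.
  max_lra.
exists n; have := N_modular Du (posT PG) (posT Pe).
have Duk := pos_meet Du (posT (pos_gen kx)).
have : N (lat_meet u k) <= N (lat_meet u (lat_join G (n%:R *: e x))).
  apply: N_mono => //; first exact: pos_meet Du PJ.
  by rewrite lat_meetP lat_meetl; apply: lat_trans kle; exact: lat_meetr.
have : N (lat_meet (cut x n u) g') <= N (lat_meet (cut x n u) G).
  apply: N_mono; [exact: pos_meet Dc (pos_gen gx')|exact: pos_meet Dc PG|].
  rewrite lat_meetP lat_meetl; apply: lat_trans (lat_meetr _ _) _.
  by rewrite -[X in lat_le X _]add0r; apply: lat_leD2r; exact: lat_add_ge0.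
have := band_part_ge Du PG; rewrite /band_comp -/(cut x n u); lra.
Qed.

(** Finitely many generators occur in [g], and the largest index bounds the others. This takes care
    of the limit stages of the transfinite induction. *)
Let generated_bounded A g : generated e A g ->
  g = 0 \/ exists2 y, A y & generated e (upto y) g.
Proof.
elim=> [|x h Ax _ IH]; [by left|right].
case: IH => [->|[y Ay hy]]; first by exists x => //; rewrite addr0; apply: generated1 => /=; exact: le_refl.
have [xy|yx] := orP (le_total' x y).
  by exists y => //; exact: generated_add.
exists x => //; apply: generated_add; first exact: le_refl.
apply: generated_sub hy => z /= zy.
exact: le_trans' zy yx.
Qed.

Let below_upto x y : y \in below x -> upto y `<=` below x.
Proof.
rewrite inE => /andP[yx ynx] z /= zy; rewrite (le_trans' zy yx)/=.
apply: contra_neq ynx => zx; apply: le_anti'; rewrite yx/=.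
by rewrite -zx.
Qed.

Let finite_bounded (A : set X) F : {subset F <= A} ->
  F = [::] \/ exists2 y, A y & {subset F <= upto y}.
Proof.
elim: F => [|x F IH] FA; [by left|right].
have Ax : A x by apply/set_mem/FA; rewrite inE eqxx.
have [|->|[y Ay Fy]] := IH.
- by move=> z zF; apply: FA; rewrite inE zF orbT.
- by exists x => // z; rewrite inE => /eqP ->; rewrite inE /=.
have [xy|yx] := orP (le_total' x y).
  by exists y => // z; rewrite inE => /predU1P[->|/Fy//]; rewrite inE.
exists x => // z; rewrite inE => /predU1P[->|/Fy]; rewrite !inE//= => zy.
exact: le_trans' zy yx.
Qed.

(** Induction on a bound [x] of [F]: the finitely many indices below [x] have a largest one, to
    which the induction hypothesis applies, and the index [x] itself is paid for by [step_le]. *)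
Lemma band_comp_sum_le F n u : D u -> uniq F ->
  \sum_(x <- F) band_comp x (cut x n u) <= N u.
Proof.
move=> Du uF.
suff H x : forall F, uniq F -> {subset F <= upto x} ->
    \sum_(x <- F) band_comp x (cut x n u) <= band_part (upto x) u.
  have [|->|[y _ Fy]] := @finite_bounded setT F; first by move=> z; rewrite inE.
    by rewrite big_nil N_ge0.
  exact: le_trans (H y F uF Fy) (band_part_le _ Du).
move: x; apply: wo_ind => x IH {}F {}uF Fx.
have H G : uniq G -> {subset G <= below x} ->
    \sum_(z <- G) band_comp z (cut z n u) <= band_part (below x) u.
  move=> uG /[dup] Gx /finite_bounded[->|[y yx Gy]].
    by rewrite big_nil band_part_ge0.
  have [yx1 yx2] := andP yx.
  apply: le_trans (IH y yx1 yx2 G uG Gy) (band_part_sub _ Du).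
  by apply: below_upto; rewrite inE.
have [xF|xF] := boolP (x \in F); last first.
  apply: le_trans (H F uF _) _.
    move=> z zF; rewrite inE/=; have := Fx _ zF; rewrite inE/= => ->/=.
    by apply: contraNneq xF => <-.
  by apply: band_part_sub => // z /andP[].
rewrite (big_rem x)//= addrC; apply: le_trans (step_le x n Du).
rewrite lerD2r; apply: H; first exact: rem_uniq.
move=> z; rewrite mem_rem_uniq// !inE => /andP[zx zF].
by have := Fx _ zF; rewrite inE/= => ->.
Qed.

(** The part of [u] in the band of [below x] is nearly attained within [upto y] for a single [y]
    before [x], where the induction hypothesis holds, and [step_ge] adds the jump at [x]. Raising
    the truncation level only increases the sums, so the two levels can be merged. *)
Lemma band_comp_sum_ge u eps : D u -> 0 < eps -> exists F n, uniq F /\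
  N u <= \sum_(x <- F) band_comp x (cut x n u) + eps.
Proof.
move=> Du eps0.
have cut_mono x n m : (n <= m)%N -> lat_le (cut x n u) (cut x m u).
  move=> nm; rewrite /cut lat_meetP lat_meetl; apply: lat_trans (lat_meetr _ _) _.
  rewrite -lat_subr_ge0 -scalerBl; apply: lat_scale_ge0 => //.
  by rewrite subr_ge0 ler_nat.
suff H x : forall eps, 0 < eps -> exists F n, [/\ uniq F, {subset F <= upto x} &
    band_part (upto x) u <= \sum_(x <- F) band_comp x (cut x n u) + eps].
  have [u0 [g gT gu]] := Du; case: (generated_bounded gT) => [g0|[y _ gy]].
    exists [::], 0%N; split=> //; rewrite big_nil add0r.
    have [c c0] := gu; rewrite g0 scaler0 lat_abs_pos// => ule.
    by rewrite (_ : u = 0) ?N0 ?ltW//; exact: lat_eq.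
  have [F [n [uF _ h]]] := H y _ eps0; exists F, n; split=> //.
  apply: le_trans h; rewrite band_part_id//; split=> //; by exists g.
move: x; apply: wo_ind => x IH {}eps {}eps0.
have e3 : 0 < eps / 3 by rewrite divr_gt0.
have [F [n [uF Fx hF]]] : exists F n, [/\ uniq F, {subset F <= below x} &
    band_part (below x) u <= \sum_(x <- F) band_comp x (cut x n u) + eps / 3 + eps / 3].
  have [g gx hg] := band_part_lt (below x) Du e3.
  case: (generated_bounded gx) => [g0|[y yx gy]].
    exists [::], 0%N; split=> //; rewrite big_nil.
    move: hg; rewrite g0; have -> : lat_meet u 0 = 0.
      apply: lat_eq; first exact: lat_meetr.
      by rewrite lat_meetP lat_le_refl andbT; case: Du.
    by rewrite N0; lra.
  have [yx1 yx2] := andP yx.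
  have [F [n [uF Fy h]]] := IH y yx1 yx2 _ e3; exists F, n; split=> //.
    by move=> z /Fy; rewrite !inE => zy; apply: (@below_upto x y); rewrite ?inE.
  have := band_part_ge Du (pos_gen gy); lra.
have [m hm] := step_ge x Du e3.
exists (x :: F), (maxn n m); split=> /=.
- rewrite uF andbT; apply/negP => /Fx; rewrite inE/= eqxx andbF//.
- move=> z; rewrite inE => /predU1P[->|/Fx]; rewrite !inE//=.
  by case/andP.
rewrite big_cons.
have : band_comp x (cut x m u) <= band_comp x (cut x (maxn n m) u).
  by apply: band_comp_mono; do ?exact: Dcut; apply: cut_mono; exact: leq_maxr.
have : \sum_(x <- F) band_comp x (cut x n u) <=
    \sum_(x <- F) band_comp x (cut x (maxn n m) u).
  apply: ler_sum => z _.
  by apply: band_comp_mono; do ?exact: Dcut; apply: cut_mono; exact: leq_maxl.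
lra.
Qed.

(** Intended for the density of the range: [w] has the same jump at [x] as [u], and almost no mass
    elsewhere. *)
Lemma band_comp_approx x u eps : D u -> 0 < eps -> exists g w,
  [/\ D g, D w, padd g w = u, band_comp x g = 0 & N w <= band_comp x u + eps].
Proof.
move=> Du eps0; have [g gx hg] := band_part_lt (below x) Du eps0.
have Pg := pos_gen gx; have Dug := pos_meet Du Pg.
have Dw : D (psub u (lat_meet u g)) by exact: pos_psub.
have uE := padd_psub r0 Dug.1 (lat_meetl u g).
exists (lat_meet u g), (psub u (lat_meet u g)); split=> //.
  apply: band_comp0; apply: (pos_le Pg); [by case: Dug|exact: lat_meetr].
by have := N_add Dug Dw; rewrite uE /band_comp; lra.
Qed.

End WellOrder.

End BandDecomposition.

(** * The space of pieces *)

Section PieceSpace.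
Context {R : realType} {E : banachLatticeType R} {X : pointedType}.
Variable r : R.
Hypothesis r0 : 0 < r.
Variable e : X -> E.
Hypothesis e_ge0 : forall x, lat_le 0 (e x).
Variable Psi : X -> E -> R.
Implicit Types (x : X) (v w : E) (u : X -> E) (F : seq X).
Local Notation padd := (padd r).
Local Notation psub := (psub r).

Definition piece_cone x : set E := [set v | lat_le 0 v /\ ideal (e x) v].

Hypotheses (Psi_ge0 : forall x v, piece_cone x v -> 0 <= Psi x v)
  (PsiD : forall x v w, piece_cone x v -> piece_cone x w ->
    Psi x (padd v w) = Psi x v + Psi x w)
  (PsiZ : forall x c v, 0 < c -> piece_cone x v ->
    Psi x (c `^ r^-1 *: v) = c * Psi x v).

Definition state (x : X) (phi : E -> R) : Prop :=
  lat_hom (ideal (e x)) phi /\ phi (e x) = 1.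

Let T : Type := (X * (E -> R))%type.

(* The points of the space are the pairs of an index [x] and a lattice
   homomorphism on the principal ideal of [e x]; other pairs play no role. *)
Definition piece_fun u (t : T) : R :=
  if `[< state t.1 t.2 >] then (t.2 (u t.1)) `^ r else 0.

Lemma piece_funE u x phi : state x phi -> piece_fun u (x, phi) = (phi (u x)) `^ r.
Proof. by move=> h; rewrite /piece_fun asboolT. Qed.

Lemma piece_fun_out u x phi : ~ state x phi -> piece_fun u (x, phi) = 0.
Proof. by move=> h; rewrite /piece_fun asboolF. Qed.

Definition finitary F u := (forall x, piece_cone x (u x)) /\
  (forall x, x \notin F -> u x = 0).

Definition piece_functions : set (T -> R) :=
  [set f | exists F u, finitary F u /\ f = piece_fun u].

(** A homomorphism that vanishes at [e x] vanishes on the whole ideal; any other can be normalized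
    to a state. *)
Lemma state_ler x v w : piece_cone x v -> piece_cone x w ->
  (forall phi, state x phi -> phi v `^ r <= phi w `^ r) -> lat_le v w.
Proof.
move=> [v0 xv] [w0 xw] H; apply: (powR_ler r0 (e_ge0 x)) => // phi hphi.
have se := @ideal_subspace _ _ (e x).
have ee := ideal_self (e_ge0 x).
have : 0 <= phi (e x) by exact: (lat_hom_ge0 se hphi).
rewrite le_eqVlt => /predU1P[z|p].
  have phi0 y : ideal (e x) y -> lat_le 0 y -> phi y = 0.
    move=> xy y0; have [c [c0 yc _]] := idealE xy.
    apply/le_anti; rewrite (lat_hom_ge0 se hphi)// andbT.
    apply: le_trans (lat_hom_le hphi xy (idealZ c ee) yc) _.
    by rewrite (lat_homZ hphi)// -z mulr0.
  by rewrite !phi0.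
pose psi y := (phi (e x))^-1 * phi y.
have k0 : 0 <= (phi (e x))^-1 by rewrite invr_ge0 ltW.
have hpsi : state x psi.
  split; last by rewrite /psi mulVf// gt_eqF.
  split=> [a b xa xb|c a xa|a b xa xb]; rewrite /psi.
  - by rewrite (lat_homD hphi)// mulrDr.
  - by rewrite (lat_homZ hphi)// mulrCA.
  - by rewrite (lat_homJ hphi)// maxr_pMr.
have := H _ hpsi; rewrite /psi !powRM//; try exact: (lat_hom_ge0 se hphi).
by rewrite ler_pM2l// powR_gt0// invr_gt0.
Qed.

Lemma piece_fun_le u u' : (forall x, piece_cone x (u x)) ->
  (forall x, piece_cone x (u' x)) -> (forall t, piece_fun u t <= piece_fun u' t) ->
  forall x, lat_le (u x) (u' x).
Proof.
move=> hu hu' H x; apply: (@state_ler x) => // phi hphi.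
by have := H (x, phi); rewrite !piece_funE.
Qed.

Lemma piece_fun_inj u u' : (forall x, piece_cone x (u x)) ->
  (forall x, piece_cone x (u' x)) -> piece_fun u = piece_fun u' -> u = u'.
Proof.
by move=> hu hu' uu; apply/funext => x; apply: lat_eq;
  apply: piece_fun_le => // t; rewrite uu.
Qed.

Lemma piece_cone0 x : piece_cone x 0.
Proof. by split; [exact: lat_le_refl|exact: ideal0]. Qed.

Lemma piece_cone_padd x v w : piece_cone x v -> piece_cone x w ->
  piece_cone x (padd v w).
Proof. by move=> [v0 xv] [w0 xw]; split; [exact: padd_ge0|exact: ideal_padd]. Qed.

Lemma piece_cone_psub x v w : piece_cone x v -> piece_cone x w ->
  piece_cone x (psub v w).
Proof. by move=> [v0 xv] [w0 xw]; split; [exact: psub_ge0|exact: ideal_psub]. Qed.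

Lemma piece_cone_scale x c v : 0 <= c -> piece_cone x v -> piece_cone x (c *: v).
Proof. by move=> c0 [v0 xv]; split; [exact: lat_scale_ge0|exact: idealZ]. Qed.

Lemma piece_cone_self x : piece_cone x (e x).
Proof. by split => //; exact: ideal_self. Qed.

Lemma piece_cone_le x v w : piece_cone x w -> lat_le 0 v -> lat_le v w ->
  piece_cone x v.
Proof. by move=> [w0 xw] v0 vw; split => //; exact: ideal_pos_le vw. Qed.

Lemma Psi0 x : Psi x 0 = 0.
Proof.
have c0 := piece_cone0 x; have := PsiD c0 c0.
by rewrite padd0//; [lra|exact: lat_le_refl].
Qed.

Lemma Psi_mono x v w : piece_cone x v -> piece_cone x w -> lat_le v w ->
  Psi x v <= Psi x w.
Proof.
move=> cv cw vw; rewrite -(padd_psub r0 cv.1 vw) PsiD//; last exact: piece_cone_psub.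
by rewrite lerDl Psi_ge0//; exact: piece_cone_psub.
Qed.

Definition piece_integral (f : T -> R) : R := xget 0 [set c | exists F u,
  [/\ finitary F u, f = piece_fun u & c = \sum_(x <- undup F) Psi x (u x)]].

Lemma finitary_sum F G u : finitary F u -> uniq G ->
  (forall x, x \notin G -> u x = 0) ->
  \sum_(x <- undup F) Psi x (u x) = \sum_(x <- G) Psi x (u x).
Proof.
move=> [_ uF] uG uG0.
rewrite (bigID (fun x => x \in G))/= [X in _ + X]big1 ?addr0; last first.
  by move=> x /uG0 ->; rewrite Psi0.
rewrite [RHS](bigID (fun x => x \in F))/= [X in _ + X]big1 ?addr0; last first.
  by move=> x /uF ->; rewrite Psi0.
rewrite -big_filter -[RHS]big_filter; apply: perm_big; apply: uniq_perm.
- by rewrite filter_uniq// undup_uniq.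
- by rewrite filter_uniq.
- by move=> x; rewrite !mem_filter mem_undup andbC.
Qed.

Lemma piece_integralE F u : (forall x, piece_cone x (u x)) -> uniq F ->
  (forall x, x \notin F -> u x = 0) ->
  piece_integral (piece_fun u) = \sum_(x <- F) Psi x (u x).
Proof.
move=> hu uF u0; rewrite /piece_integral; case: xgetP; last first.
  move=> /(_ (\sum_(x <- undup F) Psi x (u x)))[].
  by exists F, u; split.
move=> c _ [G [u' [fu' uu ->]]].
have uu' := piece_fun_inj hu fu'.1 uu; rewrite -uu' in fu' *.
exact: finitary_sum.
Qed.

(** If no [u k] were below [eps *: e x], a single state would annihilate every positive part [z k]
    of [eps *: e x - u k]; it would satisfy [phi (u k) >= eps] for all [k], against the pointwise
    hypothesis. *)
Lemma piece_dini x (u : nat -> E) eps : (forall k, piece_cone x (u k)) ->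
  (forall k, lat_le (u k.+1) (u k)) ->
  (forall phi, state x phi -> exists k, phi (u k) = 0) -> 0 < eps ->
  exists k, lat_le (u k) (eps *: e x).
Proof.
move=> cu du hu eps0; apply: contrapT => /forallNP H.
have se := @ideal_subspace _ _ (e x); have ee := ideal_self (e_ge0 x).
pose z k := lat_join (eps *: e x - u k) 0.
have xz k : ideal (e x) (z k).
  by apply: ideal_join; [apply: idealB; [exact: idealZ|exact: (cu k).2]|exact: ideal0].
have phiz phi k : lat_hom (ideal (e x)) phi -> phi (z k) = Num.max (eps * phi (e x) - phi (u k)) 0.
  move=> hphi; have xu := (cu k).2; rewrite (lat_homJ hphi) ?(lat_homB se hphi)//.
  - by rewrite (lat_homZ hphi)// (lat_hom0 hphi)//; exact: ideal0.
  - exact: idealZ.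
  - by apply: idealB => //; exact: idealZ.
  - exact: ideal0.
have udec k l : (k <= l)%N -> lat_le (u l) (u k).
  elim: l => [|l IH]; first by rewrite leqn0 => /eqP ->; exact: lat_le_refl.
  rewrite leq_eqVlt => /predU1P[->|]; first exact: lat_le_refl.
  by move=> /IH; apply: lat_trans; exact: du.
have [|||||phi hphi [phie phiz0 _]] :=
    @exists_lat_hom_compact _ _ (e x) z (e x) 1 (e_ge0 x) xz.
- by move=> k; exact: lat_joinr.
- move=> k l kl; rewrite /z lat_joinP lat_joinr andbT.
  apply: lat_trans (lat_joinl _ _).
  by apply: lat_le_add; [exact: lat_le_refl|rewrite lat_le_opp; exact: udec].
- exact: ee.
- by [].
- move=> k c m m0 h; rewrite leNgt; apply/negP => c1; apply: (H k).
  have cee : piece_cone x (eps *: e x).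
    by apply: piece_cone_scale; [exact: ltW|exact: piece_cone_self].
  apply: (state_ler (cu k) cee) => phi [hphi phie].
  have xc : ideal (e x) (c *: e x + m *: z k) by apply: idealD; exact: idealZ.
  have := lat_hom_le hphi ee xc h.
  rewrite (lat_homD hphi) ?(lat_homZ hphi)//; try exact: idealZ.
  rewrite phie mulr1 phiz// phie mulr1 => h1.
  have pu0 : 0 <= phi (u k).
    by apply: (lat_hom_ge0 se hphi); [exact: (cu k).2|exact: (cu k).1].
  rewrite powR_le ?(ltW eps0)// leNgt.
  apply/negP => h2.
  move: h1; rewrite (max_idPr _); first by rewrite mulr0 addr0 leNgt c1.
  by rewrite subr_le0 ltW.
have [k phiu] := hu phi (conj hphi phie).
have := phiz0 k; rewrite phiz// phie phiu mulr1 subr0.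
by rewrite (max_idPl (ltW eps0)) => /eqP; rewrite gt_eqF.
Qed.

Lemma finitary_comb2 F F' u u' (h : E -> E -> E) : finitary F u ->
  finitary F' u' -> h 0 0 = 0 ->
  (forall x v w, piece_cone x v -> piece_cone x w -> piece_cone x (h v w)) ->
  finitary (F ++ F') (fun x => h (u x) (u' x)).
Proof.
move=> [hu u0] [hu' u'0] h0 hc; split=> [x|x]; first exact: hc.
by rewrite mem_cat negb_or => /andP[/u0 -> /u'0 ->].
Qed.

Lemma padd00 : padd 0 0 = 0 :> E.
Proof. by rewrite padd0//; exact: lat_le_refl. Qed.

Lemma psub00 : psub 0 0 = 0 :> E.
Proof.
have z := lat_le_refl (0 : E).
by have := padd_psub r0 z z; rewrite paddC// ?padd0//; exact: psub_ge0.
Qed.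

Lemma piece_fun_padd u u' t : (forall x, piece_cone x (u x)) ->
  (forall x, piece_cone x (u' x)) ->
  piece_fun (fun x => padd (u x) (u' x)) t = piece_fun u t + piece_fun u' t.
Proof.
case: t => x phi hu hu'; have [h|h] := pselect (state x phi); last first.
  by rewrite !piece_fun_out// addr0.
have [u0 xu] := hu x; have [u'0 xu'] := hu' x.
by rewrite !piece_funE// (padd_powR r0 (e_ge0 x) h.1).
Qed.

Lemma piece_fun_psub u u' t : (forall x, piece_cone x (u x)) ->
  (forall x, piece_cone x (u' x)) ->
  piece_fun (fun x => psub (u x) (u' x)) t =
  Num.max (piece_fun u t - piece_fun u' t) 0.
Proof.
case: t => x phi hu hu'; have [h|h] := pselect (state x phi); last first.
  by rewrite !piece_fun_out// subrr maxxx.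
have [u0 xu] := hu x; have [u'0 xu'] := hu' x.
by rewrite !piece_funE// (psub_powR r0 (e_ge0 x) h.1).
Qed.

Lemma piece_fun_scale c u t : 0 <= c -> (forall x, piece_cone x (u x)) ->
  piece_fun (fun x => c `^ r^-1 *: u x) t = c * piece_fun u t.
Proof.
case: t => x phi c0 hu; have [h|h] := pselect (state x phi); last first.
  by rewrite !piece_fun_out// mulr0.
have [u0 xu] := hu x.
by rewrite !piece_funE// (scale_powR r h.1) ?powR_ge0// powRVK.
Qed.

Lemma piece_daniell : daniell_integral piece_functions piece_integral.
Proof.
have lat00 : lat_meet (0 : E) 0 = 0 by rewrite lat_meet_idl// lat_le_refl.
split.
- exists [::], (fun=> 0); split; first by split=> // x; exact: piece_cone0.
  apply/funext => -[x phi]; have [h|h] := pselect (state x phi); last first.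
    by rewrite piece_fun_out.
  by rewrite piece_funE// (lat_hom0 h.1) ?powR0 ?gt_eqF//; exact: ideal0.
- move=> _ [x phi] [F [u [[hu _] ->]]]; rewrite /piece_fun.
  by case: ifP => // _; exact: powR_ge0.
- move=> _ _ [F [u [hu ->]]] [F' [u' [hu' ->]]].
  exists (F ++ F'), (fun x => padd (u x) (u' x)); split.
    apply: finitary_comb2 => //; [exact: padd00|].
    by move=> x v w; exact: piece_cone_padd.
  by apply/funext => t; rewrite piece_fun_padd//; [case: hu|case: hu'].
- move=> _ _ [F [u [hu ->]]] [F' [u' [hu' ->]]].
  exists (F ++ F'), (fun x => psub (u x) (u' x)); split.
    apply: finitary_comb2 => //; [exact: psub00|].
    by move=> x v w; exact: piece_cone_psub.
  by apply/funext => t; rewrite piece_fun_psub//; [case: hu|case: hu'].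
- move=> c _ c0 [F [u [[hu u0] ->]]].
  exists F, (fun x => c `^ r^-1 *: u x); split.
    split=> x; first by apply: piece_cone_scale => //; exact: powR_ge0.
    by move=> /u0 ->; rewrite scaler0.
  by apply/funext => t; rewrite piece_fun_scale.
- move=> _ [F [u [[hu u0] ->]]].
  (* A state takes the value 1 at [e x], so truncation at the constant 1 is the meet with [e x]. *)
  exists F, (fun x => lat_meet (u x) (e x)); split.
    split=> x; first by apply: (piece_cone_le (hu x));
      [apply: lat_meet_ge0 => //; case: (hu x)|exact: lat_meetl].
    by move=> /u0 ->; rewrite lat_meet_idl.
  apply/funext => -[x phi]; have [h|h] := pselect (state x phi); last first.
    by rewrite !piece_fun_out//; apply/min_idPl.
  have [ux0 xu] := hu x; have ee := ideal_self (e_ge0 x).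
  by rewrite !piece_funE// (meet_powR r0 h.1)// h.2 powR1.
- move=> _ [F [u [[hu u0] ->]]].
  have [M M0 hM] : exists2 M, 0 <= M & forall x, x \in F -> lat_le (u x) (M *: e x).
    elim: F {u0} => [|x F [M M0 IH]]; first by exists 0.
    have [c [c0 hc _]] := idealE (hu x).2; exists (M + c); first exact: addr_ge0.
    move=> y; rewrite inE => /predU1P[->|/IH yM]; rewrite scalerDl.
      rewrite -[X in lat_le X _]add0r; apply: lat_le_add => //.
      exact: lat_scale_ge0.
    rewrite -[X in lat_le X _]addr0; apply: lat_le_add => //.
    exact: lat_scale_ge0.
  exists (M `^ r) => -[x phi]; have [h|h] := pselect (state x phi); last first.
    by rewrite piece_fun_out// powR_ge0.
  have ee := ideal_self (e_ge0 x); have [ux0 xu] := hu x.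
  rewrite piece_funE//; have [xF|/u0 ->] := boolP (x \in F); last first.
    by rewrite (lat_hom0 h.1) ?powR0 ?gt_eqF ?powR_ge0//; exact: ideal0.
  rewrite powR_le//; last exact: (lat_hom_ge0 (ideal_subspace _) h.1).
  have := lat_hom_le h.1 xu (idealZ M ee) (hM _ xF).
  by rewrite (lat_homZ h.1)// h.2 mulr1.
- move=> _ [F [u [[hu u0] ->]]].
  pose u' x := if x \in F then e x else 0.
  exists (piece_fun u').
    exists F, u'; split=> //; split=> x; rewrite /u'; last by move=> /negbTE ->.
    by case: ifP => _; [exact: piece_cone_self|exact: piece_cone0].
  case=> x phi; have [h|h] := pselect (state x phi); last first.
    by rewrite !piece_fun_out// eqxx; split => //; left.
  rewrite !piece_funE// /u'; have phi0 : phi 0 = 0.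
    by rewrite (lat_hom0 h.1)//; exact: ideal0.
  have [xF|/u0 ->] := boolP (x \in F); first by rewrite h.2 powR1; split=> //; right.
  have p0 : (0:R) `^ r = 0 by rewrite powR0// gt_eqF.
  by rewrite phi0 p0 eqxx; split=> //; left.
- move=> _ [F [u [[hu u0] ->]]].
  rewrite (piece_integralE hu (undup_uniq F)); last by move=> x; rewrite mem_undup; exact: u0.
  by apply: sumr_ge0 => x _; exact: Psi_ge0.
- move=> _ _ [F [u [fu ->]]] [F' [u' [fu' ->]]].
  have fuu : finitary (F ++ F') (fun x => padd (u x) (u' x)).
    apply: finitary_comb2 => //; [exact: padd00|].
    by move=> x v w; exact: piece_cone_padd.
  have -> : (fun t => piece_fun u t + piece_fun u' t) =
      piece_fun (fun x => padd (u x) (u' x)).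
    by apply/funext => t; rewrite piece_fun_padd//; [case: fu|case: fu'].
  have uG := undup_uniq (F ++ F').
  rewrite (piece_integralE fuu.1 uG); last by move=> x; rewrite mem_undup; exact: fuu.2.
  rewrite (piece_integralE fu.1 uG); last first.
    by move=> x; rewrite mem_undup mem_cat negb_or => /andP[/fu.2].
  rewrite (piece_integralE fu'.1 uG); last first.
    by move=> x; rewrite mem_undup mem_cat negb_or => /andP[_ /fu'.2].
  by rewrite -big_split/=; apply: eq_bigr => x _; rewrite PsiD//; [exact: fu.1|exact: fu'.1].
- move=> c _ c0 [F [u [[hu u0] ->]]].
  have hcu x : piece_cone x (c `^ r^-1 *: u x).
    by apply: piece_cone_scale => //; exact: powR_ge0.
  have -> : (fun t => c * piece_fun u t) = piece_fun (fun x => c `^ r^-1 *: u x).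
    by apply/funext => t; rewrite piece_fun_scale.
  have uG := undup_uniq F.
  rewrite (piece_integralE hcu uG); last first.
    by move=> x; rewrite mem_undup => /u0 ->; rewrite scaler0.
  rewrite (piece_integralE hu uG); last by move=> x; rewrite mem_undup; exact: u0.
  rewrite mulr_sumr; apply: eq_bigr => x _.
  move: c0; rewrite le_eqVlt => /predU1P[<-|c0]; last exact: PsiZ.
  by rewrite mul0r powR0 ?invr_neq0 ?gt_eqF// scale0r Psi0.
- move=> h Ch hdec h0 eps eps0.
  have /choice[Fu HFu] : forall k, exists Fu : seq X * (X -> E),
      finitary Fu.1 Fu.2 /\ h k = piece_fun Fu.2.
    by move=> k; have [F [u ?]] := Ch k; exists (F, u).
  pose u k := (Fu k).2.
  have hu k : forall x, piece_cone x (u k x) by case: (HFu k).1.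
  have hE k : h k = piece_fun (u k) by case: (HFu k).
  have udec k x : lat_le (u k.+1 x) (u k x).
    by apply: piece_fun_le => // t; rewrite -!hE.
  have udecn k l x : (k <= l)%N -> lat_le (u l x) (u k x).
    elim: l => [|l IH]; first by rewrite leqn0 => /eqP ->; exact: lat_le_refl.
    rewrite leq_eqVlt => /predU1P[->|]; first exact: lat_le_refl.
    by move=> /IH; apply: lat_trans; exact: udec.
  (* Since the [u k] decrease, all of them vanish off the finite support of the first, and Dini's
     argument is needed on finitely many pieces only. *)
  pose F := undup (Fu 0%N).1.
  have u0 k x : x \notin F -> u k x = 0.
    rewrite mem_undup => xF; apply: lat_eq; last by case: (hu k x).
    by rewrite -((HFu 0%N).1.2 x xF); exact: (udecn 0%N k x).
  have intE k : piece_integral (h k) = \sum_(x <- F) Psi x (u k x).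
    by rewrite hE (piece_integralE (hu k) (undup_uniq (Fu 0%N).1))// => x; exact: u0.
  have small x d : 0 < d -> exists k, Psi x (u k x) <= d.
    move=> d0; have Pe := Psi_ge0 (piece_cone_self x).
    pose a := d / (1 + Psi x (e x)).
    have a0 : 0 < a by rewrite divr_gt0// ltr_wpDr.
    have [||||k hk] := @piece_dini x (fun k => u k x) (a `^ r^-1).
    + by move=> k; exact: hu.
    + by move=> k; exact: udec.
    + move=> phi hphi; have [k hk] := h0 (x, phi); exists k.
      by move: hk; rewrite hE piece_funE// => /powR_eq0_eq0.
    + exact: powR_gt0.
    exists k; apply: (@le_trans _ _ (Psi x (a `^ r^-1 *: e x))).
      apply: Psi_mono => //; apply: piece_cone_scale; first exact: powR_ge0.
      exact: piece_cone_self.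
    rewrite PsiZ//; last exact: piece_cone_self.
    rewrite /a -mulrA ler_piMr ?(ltW d0)// mulrC ler_pdivrMr ?mul1r ?lerDr//.
    by rewrite ltr_wpDr.
  suff [k hk] : exists k, \sum_(x <- F) Psi x (u k x) <= eps by exists k; rewrite intE.
  elim: F {u0 intE} eps eps0 => [|x F IH] eps eps0.
    by exists 0%N; rewrite big_nil ltW.
  have e2 : 0 < eps / 2 by rewrite divr_gt0.
  have [k hk] := small x _ e2; have [l hl] := IH _ e2.
  exists (maxn k l); rewrite big_cons.
  have : Psi x (u (maxn k l) x) <= Psi x (u k x).
    by apply: Psi_mono => //; apply: udecn; exact: leq_maxl.
  have : \sum_(x <- F) Psi x (u (maxn k l) x) <= \sum_(x <- F) Psi x (u l x).
    apply: ler_sum => y _; apply: Psi_mono => //; apply: udecn; exact: leq_maxr.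
  lra.
Qed.

End PieceSpace.

(** * Truncations and traces *)

Ltac lat_mem := repeat first [ assumption | exact: ideal0 | exact: ideal_subspace
  | apply: idealD | apply: idealB
  | apply: idealN | apply: ideal_meet | apply: ideal_join | apply: idealZ
  | apply: lat_add_ge0 | apply: lat_meet_ge0 | apply: lat_join_ge0 ].

Definition lat_pos {R : realType} {E : banachLatticeType R} (u : E) := lat_join u 0.

Definition lat_neg {R : realType} {E : banachLatticeType R} (u : E) := lat_join (- u) 0.

Section PositivePart.
Context {R : realType} {E : banachLatticeType R}.
Implicit Types u v w m : E.

Lemma ideal_abs_self u : ideal (lat_abs u) u.
Proof. exact/ideal_abs/ideal_self/lat_abs_ge0. Qed.

Lemma lat_pos_ge0 u : lat_le 0 (lat_pos u).
Proof. exact: lat_joinr. Qed.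

Lemma lat_neg_ge0 u : lat_le 0 (lat_neg u).
Proof. exact: lat_joinr. Qed.

Let eval u (P Q : E) : ideal (lat_abs u) P -> ideal (lat_abs u) Q ->
  (forall phi, lat_hom (ideal (lat_abs u)) phi -> phi P = phi Q) -> P = Q.
Proof. by move=> *; apply: (ideal_eqr (lat_abs_ge0 u)). Qed.

Lemma lat_posBneg u : lat_pos u - lat_neg u = u.
Proof.
have iu := ideal_abs_self u; apply: (eval (u := u)); rewrite /lat_pos /lat_neg.
- by lat_mem.
- by [].
move=> phi h; have sI := ideal_subspace (lat_abs u).
rewrite (lat_homB sI h) ?(lat_homJ h) ?(lat_homN h) ?(lat_hom0 h); lat_mem.
max_lra.
Qed.

Lemma lat_posDneg u : lat_pos u + lat_neg u = lat_abs u.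
Proof.
have iu := ideal_abs_self u; apply: (eval (u := u)); rewrite /lat_pos /lat_neg.
- by lat_mem.
- exact/ideal_self/lat_abs_ge0.
move=> phi h; have sI := ideal_subspace (lat_abs u).
rewrite (lat_homD h) ?(lat_homJ h) ?(lat_homN h) ?(lat_hom0 h); lat_mem.
max_lra.
Qed.

Lemma lat_pos_meet_neg u : lat_meet (lat_pos u) (lat_neg u) = 0.
Proof.
have iu := ideal_abs_self u; apply: (eval (u := u)); rewrite /lat_pos /lat_neg.
- by lat_mem.
- exact: ideal0.
move=> phi h; have sI := ideal_subspace (lat_abs u).
rewrite (lat_hom_meet sI h) ?(lat_homJ h) ?(lat_homN h) ?(lat_hom0 h); lat_mem.
max_lra.
Qed.

Lemma lat_pos_le_abs u : lat_le (lat_pos u) (lat_abs u).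
Proof. by rewrite /lat_pos lat_joinP lat_le_abs lat_abs_ge0. Qed.

Lemma lat_neg_le_abs u : lat_le (lat_neg u) (lat_abs u).
Proof. by rewrite /lat_neg lat_joinP lat_abs_ge0 andbT; exact: lat_joinr. Qed.

Lemma lat_absD u v : lat_le (lat_abs (u + v)) (lat_abs u + lat_abs v).
Proof.
rewrite lat_absP -[X in lat_le X _ && _]/(u + v) lat_le_add ?lat_le_abs//=.
rewrite -lat_le_opp opprK opprD; apply: lat_le_add; exact: lat_joinr.
Qed.

Lemma lat_absN u : lat_abs (- u) = lat_abs u.
Proof. by have := lat_absB 0 u; rewrite sub0r subr0. Qed.

Lemma lat_abs_subD u v : lat_le (lat_abs (u - v)) (lat_abs u + lat_abs v).
Proof. by rewrite -[in X in lat_le _ X](lat_absN v); exact: lat_absD. Qed.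

Lemma lat_meet_addl u v m : lat_le 0 u -> lat_le 0 v -> lat_le 0 m ->
  lat_le (lat_meet (u + v) m) (lat_meet u m + lat_meet v m).
Proof.
move=> u0 v0 m0; have [e0 iu iv im] := ideal_sum3 u0 v0 m0.
have sI := ideal_subspace (u + v + m).
apply: (ideal_ler e0); [by lat_mem..|move=> phi h].
have /= := lat_hom_ge0 sI h iu u0; have /= := lat_hom_ge0 sI h iv v0.
have /= := lat_hom_ge0 sI h im m0.
rewrite (lat_homD h) ?(lat_hom_meet sI h) ?(lat_homD h); lat_mem.
max_lra.
Qed.

Lemma lat_meet_addr u v m : lat_le 0 u -> lat_le 0 v -> lat_le 0 m ->
  lat_le (lat_meet u m + lat_meet v m) (lat_meet (u + v) (m + m)).
Proof. by move=> u0 v0 m0; rewrite lat_meetP !lat_le_add ?lat_meetl ?lat_meetr. Qed.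

Lemma lat_meet_padd r u v m : 0 < r -> lat_le 0 u -> lat_le 0 v -> lat_le 0 m ->
  lat_le (lat_meet (padd r u v) m) (padd r (lat_meet u m) (lat_meet v m)).
Proof.
move=> r0 u0 v0 m0; have [e0 iu iv im] := ideal_sum3 u0 v0 m0.
apply: (powR_ler r0 e0); lat_side => phi h.
rewrite (padd_powR r0 e0 h) ?(meet_powR r0 h) ?(padd_powR r0 e0 h); lat_side.
have := powR_ge0 (phi u) r; have := powR_ge0 (phi v) r; have := powR_ge0 (phi m) r.
max_lra.
Qed.

End PositivePart.

Section Trace.
Context {R : realType} {E : banachLatticeType R} {X : pointedType}.
Variable r : R.
Hypothesis r0 : 0 < r.
Variable e : X -> E.
Hypothesis e_ge0 : forall x, lat_le 0 (e x).
Implicit Types (x : X) (u v w s : E) (F G : nat -> seq X).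

(** An element of [I] need not lie in the ideal of [e x], where states are homomorphisms; its
    truncations at multiples of [e x] do. *)
Definition cut (A : seq X) k u x : E :=
  if x \in A then lat_meet u (k%:R *: e x) else 0.

Definition exhausting F := (forall k, uniq (F k)) /\
  (forall k, {subset F k <= F k.+1}).

(* The r-th power of the function that represents [u]. Only the countably many
   pieces listed by [F] are taken into account: [u] vanishes almost everywhere on
   each of the others, but possibly not on their union. *)
Definition trace F u (t : X * (E -> R)) : \bar R :=
  ereal_sup (range (fun k => (piece_fun r e (cut (F k) k u) t)%:E)).

Lemma ke_ge0 x k : lat_le 0 (k%:R *: e x).
Proof. by apply: lat_scale_ge0. Qed.

Lemma ke_mono x k l : (k <= l)%N -> lat_le (k%:R *: e x) (l%:R *: e x).
Proof.
move=> kl; rewrite -lat_subr_ge0 -scalerBl; apply: lat_scale_ge0 => //.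
by rewrite subr_ge0 ler_nat.
Qed.

Lemma piece_cone_meet x u k : lat_le 0 u -> piece_cone e x (lat_meet u (k%:R *: e x)).
Proof.
move=> u0; split; first by apply: lat_meet_ge0 => //; exact: ke_ge0.
apply: (@ideal_pos_le _ _ _ _ (k%:R *: e x)); last exact: lat_meetr.
  exact/idealZ/ideal_self.
by apply: lat_meet_ge0 => //; exact: ke_ge0.
Qed.

Lemma cut_cone A k u x : lat_le 0 u -> piece_cone e x (cut A k u x).
Proof.
move=> u0; rewrite /cut; case: ifP => _; last exact: piece_cone0.
exact: piece_cone_meet.
Qed.

Lemma cut_finitary A k u : lat_le 0 u -> finitary e A (cut A k u).
Proof. by move=> u0; split=> x; [exact: cut_cone|rewrite /cut => /negbTE ->]. Qed.

Lemma cut_mono (A B : seq X) k l u v x : {subset A <= B} -> (k <= l)%N ->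
  lat_le 0 u -> lat_le u v -> lat_le (cut A k u x) (cut B l v x).
Proof.
move=> AB kl u0 uv; have v0 := lat_trans u0 uv; rewrite /cut.
have [/AB ->|_] := boolP (x \in A); last by case: ifP => _;
  [exact: lat_meet_ge0 (ke_ge0 _ _)|exact: lat_le_refl].
rewrite lat_meetP; apply/andP; split; first exact: lat_trans (lat_meetl _ _) uv.
by apply: lat_trans (lat_meetr _ _) _; exact: ke_mono.
Qed.

Lemma piece_fun_mono (u v : X -> E) t : (forall x, piece_cone e x (u x)) ->
  (forall x, piece_cone e x (v x)) -> (forall x, lat_le (u x) (v x)) ->
  piece_fun r e u t <= piece_fun r e v t.
Proof.
case: t => x phi hu hv uv; have [h|h] := pselect (state e x phi); last first.
  by rewrite !piece_fun_out.
have [u0 xu] := hu x; have [v0 xv] := hv x; have sI := ideal_subspace (e x).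
rewrite !piece_funE// powR_le//.
- exact: (lat_hom_le h.1).
- exact: (lat_hom_ge0 sI h.1).
- exact: (lat_hom_ge0 sI h.1).
Qed.

Lemma cut_fun_mono (A B : seq X) k l u v t : {subset A <= B} -> (k <= l)%N ->
  lat_le 0 u -> lat_le u v ->
  piece_fun r e (cut A k u) t <= piece_fun r e (cut B l v) t.
Proof.
move=> AB kl u0 uv; have v0 := lat_trans u0 uv.
by apply: piece_fun_mono => x; [exact: cut_cone|exact: cut_cone|exact: cut_mono].
Qed.

Lemma piece_fun_ge0 (u : X -> E) t : 0 <= piece_fun r e u t.
Proof. by rewrite /piece_fun; case: ifP => // _; exact: powR_ge0. Qed.

Lemma exhausting_sub F k l : exhausting F -> (k <= l)%N -> {subset F k <= F l}.
Proof.
move=> [_ FS]; elim: l => [|l IH]; first by rewrite leqn0 => /eqP ->.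
by rewrite leq_eqVlt => /predU1P[->//|/IH H x /H]; exact: FS.
Qed.

Lemma trace_ge0 F u t : (0 <= trace F u t)%E.
Proof.
apply: le_trans (ereal_sup_ubound (_ : range _ (piece_fun r e (cut (F 0%N) 0 u) t)%:E)).
  by rewrite lee_fin piece_fun_ge0.
by exists 0%N.
Qed.

Lemma trace_ge F u t k : ((piece_fun r e (cut (F k) k u) t)%:E <= trace F u t)%E.
Proof. by apply: ereal_sup_ubound; exists k. Qed.

Lemma trace_mono F G u v t : (forall k, {subset F k <= G k}) -> lat_le 0 u ->
  lat_le u v -> (trace F u t <= trace G v t)%E.
Proof.
move=> FG u0 uv; apply: ge_ereal_sup => _ [k _ <-].
by apply: le_trans (trace_ge G v t k); rewrite lee_fin; exact: cut_fun_mono.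
Qed.

(** Since [phi (e x) = 1], the value at level [M] is the minimum of [M] and the value at level [k],
    and the latter is at most [B < M]. *)
Lemma hom_meet_stable phi x w (M : nat) k (B : R) : state e x phi ->
  lat_le 0 w -> (forall k, phi (lat_meet w (k%:R *: e x)) <= B) -> B < M%:R ->
  (M <= k)%N -> phi (lat_meet w (k%:R *: e x)) = phi (lat_meet w (M%:R *: e x)).
Proof.
move=> h w0 wB BM Mk; have sI := ideal_subspace (e x).
have [_ ik] := piece_cone_meet x k w0; have iM : ideal (e x) (M%:R *: e x).
  exact/idealZ/ideal_self.
have -> : lat_meet w (M%:R *: e x) = lat_meet (lat_meet w (k%:R *: e x)) (M%:R *: e x).
  apply: lat_eq; rewrite !lat_meetP ?lat_meetl ?lat_meetr ?andbT/=.
    by apply: lat_trans (lat_meetr _ _) _; exact: ke_mono.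
  by apply: lat_trans (lat_meetl _ _) (lat_meetl _ _).
rewrite [RHS](lat_hom_meet sI h.1)// (lat_homZ h.1) ?h.2 ?mulr1; last exact: ideal_self.
by rewrite (min_idPl _)// (le_trans (wB k))// ltW.
Qed.

Definition root F u t : R := fine (trace F u t) `^ r^-1.

Lemma root_ge0 F u t : 0 <= root F u t.
Proof. exact: powR_ge0. Qed.

(* Where the trace of [s] is finite, [root] is on [0, s] the evaluation of a
   lattice homomorphism at a fixed truncation level. *)
Lemma root_evaluation F s t : exhausting F -> lat_le 0 s ->
  (trace F s t < +oo)%E ->
  (forall w, lat_le 0 w -> lat_le w s -> trace F w t = 0%E) \/
  exists phi x (M : nat), [/\ state e x phi, t = (x, phi), x \in F M,
    forall w k, lat_le 0 w -> lat_le w s -> (M <= k)%N ->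
      phi (lat_meet w (k%:R *: e x)) = phi (lat_meet w (M%:R *: e x)) &
    forall w, lat_le 0 w -> lat_le w s ->
      trace F w t = (phi (lat_meet w (M%:R *: e x)) `^ r)%:E].
Proof.
case: t => x phi iF s0 sfin.
have zero : (forall k w, lat_le 0 w -> piece_fun r e (cut (F k) k w) (x, phi) = 0) ->
    forall w, lat_le 0 w -> lat_le w s -> trace F w (x, phi) = 0%E.
  move=> H w w0 ws; apply/le_anti; rewrite trace_ge0 andbT.
  by apply: ge_ereal_sup => _ [k _ <-]; rewrite H.
have [h|h] := pselect (state e x phi); last first.
  by left; apply: zero => k w _; exact: piece_fun_out.
have sI := ideal_subspace (e x).
have [[k0 xk0]|/forallNP xF] := pselect (exists k, x \in F k); last first.
  left; apply: zero => k w _; rewrite piece_funE// /cut (negbTE (introN idP (xF k))).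
  by rewrite (lat_hom0 h.1) ?powR0 ?gt_eqF//; exact: ideal0.
right; have tE : trace F s (x, phi) = (fine (trace F s (x, phi)))%:E.
  by rewrite fineK// ge0_fin_numE// trace_ge0.
pose B := root F s (x, phi).
have xF k : (k0 <= k)%N -> x \in F k.
  by move=> kk; exact: (exhausting_sub iF kk).
have phi0 k w : lat_le 0 w -> 0 <= phi (lat_meet w (k%:R *: e x)).
  by move=> w0; have [m0 im] := piece_cone_meet x k w0; exact: (lat_hom_ge0 sI h.1).
have phim w k l : lat_le 0 w -> (k <= l)%N ->
    phi (lat_meet w (k%:R *: e x)) <= phi (lat_meet w (l%:R *: e x)).
  move=> w0 kl; have [_ ik] := piece_cone_meet x k w0.
  have [_ il] := piece_cone_meet x l w0; apply: (lat_hom_le h.1 ik il).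
  rewrite lat_meetP lat_meetl; apply: lat_trans (lat_meetr _ _) _; exact: ke_mono.
have sB k : phi (lat_meet s (k%:R *: e x)) <= B.
  apply: le_trans (phim s k (maxn k k0) s0 (leq_maxl _ _)) _.
  rewrite -[leLHS](powRK r0 (phi0 _ _ s0)) /B /root powR_le ?invr_gt0 ?powR_ge0//.
    rewrite -lee_fin -tE; have := trace_ge F s (x, phi) (maxn k k0).
    by rewrite piece_funE// /cut xF ?leq_maxr.
  by apply: fine_ge0; exact: trace_ge0.
(* Above the bound [B], so that truncation no longer acts at the point, and late enough for [x] to
   be listed. *)
pose M := maxn (Num.bound B) k0.
have BM : B < M%:R.
  apply: lt_le_trans (archi_boundP (root_ge0 F s _)) _.
  by rewrite ler_nat leq_maxl.
have wB w k : lat_le 0 w -> lat_le w s -> phi (lat_meet w (k%:R *: e x)) <= B.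
  move=> w0 ws; apply: le_trans (sB k).
  have [_ ik] := piece_cone_meet x k w0; have [_ il] := piece_cone_meet x k s0.
  apply: (lat_hom_le h.1 ik il).
  by rewrite lat_meetP lat_meetr andbT; apply: lat_trans (lat_meetl _ _) ws.
exists phi, x, M; split=> //.
- by apply: xF; exact: leq_maxr.
- by move=> w k w0 ws Mk; apply: (hom_meet_stable h w0 _ BM Mk) => l; exact: (wB _ _ w0 ws).
move=> w w0 ws; apply/le_anti/andP; split; last first.
  have := trace_ge F w (x, phi) M; rewrite piece_funE// /cut xF//.
  exact: leq_maxr.
apply: ge_ereal_sup => _ [k _ <-]; rewrite lee_fin piece_funE// /cut.
case: ifP => _; last by rewrite (lat_hom0 h.1) ?powR0 ?gt_eqF ?powR_ge0//; exact: ideal0.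
rewrite powR_le ?phi0//; apply: le_trans (phim w k (maxn k M) w0 (leq_maxl _ _)) _.
rewrite (@hom_meet_stable phi x w M (maxn k M) B)// ?leq_maxr// => l; exact: (wB _ _ w0 ws).
Qed.

Lemma traceE F s w t : exhausting F -> lat_le 0 w -> lat_le w s ->
  (trace F s t < +oo)%E -> trace F w t = (root F w t `^ r)%:E.
Proof.
move=> iF w0 ws sfin; have wfin : (trace F w t < +oo)%E.
  by apply: le_lt_trans sfin; by apply: (@trace_mono F F) => // k x.
rewrite /root powRVK//; first by rewrite fineK// ge0_fin_numE// trace_ge0.
by apply: fine_ge0; exact: trace_ge0.
Qed.

Lemma rootD F s a b t : exhausting F -> lat_le 0 a -> lat_le 0 b ->
  lat_le (a + b) s -> (trace F s t < +oo)%E ->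
  root F (a + b) t = root F a t + root F b t.
Proof.
move=> iF a0 b0 abs sfin; have ab0 := lat_add_ge0 a0 b0.
have s0 := lat_trans ab0 abs.
have as_ : lat_le a s.
  by apply: lat_trans abs; rewrite -[X in lat_le X _]addr0; apply: lat_le_add => //; exact: lat_le_refl.
have bs : lat_le b s.
  by apply: lat_trans abs; rewrite -[X in lat_le X _]add0r; apply: lat_le_add => //; exact: lat_le_refl.
rewrite /root; case: (root_evaluation iF s0 sfin) => [H|[phi [x [M [h _ _ st H]]]]].
  by rewrite !H//= powR0 ?addr0// invr_eq0 gt_eqF.
have [ma ia] := piece_cone_meet x M a0; have [mb ib] := piece_cone_meet x M b0.
have [mab iab] := piece_cone_meet x M ab0.
have [mab2 iab2] := piece_cone_meet x (M + M) ab0.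
have sI := ideal_subspace (e x).
rewrite !H//= !powRK//; try exact: (lat_hom_ge0 sI h.1).
have Me := ke_ge0 x M.
rewrite -(lat_homD h.1)//; apply/le_anti/andP; split.
  by apply: (lat_hom_le h.1) => //; [exact: idealD|exact: lat_meet_addl].
(* The sum of two truncations at level [M] is bounded by a truncation at level [2 M], whose value is
   the same as at level [M]. *)
rewrite -(st (a + b) (M + M)%N) ?leq_addr//.
apply: (lat_hom_le h.1) => //; first exact: idealD.
by rewrite natrD scalerDl; exact: lat_meet_addr.
Qed.

Lemma root_meet F s a b t : exhausting F -> lat_le 0 a -> lat_le 0 b ->
  lat_le a s -> lat_le b s -> (trace F s t < +oo)%E ->
  root F (lat_meet a b) t = Num.min (root F a t) (root F b t).
Proof.
move=> iF a0 b0 as_ bs sfin; have s0 := lat_trans a0 as_.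
have ab0 := lat_meet_ge0 a0 b0; have abs := lat_trans (lat_meetl a b) as_.
rewrite /root; case: (root_evaluation iF s0 sfin) => [H|[phi [x [M [h _ _ st H]]]]].
  by rewrite !H//= minxx.
have [ma ia] := piece_cone_meet x M a0; have [mb ib] := piece_cone_meet x M b0.
have [mab iab] := piece_cone_meet x M ab0.
have sI := ideal_subspace (e x).
rewrite !H//= !powRK//; try exact: (lat_hom_ge0 sI h.1).
rewrite -(lat_hom_meet sI h.1)//; congr phi.
apply: lat_eq; rewrite !lat_meetP; repeat (apply/andP; split);
  rewrite ?lat_meetl ?lat_meetr//.
- by apply: lat_trans (lat_meetl _ _) (lat_meetl _ _).
- by apply: lat_trans (lat_meetl _ _) (lat_meetr _ _).
- by apply: lat_trans (lat_meetl _ _) (lat_meetl _ _).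
- by apply: lat_trans (lat_meetr _ _) (lat_meetl _ _).
- by apply: lat_trans (lat_meetl _ _) (lat_meetr _ _).
Qed.

Lemma root0 F t : exhausting F -> root F 0 t = 0.
Proof.
move=> iF; suff -> : root F 0 t = fine 0 `^ r^-1 by rewrite powR0// invr_eq0 gt_eqF.
congr (fine _ `^ _); apply/le_anti; rewrite trace_ge0 andbT.
apply: ge_ereal_sup => _ [k _ <-]; case: t => x phi.
have [h|h] := pselect (state e x phi); last by rewrite piece_fun_out.
rewrite piece_funE// /cut lat_meet_idl ?if_same; last exact: ke_ge0.
by rewrite (lat_hom0 h.1) ?powR0 ?gt_eqF//; exact: ideal0.
Qed.

Definition rep F u t : R := root F (lat_pos u) t - root F (lat_neg u) t.

Lemma rep_pos F u t : exhausting F -> lat_le 0 u -> rep F u t = root F u t.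
Proof.
move=> iF u0; have n0 : lat_neg u = 0.
  apply: lat_eq; last exact: lat_joinr.
  by rewrite /lat_neg lat_joinP lat_le_refl andbT -lat_le_opp opprK oppr0.
have p0 : lat_pos u = u.
  apply: lat_eq; last exact: lat_joinl.
  by rewrite /lat_pos lat_joinP lat_le_refl.
by rewrite /rep n0 p0 root0// subr0.
Qed.

Lemma repB F u v t : exhausting F ->
  (trace F ((lat_abs u + lat_abs v) + (lat_abs u + lat_abs v))%R t < +oo)%E ->
  rep F (u - v) t = rep F u t - rep F v t.
Proof.
move=> iF; set s := (_ + _)%R => sfin; rewrite /rep.
have [[[pu nu] pv] nv] := (lat_pos_ge0 u, lat_neg_ge0 u, lat_pos_ge0 v, lat_neg_ge0 v).
have [puv nuv] := (lat_pos_ge0 (u - v), lat_neg_ge0 (u - v)).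
(* The difference is rewritten as an equality between sums of positive elements, since [rootD]
   applies to positive elements below [s] only. *)
have E1 : lat_pos (u - v) + (lat_neg u + lat_pos v) =
          lat_neg (u - v) + (lat_pos u + lat_neg v).
  have posE w : lat_pos w = w + lat_neg w.
    by apply/eqP; rewrite -subr_eq lat_posBneg.
  rewrite !posE [u - v + _]addrC -addrA; congr (_ + _).
  by rewrite [lat_neg u + _]addrCA addrA subrK addrA.
have S1 : lat_le (lat_pos (u - v) + (lat_neg u + lat_pos v)) s.
  apply: lat_le_add.
    exact: lat_trans (lat_pos_le_abs _) (lat_abs_subD _ _).
  by apply: lat_le_add; [exact: lat_neg_le_abs|exact: lat_pos_le_abs].
have S2 : lat_le (lat_neg (u - v) + (lat_pos u + lat_neg v)) s.
  apply: lat_le_add.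
    exact: lat_trans (lat_neg_le_abs _) (lat_abs_subD _ _).
  by apply: lat_le_add; [exact: lat_pos_le_abs|exact: lat_neg_le_abs].
have le2 (a b : E) : lat_le 0 a -> lat_le b (a + b).
  move=> a0; rewrite -[X in lat_le X _]add0r.
  by apply: lat_le_add => //; exact: lat_le_refl.
have H1 := rootD iF puv (lat_add_ge0 nu pv) S1 sfin.
have H2 := rootD iF nuv (lat_add_ge0 pu nv) S2 sfin.
have H3 := rootD iF nu pv (lat_trans (le2 _ _ puv) S1) sfin.
have H4 := rootD iF pu nv (lat_trans (le2 _ _ nuv) S2) sfin.
have : root F (lat_pos (u - v) + (lat_neg u + lat_pos v)) t =
       root F (lat_neg (u - v) + (lat_pos u + lat_neg v)) t by rewrite E1.
rewrite H1 H2 H3 H4.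
move: (root F (lat_pos (u - v)) t) (root F (lat_neg (u - v)) t) (root F (lat_pos u) t).
move: (root F (lat_neg u) t) (root F (lat_pos v) t) (root F (lat_neg v) t).
move=> a b c a1 b1 c1 h; clear -h; lra.
Qed.

(** The positive and negative parts are disjoint, so one of their roots vanishes at [t], and the
    modulus of the difference is the sum. *)
Lemma norm_rep F u t : exhausting F -> (trace F (lat_abs u) t < +oo)%E ->
  `|rep F u t| = root F (lat_abs u) t.
Proof.
move=> iF ufin; rewrite /rep.
have [pu nu] := (lat_pos_ge0 u, lat_neg_ge0 u).
have := @root_meet F (lat_abs u) (lat_pos u) (lat_neg u) t iF pu nu
  (lat_pos_le_abs u) (lat_neg_le_abs u) ufin.
rewrite lat_pos_meet_neg root0// => H.
have S : lat_le (lat_pos u + lat_neg u) (lat_abs u).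
  by rewrite lat_posDneg; exact: lat_le_refl.
have := rootD iF pu nu S ufin; rewrite lat_posDneg => ->.
have := root_ge0 F (lat_pos u) t; have := root_ge0 F (lat_neg u) t.
move: H; case: (leP (root F (lat_pos u) t) (root F (lat_neg u) t)) => ? <- _ _.
  by rewrite sub0r add0r normrN ger0_norm// root_ge0.
by rewrite subr0 addr0 ger0_norm// root_ge0.
Qed.

End Trace.

(** * Approximation in the r-th mean *)

Section PowerInequalities.
Context {R : realType}.
Variable r : R.
Hypothesis r1 : 1 <= r.
Implicit Types a b c : R.

Let r0 : 0 < r. Proof. exact: lt_le_trans r1. Qed.

(** Each of [b = a] and [b = c] satisfies [b]^ r <= b * (a + c) [^ (r - 1)], as [r >= 1]; the two
    are added. *)
Lemma powR_super a c : 0 <= a -> 0 <= c -> a `^ r + c `^ r <= (a + c) `^ r.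
Proof.
move=> a0 c0.
have powS b : 0 < b -> b `^ r = b * b `^ (r - 1).
  move=> b0; rewrite -[in LHS](subrKC 1 r) [LHS]powRD; last by rewrite (gt_eqF b0) implybT.
  by rewrite powRr1// ltW.
have H b : 0 <= b -> b <= a + c -> b `^ r <= b * (a + c) `^ (r - 1).
  rewrite le_eqVlt => /predU1P[<-|b0] bac.
    by rewrite mul0r powR0// gt_eqF.
  rewrite (powS b b0) ler_wpM2l ?(ltW b0)// ge0_ler_powR ?nnegrE ?subr_ge0//; first exact: ltW.
  exact: addr_ge0.
have ac0 := addr_ge0 a0 c0.
move: (ac0); rewrite le_eqVlt => /predU1P[ac|acp].
  have [-> ->] : a = 0 /\ c = 0 by lra.
  by rewrite addr0 powR0 ?gt_eqF// addr0.
apply: le_trans (lerD (H _ a0 _) (H _ c0 _)) _; rewrite ?lerDl ?lerDr//.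
by rewrite -mulrDl -powS.
Qed.

(** Superadditivity for the smaller number and the difference. This converts [L_1] estimates between
    r-th powers into [L_r] estimates. *)
Lemma powR_dist a b : 0 <= a -> 0 <= b -> `|a - b| `^ r <= `|a `^ r - b `^ r|.
Proof.
wlog ab : a b / a <= b.
  move=> H a0 b0; have [|/ltW] := leP a b; first by move/H; exact.
  by rewrite distrC (distrC (a `^ r)) => /H; exact.
move=> a0 b0; have := @powR_super a (b - a) a0; rewrite subr_ge0 => /(_ ab).
rewrite (addrC a) subrK distrC (distrC (a `^ r)) ger0_norm ?subr_ge0// => h.
by apply: le_trans (ler_norm _); lra.
Qed.

Lemma powR_normD a b : `|a + b| `^ r <= 2 `^ r * (`|a| `^ r + `|b| `^ r) :> R.
Proof.
apply: (@le_trans _ _ ((2 * Num.max `|a| `|b|) `^ r)).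
  rewrite ge0_ler_powR ?(ltW r0) ?nnegrE ?mulr_ge0 ?le_max ?normr_ge0//.
  by apply: le_trans (ler_normD _ _) _; max_lra.
rewrite powRM ?le_max ?normr_ge0// ler_wpM2l ?powR_ge0//.
have := powR_ge0 `|a| r; have := powR_ge0 `|b| r.
by case: (leP `|a| `|b|) => _; lra.
Qed.

End PowerInequalities.

Lemma lee_of_add {R : realType} (x : \bar R) (a b eps : R) :
  (a%:E - eps%:E <= b%:E -> x + b%:E <= a%:E -> x <= eps%:E)%E.
Proof.
case: x => [x| |]; rewrite -?EFinD -?EFinB ?lee_fin ?leey ?leNye//.
by move=> h1 h2; lra.
Qed.

Section PowerApproximation.
Context d (T : measurableType d) (R : realType) (mu : {measure set T -> \bar R}).
Variable r : R.
Hypothesis r1 : 1 <= r.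
Implicit Types f g : T -> R.

Let r0 : 0 < r. Proof. exact: lt_le_trans r1. Qed.

Definition powint f : \bar R := locked (\int[mu]_t (`|f t| `^ r)%:E)%E.

Lemma powintE f : powint f = (\int[mu]_t (`|f t| `^ r)%:E)%E.
Proof. by rewrite /powint -lock. Qed.

Lemma measurable_powint f : measurable_fun setT f ->
  measurable_fun setT (fun t => (`|f t| `^ r)%:E).
Proof.
move=> mf; apply/measurable_EFinP; apply: (measurableT_comp (measurable_powR _)).
exact: measurableT_comp.
Qed.

Lemma powint_ge0 f : (0 <= powint f)%E.
Proof. by rewrite powintE; exact: integral_ge0. Qed.

Lemma powint_le f g : measurable_fun setT f -> measurable_fun setT g ->
  (forall t, `|f t| <= `|g t|) -> (powint f <= powint g)%E.
Proof.
move=> mf mg fg; rewrite !powintE; apply: ge0_le_integral => //.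
- exact: measurable_powint.
- exact: measurable_powint.
- by move=> t _; rewrite lee_fin ge0_ler_powR ?nnegrE ?(ltW r0).
Qed.

Lemma powint_ae f g : measurable_fun setT f -> measurable_fun setT g ->
  {ae mu, forall t, f t = g t} -> powint f = powint g.
Proof.
move=> mf mg fg; rewrite !powintE.
apply: ae_eq_integral; [exact: measurableT|exact: measurable_powint..|].
by apply: filterS fg => t -> _.
Qed.

Lemma powintD_le f g : measurable_fun setT f -> measurable_fun setT g ->
  (powint (f \+ g)%R <= (2 `^ r)%:E * (powint f + powint g))%E.
Proof.
move=> mf mg; have mf' := measurable_powint mf; have mg' := measurable_powint mg.
have fg0 t : (0 <= (`|f t| `^ r)%:E + (`|g t| `^ r)%:E :> \bar R)%E.
  by rewrite -EFinD lee_fin addr_ge0 ?powR_ge0.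
rewrite !powintE -ge0_integralD//; try by move=> t _; rewrite lee_fin powR_ge0.
rewrite -ge0_integralZl_EFin//; try exact: (emeasurable_funD mf' mg'); try exact: powR_ge0.
apply: ge0_le_integral => //.
- by apply: measurable_powint; exact: measurable_funD.
- by apply: emeasurable_funM => //; exact: emeasurable_funD.
- by move=> t _; rewrite -EFinD -EFinM lee_fin; exact: powR_normD.
Qed.

Lemma powintZ c f : measurable_fun setT f -> 0 <= c ->
  powint (fun t => c * f t) = ((c `^ r)%:E * powint f)%E.
Proof.
move=> mf c0; rewrite !powintE -ge0_integralZl_EFin ?powR_ge0//.
- by apply: eq_integral => t _; rewrite -EFinM -powRM// normrM (ger0_norm c0).
- exact: measurable_powint.
Qed.

Variable K : set (T -> R).
Hypotheses (K_sub : forall f g, K f -> K g -> K (f \- g))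
  (K_closed : forall f, measurable_fun setT f -> (forall eps, 0 < eps ->
    exists2 g, K g & measurable_fun setT g /\ (powint (f \- g)%R <= eps%:E)%E) -> K f)
  (K_indic : forall c (A : set T), 0 <= c -> measurable A -> (mu A < +oo)%E ->
    K (fun t => c * \1_A t)).

Let K_eq f g : K f -> f =1 g -> K g.
Proof. by move=> Kf /funext <-. Qed.

Let K0 : K (fun=> 0).
Proof.
apply: K_eq (K_indic (lexx 0) measurable0 _) _; first by rewrite measure0 ltry.
by move=> t; rewrite mul0r.
Qed.

Let K_add f g : K f -> K g -> K (f \+ g).
Proof.
by move=> Kf Kg; apply: K_eq (K_sub Kf (K_sub K0 Kg)) _ => t /=; rewrite sub0r opprK.
Qed.

Let K_sum I (s : seq I) (P : pred I) (F : I -> T -> R) : (forall i, P i -> K (F i)) ->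
  K (fun t => \sum_(i <- s | P i) F i t).
Proof.
move=> KF; elim: s => [|i s IH]; first by apply: K_eq K0 _ => t; rewrite big_nil.
have [Pi|nPi] := boolP (P i); last first.
  by apply: K_eq IH _ => t; rewrite big_cons (negbTE nPi).
by apply: K_eq (K_add (KF _ Pi) IH) _ => t; rewrite big_cons Pi.
Qed.

Import HBNNSimple.

Let K_simple (g : {nnsfun T >-> R}) : (powint g < +oo)%E -> K g.
Proof.
move=> gfin; have [s sE] : exists s : seq R, forall t,
    g t = \sum_(y <- s) (y * \1_(g @^-1` [set y]) t).
  by eexists => t; rewrite fimfunE fsbig_finite//=; exact: fimfunP.
(* Only the positive levels are kept: the zero set of [g] may have infinite measure, the other level
   sets do not, by Markov's inequality. *)
apply: (K_eq (f := fun t => \sum_(y <- s | 0 < y) (y * \1_(g @^-1` [set y]) t))).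
  apply: K_sum => y y0; apply: K_indic; [exact: ltW|exact: measurable_funPTI|].
  set A := g @^-1` [set y]; have mA : measurable A by exact: measurable_funPTI.
  have h : ((y `^ r)%:E * mu A <= powint g)%E.
    rewrite powintE -(setIT A) -integral_indic// -ge0_integralZl_EFin ?powR_ge0//.
      apply: ge0_le_integral => //.
      - by move=> t _; rewrite -EFinM lee_fin mulr_ge0// powR_ge0.
      - apply/measurable_EFinP; apply: measurable_funM => //.
      - exact: measurable_powint.
      - move=> t _; rewrite -EFinM lee_fin indicE.
        have [|_] := boolP (t \in A); last by rewrite mulr0 powR_ge0.
        by rewrite inE /A/= => ->; rewrite mulr1 ger0_norm// ltW.
    by apply/measurable_EFinP; exact: measurable_indic.
  have yr : 0 < y `^ r by rewrite powR_gt0.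
  have := le_lt_trans h gfin; case: (mu A) (measure_ge0 mu A) => [a _ _| |]//.
    exact: ltry.
  by rewrite gt0_muley// lte_fin.
move=> t; rewrite sE big_mkcond/=; apply: eq_bigr => y _.
case: ifPn => //; rewrite -leNgt le_eqVlt => /predU1P[->|y0]; first by rewrite mul0r.
rewrite indicE memNset ?mulr0// => /= gy.
by move: y0; rewrite -gy ltNge fun_ge0.
Qed.

(** By superadditivity [(f - g)^r + g^r <= f^r], so closeness of the integrals of the powers implies
    closeness in the r-th mean. *)
Let powint_sub f g (eps : R) : measurable_fun setT f -> measurable_fun setT g ->
  (forall t, 0 <= g t) -> (forall t, g t <= f t) -> (powint f < +oo)%E ->
  (powint f - eps%:E <= powint g)%E -> (powint (f \- g)%R <= eps%:E)%E.
Proof.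
move=> mf mg g0 gf ffin hg; have f0 t : 0 <= f t by exact: le_trans (gf t).
have mfg : measurable_fun setT (f \- g) by exact: measurable_funB.
have fnum : powint f \is a fin_num by rewrite ge0_fin_numE ?powint_ge0.
have gnum : powint g \is a fin_num.
  have /ge0_fin_numE -> := powint_ge0 g.
  apply: le_lt_trans ffin; apply: (powint_le mg mf) => t.
  by rewrite !ger0_norm.
have : (powint (f \- g)%R + powint g <= powint f)%E.
  rewrite !powintE -ge0_integralD//; [|exact: measurable_powint..].
  apply: ge0_le_integral => //.
  - by move=> t _; rewrite -EFinD lee_fin addr_ge0 ?powR_ge0.
  - by apply: emeasurable_funD; exact: measurable_powint.
  - exact: measurable_powint.
  - move=> t _; rewrite -EFinD lee_fin /= ger0_norm ?subr_ge0// !ger0_norm//.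
    by rewrite -[in leRHS](subrK (g t) (f t)) powR_super// subr_ge0.
by move: hg; rewrite -(fineK fnum) -(fineK gnum); exact: lee_of_add.
Qed.

Let simple_approximation f : measurable_fun setT f -> (forall t, 0 <= f t) ->
  exists g : nat -> T -> R, [/\ forall k, measurable_fun setT (g k),
    forall k, (powint (g k) < +oo)%E -> K (g k), forall k t, 0 <= g k t,
    forall t, nondecreasing_seq (fun k => g k t) &
    forall t, g k t @[k --> \oo] --> f t].
Proof.
move=> mf f0; have mf' : measurable_fun setT (EFin \o f) by exact/measurable_EFinP.
have f0' t : setT t -> (0 <= (EFin \o f) t)%E by move=> _; rewrite lee_fin.
exists (fun k => nnsfun_approx measurableT mf' k); split.
- by move=> k; exact: measurable_funPT.
- by move=> k; exact: K_simple.
- by move=> k t; exact: fun_ge0.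
- by move=> t k l kl; have /lefP := nd_nnsfun_approx measurableT mf' kl; exact.
- by move=> t; have /fine_cvgP[_] := cvg_nnsfun_approx measurableT mf' f0' (x := t) I.
Qed.

Let K_nonneg f : measurable_fun setT f -> (forall t, 0 <= f t) ->
  (powint f < +oo)%E -> K f.
Proof.
move=> mf f0 ffin; have [g [mg Kg g0 gnd gcvg]] := simple_approximation mf f0.
have gf k t : g k t <= f t.
  rewrite -(cvg_lim _ (gcvg t))//; apply: (nondecreasing_cvgn_le (gnd t)).
  by apply: cvgP; exact: gcvg.
have gfin k : (powint (g k) < +oo)%E.
  apply: le_lt_trans ffin; apply: (powint_le (mg k) mf) => t.
  by rewrite !ger0_norm.
have cvgi : powint (g k) @[k --> \oo] --> powint f.
  have -> : powint f = (\int[mu]_t limn (fun k => (`|g k t| `^ r)%:E))%E.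
    rewrite powintE; apply: eq_integral => t _; apply/esym/cvg_lim => //.
    apply: cvg_EFin; first exact: nearW.
    apply: (@cvg_comp _ _ _ (fun k => g k t) (fun a : R => `|a| `^ r)).
      exact: gcvg.
    exact: (continuous_norm_powR r0).
  under eq_fun do rewrite powintE.
  apply: cvg_monotone_convergence => //.
  - by move=> k; exact: measurable_powint.
  - move=> t _ k l kl; rewrite lee_fin ge0_ler_powR ?nnegrE ?(ltW r0)//.
    by rewrite !ger0_norm//; exact: gnd.
apply: K_closed => // eps eps0.
have fnum : powint f \is a fin_num by rewrite ge0_fin_numE ?powint_ge0.
have lt : (powint f - eps%:E < powint f)%E.
  by rewrite -(fineK fnum) -EFinB lte_fin ltrBlDr ltrDl.
have /cvgi[k _ /(_ k (leqnn _)) hk] : nbhs (powint f) [set y | powint f - eps%:E < y]%E.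
  by apply: open_nbhs_nbhs; split=> //; exact: open_ereal_gt_ereal.
exists (g k); first exact: Kg (gfin k).
split; first exact: mg.
exact: (powint_sub mf (mg k) (g0 k) (gf k) ffin (ltW hk)).
Qed.

(** Simple functions, their monotone limits, and differences of nonnegative functions successively
    fall into [K], which is meant to be the closure of the range of the representation. *)
Lemma powint_approximation f : measurable_fun setT f -> (powint f < +oo)%E -> K f.
Proof.
move=> mf ffin.
have H g : measurable_fun setT g -> (powint g < +oo)%E -> K (fun t => Num.max (g t) 0).
  move=> mg gfin; have mg0 : measurable_fun setT (fun t => Num.max (g t) 0).
    exact: measurable_maxr.
  apply: (K_nonneg mg0) => [t|]; first by rewrite le_max lexx orbT.
  apply: le_lt_trans gfin; apply: powint_le => // t.
  by rewrite ger0_norm ?le_max ?lexx ?orbT// ge_max ler_norm normr_ge0.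
have mNf : measurable_fun setT (fun t => - f t) by exact: measurableT_comp.
have Nfin : (powint (fun t => - f t)%R < +oo)%E.
  by apply: le_lt_trans ffin; apply: powint_le => // t; rewrite normrN.
apply: K_eq (K_sub (H _ mf ffin) (H _ mNf Nfin)) _ => t /=.
max_lra.
Qed.

End PowerApproximation.

(** * Representation of r-additive functionals *)

Section IntegralFacts.
Local Open Scope ereal_scope.
Context d (T : measurableType d) (R : realType) (mu : {measure set T -> \bar R}).
Implicit Types f g : T -> \bar R.

Lemma ge0_integrable f : measurable_fun setT f -> (forall t, 0 <= f t) ->
  \int[mu]_t f t < +oo -> mu.-integrable setT f.
Proof.
move=> mf f0 fi; apply/integrableP; split=> //.
by under eq_integral do rewrite gee0_abs//.
Qed.

Lemma ae_lty f : measurable_fun setT f -> (forall t, 0 <= f t) ->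
  \int[mu]_t f t < +oo -> {ae mu, forall t, f t < +oo}.
Proof.
move=> mf f0 fi; have := integrable_ae measurableT (ge0_integrable mf f0 fi).
by apply: filterS => t /(_ I); rewrite ge0_fin_numE.
Qed.

Lemma ae_eq_of_le f g : measurable_fun setT f -> measurable_fun setT g ->
  (forall t, 0 <= f t) -> (forall t, f t <= g t) ->
  \int[mu]_t f t = \int[mu]_t g t -> \int[mu]_t f t < +oo ->
  {ae mu, forall t, f t = g t}.
Proof.
move=> mf mg f0 fg fgi fi; have g0 t : 0 <= g t by exact: le_trans (fg t).
have gi : \int[mu]_t g t < +oo by rewrite -fgi.
have If := ge0_integrable mf f0 fi; have Ig := ge0_integrable mg g0 gi.
have gB : \int[mu]_t (g \- f) t = 0.
  rewrite integralB//= fgi subee// ge0_fin_numE//; exact: integral_ge0.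
have finf := ae_lty mf f0 fi; have fing := ae_lty mg g0 gi.
have mgf : measurable_fun setT (g \- f) by exact: emeasurable_funB.
have : \int[mu]_t `|(g \- f) t| = 0.
  rewrite -gB; apply: ae_eq_integral => //; first exact: measurableT_comp.
  by apply: filterS finf => t ft _ /=; rewrite gee0_abs// sube_ge0// ge0_fin_numE// ft.
move/(ae_eq_integral_abs mu measurableT mgf); move: finf fing.
apply: filterS3 => t ft gt /(_ I) /= /eqP.
by rewrite sube_eq ?ge0_fin_numE// ?add0e => /eqP.
Qed.

End IntegralFacts.

(** * The measure on the pieces and the map into [L_r] *)

Section RepresentationMeasure.
Context {R : realType} {E : banachLatticeType R} {X : pointedType}.
Variable r : R.
Hypothesis r1 : 1 <= r.
Variable e : X -> E.
Hypothesis e_ge0 : forall x, lat_le 0 (e x).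
Local Notation D := (generated_pos e setT).
Variables (N : E -> R) (Psi : X -> E -> R).
Hypotheses (N_ge0 : forall u, D u -> 0 <= N u)
  (N_add : forall u v, D u -> D v -> N (padd r u v) = N u + N v).
Hypotheses (Psi_ge0 : forall x u, D u -> 0 <= Psi x u)
  (Psi_add : forall x u v, D u -> D v -> Psi x (padd r u v) = Psi x u + Psi x v)
  (Psi_scale : forall x c u, 0 < c -> D u -> Psi x (c `^ r^-1 *: u) = c * Psi x u)
  (Psi_sum_le : forall A n u, D u -> uniq A ->
    \sum_(x <- A) Psi x (lat_meet u (n%:R *: e x)) <= N u)
  (Psi_sum_ge : forall u eps, D u -> 0 < eps -> exists A n, uniq A /\
    N u <= \sum_(x <- A) Psi x (lat_meet u (n%:R *: e x)) + eps).

Let r0 : 0 < r. Proof. exact: lt_le_trans r1. Qed.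

Lemma piece_cone_pos x u : piece_cone e x u -> D u.
Proof.
by move=> [u0 xu]; split=> //; exists (e x) => //; exact: generated1.
Qed.

Lemma piece_space_daniell :
  daniell_integral (piece_functions r e) (piece_integral r e Psi).
Proof.
apply: piece_daniell => // [x v|x v w|x c v c0] /piece_cone_pos.
- exact: Psi_ge0.
- by move=> Dv /piece_cone_pos; exact: Psi_add.
- exact: Psi_scale.
Qed.

Let dan := piece_space_daniell.

Variable mu : {outer_measure set (X * (E -> R)) -> \bar R}.
Hypothesis muE : forall A, mu A = dan_outer (piece_functions r e) (piece_integral r e Psi) A.

Local Notation U := (caratheodory_type mu).
Local Notation mes := (mu : set U -> \bar R).
Implicit Types (F G H : nat -> seq X) (u v w s : E) (t : U).

Definition cut_sum F k u := \sum_(x <- F k) Psi x (lat_meet u (k%:R *: e x)).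

Lemma pos_meetk x k u : D u -> D (lat_meet u (k%:R *: e x)).
Proof. by move=> Du; exact: pos_meet Du (posT (pos_elem e_ge0 x k)). Qed.

Lemma Psi_nondecreasing x u v : D u -> D v -> lat_le u v -> Psi x u <= Psi x v.
Proof.
move=> Du Dv uv; rewrite -(padd_psub r0 Du.1 uv) Psi_add//; last exact: pos_psub.
by rewrite lerDl Psi_ge0//; exact: pos_psub.
Qed.

Lemma measurable_piece_fun (f : U -> R) : piece_functions r e f ->
  measurable_fun [set: U] f.
Proof. exact: (dan_measurable_fun dan muE). Qed.

Lemma integral_piece_fun (f : U -> R) : piece_functions r e f ->
  (\int[mes]_t (f t)%:E = (piece_integral r e Psi f)%:E)%E.
Proof. exact: (dan_integral dan muE). Qed.

Lemma cut_function F k u : lat_le 0 u ->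
  piece_functions r e (piece_fun r e (cut e (F k) k u)).
Proof. by move=> u0; exists (F k), (cut e (F k) k u); split=> //; exact: cut_finitary. Qed.

Lemma integral_cut F k u : D u -> uniq (F k) ->
  (\int[mes]_t (piece_fun r e (cut e (F k) k u) t)%:E = (cut_sum F k u)%:E)%E.
Proof.
move=> [u0 Du] uF; rewrite integral_piece_fun; last exact: cut_function.
have [hu h0] := cut_finitary e_ge0 (F k) k u0.
rewrite (piece_integralE r0 e_ge0 _ hu uF h0); last first.
  by move=> x v w /piece_cone_pos cv /piece_cone_pos; exact: Psi_add.
by congr EFin; apply: eq_big_seq => x xF; rewrite /cut xF.
Qed.

Lemma cut_fun_nd F u t : exhausting F -> lat_le 0 u ->
  nondecreasing_seq (fun k => (piece_fun r e (cut e (F k) k u) t)%:E).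
Proof.
move=> eF u0 k l kl; rewrite lee_fin; apply: cut_fun_mono => //.
  exact: exhausting_sub eF kl.
exact: lat_le_refl.
Qed.

Lemma trace_cvg F u t : exhausting F -> lat_le 0 u ->
  (fun k => (piece_fun r e (cut e (F k) k u) t)%:E) @ \oo --> trace r e F u t.
Proof. by move=> eF u0; apply: ereal_nondecreasing_cvgn; exact: cut_fun_nd. Qed.

Lemma measurable_cut F k u : lat_le 0 u ->
  measurable_fun [set: U] (fun t => (piece_fun r e (cut e (F k) k u) t)%:E).
Proof. by move=> u0; apply/measurable_EFinP/measurable_piece_fun/cut_function. Qed.

Lemma measurable_trace F u : exhausting F -> lat_le 0 u ->
  measurable_fun [set: U] (trace r e F u).
Proof.
move=> eF u0; apply: (@emeasurable_fun_cvg _ U R setT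
  (fun k t => (piece_fun r e (cut e (F k) k u) t)%:E)) => [k|t _].
  exact: measurable_cut.
exact: trace_cvg.
Qed.

Lemma measurable_root F u : exhausting F -> lat_le 0 u ->
  measurable_fun [set: U] (root r e F u).
Proof.
move=> eF u0; apply: (measurableT_comp (measurable_powR _)).
by apply: measurableT_comp => //; exact: measurable_trace.
Qed.

Lemma measurable_rep F u : exhausting F -> measurable_fun [set: U] (rep r e F u).
Proof.
by move=> eF; apply: measurable_funB; apply: measurable_root => //;
  [exact: lat_pos_ge0|exact: lat_neg_ge0].
Qed.

(** The countably many listed pieces carry the whole mass of [u]; the trace along [F] then has
    integral [N u]. *)
Definition exhausts F u := exhausting F /\
  forall eps, 0 < eps -> exists k, N u <= cut_sum F k u + eps.

Lemma integral_trace_cvg F u : exhausting F -> D u ->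
  (cut_sum F k u)%:E @[k --> \oo] --> (\int[mes]_t trace r e F u t)%E.
Proof.
move=> eF Du; have [u0 _] := Du.
have : (\int[mes]_t (piece_fun r e (cut e (F k) k u) t)%:E)%E @[k --> \oo] -->
    (\int[mes]_t limn (fun k => (piece_fun r e (cut e (F k) k u) t)%:E))%E.
  apply: cvg_monotone_convergence => //.
  - by move=> k; exact: measurable_cut.
  - by move=> k t _; rewrite lee_fin piece_fun_ge0.
  - by move=> t _; exact: cut_fun_nd.
have -> : (fun k => \int[mes]_t (piece_fun r e (cut e (F k) k u) t)%:E)%E =
    (fun k => (cut_sum F k u)%:E).
  by apply/funext => k; rewrite integral_cut//; case: eF.
move=> /cvg_trans; apply; rewrite (_ : (fun t => limn _) = trace r e F u)//.
apply/funext => t; apply/cvg_lim => //; exact: trace_cvg.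
Qed.

Lemma integral_trace_le F u : exhausting F -> D u ->
  (\int[mes]_t trace r e F u t <= (N u)%:E)%E.
Proof.
move=> eF Du; have h := integral_trace_cvg eF Du.
rewrite -(cvg_lim _ h)//; apply: lime_le; first exact: cvgP h.
by apply: nearW => k; rewrite lee_fin; apply: Psi_sum_le => //; case: eF.
Qed.

Lemma integral_trace F u : exhausts F u -> D u ->
  (\int[mes]_t trace r e F u t = (N u)%:E)%E.
Proof.
move=> [eF hF] Du; apply/le_anti; rewrite integral_trace_le//=.
apply/lee_addgt0Pr => eps eps0; have [k hk] := hF _ eps0.
apply: (@le_trans _ _ ((cut_sum F k u)%:E + eps%:E)%E); first by rewrite -EFinD lee_fin.
have [u0 _] := Du; rewrite leeD2r// -integral_cut//; last by case: eF.
apply: ge0_le_integral => //.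
- by move=> t _; rewrite lee_fin piece_fun_ge0.
- exact: measurable_cut.
- exact: measurable_trace.
- by move=> t _; exact: trace_ge.
Qed.

Lemma ae_trace_lty F u : exhausting F -> D u ->
  {ae mes, forall t, (trace r e F u t < +oo)%E}.
Proof.
move=> eF Du; have [u0 _] := Du; apply: ae_lty.
- exact: measurable_trace.
- by move=> t; exact: trace_ge0.
- by apply: le_lt_trans (integral_trace_le eF Du) _; rewrite ltry.
Qed.

Lemma cut_sum_sub F G k l u : exhausting F -> exhausting G -> D u ->
  (k <= l)%N -> {subset F k <= G l} -> cut_sum F k u <= cut_sum G l u.
Proof.
move=> [uF _] [uG _] Du kl FG; rewrite /cut_sum [leRHS](bigID (mem (F k)))/=.
rewrite -[leLHS]addr0 lerD//; last first.
  by apply: sumr_ge0 => x _; apply: Psi_ge0; exact: pos_meetk.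
rewrite -[leRHS]big_filter [leRHS](perm_big (F k)); last first.
  apply: uniq_perm => //; first by rewrite filter_uniq.
  by move=> x; rewrite mem_filter; case: (boolP (x \in F k)) => //= /FG ->.
apply: ler_sum => x _; apply: Psi_nondecreasing; [exact: pos_meetk|exact: pos_meetk|].
rewrite lat_meetP lat_meetl; apply: lat_trans (lat_meetr _ _) _; exact: ke_mono.
Qed.

Lemma exhausts_sub F G u : D u -> exhausts F u -> exhausting G ->
  (forall k, {subset F k <= G k}) -> exhausts G u.
Proof.
move=> Du [eF hF] eG FG; split=> // eps /hF[k hk]; exists k; apply: le_trans hk _.
by rewrite lerD2r; exact: cut_sum_sub.
Qed.

(** Write [v = padd u w]. Truncation is subadditive for [padd], and the listed part of [w] is at
    most [N w], so the mass of [u] missed by [F] is at most the mass of [v] missed by [F]. *)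
Lemma exhausts_le F u v : D v -> lat_le 0 u -> lat_le u v -> exhausts F v ->
  exhausts F u.
Proof.
move=> Dv u0 uv [eF hF]; split=> // eps /hF[k hk]; exists k.
have Du := pos_le Dv u0 uv; have Dw := pos_psub r0 e_ge0 Dv Du.
have E1 := padd_psub r0 u0 uv; move: hk; rewrite -[in N v]E1 N_add// => hk.
suff : cut_sum F k v <= cut_sum F k u + N (psub r v u) by lra.
apply: (@le_trans _ _ (cut_sum F k u + cut_sum F k (psub r v u))); last first.
  by rewrite lerD2l; apply: Psi_sum_le => //; case: eF.
rewrite /cut_sum -big_split/=; apply: ler_sum => x _.
rewrite -Psi_add; [|exact: pos_meetk..]; apply: Psi_nondecreasing; first exact: pos_meetk.
  by apply: pos_padd => //; exact: pos_meetk.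
rewrite -[in lat_meet v _]E1; apply: lat_meet_padd => //; first exact: Dw.1.
exact: ke_ge0.
Qed.

Lemma exhausting_union F G : exhausting F -> exhausting G ->
  exists H, [/\ exhausting H, forall k, {subset F k <= H k} &
    forall k, {subset G k <= H k}].
Proof.
move=> [_ FS] [_ GS]; exists (fun k => undup (F k ++ G k)); split.
- split=> [k|k x]; first exact: undup_uniq.
  by rewrite !mem_undup !mem_cat => /orP[/FS ->//|/GS ->]; rewrite orbT.
- by move=> k x xF; rewrite mem_undup mem_cat xF.
- by move=> k x xG; rewrite mem_undup mem_cat xG orbT.
Qed.

Lemma exhausts_exists u : D u -> exists F, exhausts F u.
Proof.
move=> Du; have /choice[A hA] : forall j : nat, exists An : seq X * nat, uniq An.1 /\
    N u <= \sum_(x <- An.1) Psi x (lat_meet u (An.2%:R *: e x)) + j.+1%:R^-1.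
  move=> j; have j0 : (0 : R) < j.+1%:R^-1 by rewrite invr_gt0.
  have [A [n h]] := Psi_sum_ge Du j0.
  by exists (A, n).
pose F k := undup (flatten [seq (A j).1 | j <- iota 0 k.+1]).
have AF j k x : (j <= k)%N -> x \in (A j).1 -> x \in F k.
  move=> jk xA; rewrite mem_undup; apply/flattenP; exists (A j).1 => //.
  by apply/mapP; exists j => //; rewrite mem_iota.
have eF : exhausting F.
  split=> [k|k x]; first exact: undup_uniq.
  rewrite {1}/F mem_undup => /flattenP[_ /mapP[j + ->]].
  by rewrite mem_iota => /= jk; apply: AF; rewrite ltnW.
exists F; split=> // eps eps0; have [j hj] := ltr_add_invr eps0.
(* The index of the list is also its truncation level, so it must exceed both [j] and the level that
   goes with [A j]. *)
rewrite add0r in hj; exists (maxn j (A j).2).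
have [uA hA'] := hA j; apply: (le_trans hA'); apply: lerD; last exact: ltW.
have eA : exhausting (fun=> (A j).1) by split=> // k x.
apply: (@cut_sum_sub (fun=> (A j).1) F (A j).2) => //; first exact: leq_maxr.
by move=> x; apply: AF; exact: leq_maxl.
Qed.

(** The trace along the longer list is pointwise at least the other one, and both have the finite
    integral [N u]. *)
Lemma trace_sub_ae F G u : D u -> exhausts F u -> exhausting G ->
  (forall k, {subset F k <= G k}) ->
  {ae mes, forall t, trace r e F u t = trace r e G u t}.
Proof.
move=> Du hF eG FG; have hG := exhausts_sub Du hF eG FG.
have [u0 _] := Du; have [eF _] := hF; apply: ae_eq_of_le.
- exact: measurable_trace.
- exact: measurable_trace.
- by move=> t; exact: trace_ge0.
- by move=> t; apply: trace_mono => //; exact: lat_le_refl.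
- by rewrite !integral_trace.
- by rewrite integral_trace// ltry.
Qed.

Local Notation I := (generated_ideal e setT).

Lemma abs_pos u : I u -> D (lat_abs u).
Proof. by move=> Iu; split; [exact: lat_abs_ge0|exact: generated_ideal_abs]. Qed.

Lemma rep_sub_ae F G u : I u -> exhausts F (lat_abs u) -> exhausting G ->
  (forall k, {subset F k <= G k}) ->
  {ae mes, forall t, rep r e F u t = rep r e G u t}.
Proof.
move=> Iu hF eG FG; have Du := abs_pos Iu.
have Dp := pos_le Du (lat_pos_ge0 u) (lat_pos_le_abs u).
have Dn := pos_le Du (lat_neg_ge0 u) (lat_neg_le_abs u).
have hp := exhausts_le Du (lat_pos_ge0 u) (lat_pos_le_abs u) hF.
have hn := exhausts_le Du (lat_neg_ge0 u) (lat_neg_le_abs u) hF.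
apply: filterS2 (trace_sub_ae Dp hp eG FG) (trace_sub_ae Dn hn eG FG) => t p n.
by rewrite /rep /root p n.
Qed.

Lemma integral_rep F u : I u -> exhausts F (lat_abs u) ->
  (\int[mes]_t (`|rep r e F u t| `^ r)%:E = (N (lat_abs u))%:E)%E.
Proof.
move=> Iu hF; have Du := abs_pos Iu; have [eF _] := hF.
rewrite -(integral_trace hF Du); apply: ae_eq_integral => //.
- apply/measurable_EFinP; apply: (measurableT_comp (measurable_powR _)).
  by apply: measurableT_comp => //; exact: measurable_rep.
- exact: measurable_trace (lat_abs_ge0 u).
apply: filterS (ae_trace_lty eF Du) => t tfin _.
rewrite norm_rep// (@traceE _ _ _ _ r0 _ e_ge0 F (lat_abs u))//.
  exact: lat_abs_ge0.
exact: lat_le_refl.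
Qed.

(** On the common list [H] the representation is compatible with subtraction wherever the trace of
    [2 (|u| + |v|)] is finite, that is, almost everywhere; changing lists costs null sets. *)
Lemma rep_sub_eq_ae F G H u v : I u -> I v -> exhausts F (lat_abs u) ->
  exhausts G (lat_abs v) -> exhausting H -> (forall k, {subset F k <= H k}) ->
  (forall k, {subset G k <= H k}) ->
  {ae mes, forall t, rep r e F u t - rep r e G v t = rep r e H (u - v) t}.
Proof.
move=> Iu Iv hF hG eH FH GH.
have Ds : D ((lat_abs u + lat_abs v) + (lat_abs u + lat_abs v)).
  have [_ Z J] := generated_ideal_subspace e_ge0 setT.
  have [/= AA _ _] := generated_ideal_subspace e_ge0 setT.
  have [u0 Du] := abs_pos Iu; have [v0 Dv] := abs_pos Iv.
  have Duv := AA _ _ Du Dv; split; last exact: (AA _ _ Duv Duv).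
  by do ?apply: lat_add_ge0.
move: (rep_sub_ae Iu hF eH FH) (rep_sub_ae Iv hG eH GH) (ae_trace_lty eH Ds).
by apply: filterS3 => t -> -> /(repB r0 e_ge0 eH) ->.
Qed.

Lemma exhausts_common F G u v : exhausting F -> exhausting G -> I u -> I v ->
  exists H, [/\ exhausts H (lat_abs (u - v)), forall k, {subset F k <= H k} &
    forall k, {subset G k <= H k}].
Proof.
move=> eF eG Iu Iv; have Iuv : I (u - v).
  have [AA Z _] := generated_ideal_subspace e_ge0 setT.
  by apply: AA => //; rewrite -scaleN1r; exact: Z.
have [K hK] := exhausts_exists (abs_pos Iuv).
have [H [eH FH GH]] := exhausting_union eF eG.
have [L [eL HL KL]] := exhausting_union eH hK.1.
exists L; split.
- exact: exhausts_sub (abs_pos Iuv) hK eL KL.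
- by move=> k x /FH; exact: HL.
- by move=> k x /GH; exact: HL.
Qed.

Lemma integral_rep_sub F G u v : I u -> I v -> exhausts F (lat_abs u) ->
  exhausts G (lat_abs v) ->
  (\int[mes]_t (`|rep r e F u t - rep r e G v t| `^ r)%:E = (N (lat_abs (u - v)))%:E)%E.
Proof.
move=> Iu Iv hF hG; have [H [hH FH GH]] := exhausts_common hF.1 hG.1 Iu Iv.
have Iuv : I (u - v).
  have [AA Z _] := generated_ideal_subspace e_ge0 setT.
  by apply: AA => //; rewrite -scaleN1r; exact: Z.
rewrite -(integral_rep Iuv hH); apply: ae_eq_integral => //.
- apply/measurable_EFinP; apply: (measurableT_comp (measurable_powR _)).
  apply: measurableT_comp => //.
  by apply: measurable_funB; apply: measurable_rep; [exact: hF.1|exact: hG.1].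
- apply/measurable_EFinP; apply: (measurableT_comp (measurable_powR _)).
  by apply: measurableT_comp => //; exact: measurable_rep hH.1.
apply: filterS (rep_sub_eq_ae Iu Iv hF hG hH.1 FH GH) => t -> //.
Qed.

Hypothesis Psi_approx : forall x u eps, D u -> 0 < eps -> exists g w,
  [/\ D g, D w, padd r g w = u, Psi x g = 0 & N w <= Psi x u + eps].

Local Notation pint := (powint mes r).

Definition approximable (f : U -> R) := measurable_fun setT f /\
  forall eps, 0 < eps -> exists u F, [/\ I u, exhausts F (lat_abs u) &
    (pint (f \- rep r e F u)%R <= eps%:E)%E].

Let two_r : 0 < 2 `^ r :> R. Proof. by rewrite powR_gt0. Qed.

Lemma approximable_closed (f : U -> R) : measurable_fun setT f ->
  (forall eps, 0 < eps -> exists2 g, approximable g &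
    measurable_fun setT g /\ (pint (f \- g)%R <= eps%:E)%E) -> approximable f.
Proof.
move=> mf H; split=> // eps eps0; pose d := eps / 2 `^ r / 2.
have d0 : 0 < d by rewrite !divr_gt0.
have [g [_ Hg] [mg fg]] := H d d0; have [u [F [Iu hF gu]]] := Hg d d0.
exists u, F; split=> //.
have mu' : measurable_fun [set: U] (rep r e F u) by apply: measurable_rep; exact: hF.1.
have mfg := measurable_funB mf mg.
have mgu := measurable_funB mg mu'.
rewrite (_ : (f \- rep r e F u)%R = ((f \- g) \+ (g \- rep r e F u))%R); last first.
  by apply/funext => t /=; rewrite addrA subrK.
apply: le_trans (powintD_le mes r1 mfg mgu) _.
apply: (@le_trans _ _ ((2 `^ r)%:E * (d%:E + d%:E))%E).
  by rewrite lee_pmul2l ?lte_fin ?two_r//; exact: (leeD fg gu).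
rewrite -EFinD -EFinM lee_fin /d.
by rewrite -splitr mulrC divfK// gt_eqF.
Qed.

Lemma approximable_sub (f g : U -> R) : approximable f -> approximable g ->
  approximable (f \- g).
Proof.
move=> [mf Hf] [mg Hg]; split; first exact: measurable_funB.
move=> eps eps0; pose d := eps / 2 `^ r / 2.
have d0 : 0 < d by rewrite !divr_gt0.
have [u [F [Iu hF fu]]] := Hf d d0; have [v [G [Iv hG gv]]] := Hg d d0.
have [H [hH FH GH]] := exhausts_common hF.1 hG.1 Iu Iv.
have Iuv : I (u - v).
  have [AA Z _] := generated_ideal_subspace e_ge0 setT.
  by apply: AA => //; rewrite -scaleN1r; exact: Z.
exists (u - v), H; split=> //.
have mu' : measurable_fun [set: U] (rep r e F u) by apply: measurable_rep; exact: hF.1.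
have mv' : measurable_fun [set: U] (rep r e G v) by apply: measurable_rep; exact: hG.1.
have mh' : measurable_fun [set: U] (rep r e H (u - v)) by apply: measurable_rep; exact: hH.1.
have mfu := measurable_funB mf mu'.
have mgv := measurable_funB mv' mg.
rewrite (@powint_ae _ _ _ mes r _ ((f \- rep r e F u) \+ (rep r e G v \- g))%R); first last.
- apply: filterS (rep_sub_eq_ae Iu Iv hF hG hH.1 FH GH) => t /= <-.
  by move: (f t) (g t) (rep r e F u t) (rep r e G v t) => a b c k; ring.
- exact: (measurable_funD mfu mgv).
- exact: (measurable_funB (measurable_funB mf mg) mh').
apply: le_trans (powintD_le mes r1 mfu mgv) _.
apply: (@le_trans _ _ ((2 `^ r)%:E * (d%:E + d%:E))%E).
  rewrite lee_pmul2l ?lte_fin ?two_r//; apply: (leeD fu).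
  have -> : pint (rep r e G v \- g)%R = pint (g \- rep r e G v)%R; last exact: gv.
  by rewrite !powintE; apply: eq_integral => t _ /=; rewrite distrC.
rewrite -EFinD -EFinM lee_fin /d.
by rewrite -splitr mulrC divfK// gt_eqF.
Qed.

Definition single x v : X -> E := fun y => if y == x then v else 0.

Lemma single_cone x v : piece_cone e x v -> forall y, piece_cone e y (single x v y).
Proof.
by move=> xv y; rewrite /single; case: eqP => [->//|_]; exact: piece_cone0.
Qed.

Lemma single_finitary x v : piece_cone e x v -> finitary e [:: x] (single x v).
Proof.
move=> xv; split; first exact: single_cone.
by move=> y; rewrite inE /single => /negbTE ->.
Qed.

Lemma single_function x v : piece_cone e x v ->
  piece_functions r e (piece_fun r e (single x v)).
Proof. by move=> xv; exists [:: x], (single x v); split=> //; exact: single_finitary. Qed.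

Lemma integral_single x v : piece_cone e x v ->
  (\int[mes]_t (piece_fun r e (single x v) t)%:E = (Psi x v)%:E)%E.
Proof.
move=> xv; rewrite integral_piece_fun; last exact: single_function.
have [hu h0] := single_finitary xv.
rewrite (@piece_integralE _ _ _ _ r0 _ e_ge0 _ _ [:: x])//; last first.
  by move=> y v' w /piece_cone_pos cv /piece_cone_pos; exact: Psi_add.
by rewrite big_seq1 /single eqxx.
Qed.

Lemma trace_ge_single F x w t : (forall k, x \in F k) -> piece_cone e x w ->
  ((piece_fun r e (single x w) t)%:E <= trace r e F w t)%E.
Proof.
move=> xF xw; have [w0 [c c0]] := xw; rewrite lat_abs_pos// => wc.
apply: le_trans (trace_ge r e F w t (Num.bound c)); rewrite lee_fin.
apply: piece_fun_mono => [|y|y|y] //; first exact: single_cone.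
  exact: cut_cone.
rewrite /single /cut; case: eqP => [->|_].
  rewrite xF lat_meetP lat_le_refl/=; apply: lat_trans wc _.
  rewrite -lat_subr_ge0 -scalerBl; apply: lat_scale_ge0 => //.
  by rewrite subr_ge0 ltW// archi_boundP.
case: ifP => _; last exact: lat_le_refl.
by apply: lat_meet_ge0 => //; exact: ke_ge0.
Qed.

Lemma measurable_piece_root (f : U -> R) : piece_functions r e f ->
  measurable_fun setT (fun t => f t `^ r^-1).
Proof.
by move=> Cf; apply: (measurableT_comp (measurable_powR _)); exact: measurable_piece_fun.
Qed.

(** The approximant is not [v], which may have mass on other pieces, but some [w <= v] with the same
    mass on the piece [x] and at most [eps] on the rest. *)
Lemma approximable_single x v : piece_cone e x v ->
  approximable (fun t => (piece_fun r e (single x v) t) `^ r^-1).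
Proof.
move=> xv; split; first exact/measurable_piece_root/single_function.
move=> eps eps0; have Dv := piece_cone_pos xv.
have [g [w [Dg Dw gw Pg Nw]]] := Psi_approx x Dv eps0.
have wv : lat_le w v.
  by have [g0 _] := Dg; have [w0 _] := Dw; rewrite -gw paddC//; exact: padd_geL.
have xw : piece_cone e x w by exact: piece_cone_le xv Dw.1 wv.
have Pvw : Psi x v = Psi x w by rewrite -gw Psi_add// Pg add0r.
have [G hG] := exhausts_exists Dw.
have ex : exhausting (fun=> [:: x]) by split=> // k y.
have [F [eF GF xF']] := exhausting_union hG.1 ex.
have hF := exhausts_sub Dw hG eF GF.
have xF k : x \in F k by apply: (xF' k); rewrite inE.
exists w, F; split; [exact: Dw.2|by rewrite lat_abs_pos//; case: Dw|].
set q := fun t : U => _; set fv := piece_fun r e (single x v).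
set fw := piece_fun r e (single x w).
have mv := measurable_piece_fun (single_function xv).
have mw := measurable_piece_fun (single_function xw).
have mq : measurable_fun setT q by exact/measurable_piece_root/single_function.
have mt := measurable_trace eF Dw.1.
have mr := measurable_rep w eF.
have mqr := measurable_funB mq mr.
(* The integrated form of [|q - rep w|^r <= |fv - trace w| <= (fv - fw) + (trace w - fw)], with the
   negative terms moved to the left since finiteness is not known yet. *)
have le_int : (pint (q \- rep r e F w)%R + (Psi x w)%:E + (Psi x w)%:E <=
    (Psi x v)%:E + (N w)%:E)%E.
  rewrite -[in leRHS](integral_trace hF Dw) -(integral_single xv) -!(integral_single xw).
  have pv t : (0 <= (fv t)%:E)%E by rewrite lee_fin piece_fun_ge0.
  have pw t : (0 <= (fw t)%:E)%E by rewrite lee_fin piece_fun_ge0.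
  have pt t : (0 <= trace r e F w t)%E by exact: trace_ge0.
  have pq t : (0 <= (`|(q \- rep r e F w) t| `^ r)%:E)%E by rewrite lee_fin powR_ge0.
  have mw' : measurable_fun setT (fun t : U => (fw t)%:E) by exact/measurable_EFinP.
  have mv' : measurable_fun setT (fun t : U => (fv t)%:E) by exact/measurable_EFinP.
  have mq' := measurable_powint r mqr.
  have mqw := emeasurable_funD mq' mw'.
  rewrite powintE -ge0_integralD// -ge0_integralD//; last first.
    by move=> t _; exact: adde_ge0.
  rewrite -ge0_integralD//; apply: ae_ge0_le_integral => //.
  - by move=> t _; apply: adde_ge0 => //; exact: adde_ge0.
  - exact: emeasurable_funD.
  - by move=> t _; exact: adde_ge0.
  - exact: emeasurable_funD.
  apply: filterS (ae_trace_lty eF Dw) => t tfin _.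
  have tE := traceE r0 e_ge0 eF Dw.1 (lat_le_refl _) tfin.
  have := trace_ge_single t xF xw; rewrite tE lee_fin -/fw => wt.
  rewrite -!EFinD lee_fin /= rep_pos//; last exact: Dw.1.
  have vw : fw t <= fv t.
    apply: piece_fun_mono => [|y|y|y] //; [exact: single_cone|exact: single_cone|].
    by rewrite /single; case: eqP => // _; exact: lat_le_refl.
  have := powR_dist r1 (powR_ge0 (fv t) r^-1) (root_ge0 r e F w t).
  rewrite powRVK//; last exact: piece_fun_ge0.
  rewrite -/fv; move: wt vw.
  move: (root r e F w t `^ r) (fv t) (fw t) (`|_| `^ r) => a b c z ca cb.
  have : `|b - a| <= (b - c) + (a - c) by rewrite ler_norml; apply/andP; split; lra.
  by lra.
have qnum : pint (q \- rep r e F w)%R \is a fin_num.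
  have /ge0_fin_numE -> := powint_ge0 mes r (q \- rep r e F w)%R.
  apply: le_lt_trans (ltry (Psi x v + N w)); rewrite EFinD.
  apply: le_trans le_int; rewrite -addeA -[leLHS]adde0 leeD2l//.
  by rewrite -EFinD lee_fin addr_ge0// Psi_ge0.
move: le_int; rewrite -(fineK qnum) -!EFinD !lee_fin.
move: (fine _) => z; rewrite Pvw in Nw *; lra.
Qed.

Lemma approximable0 : approximable (fun=> 0).
Proof.
have c0 := piece_cone0 e (point : X).
have [m H] := approximable_sub (approximable_single c0) (approximable_single c0).
have E0 : (fun=> 0) = (fun t : U => piece_fun r e (single point 0) t `^ r^-1) \-
    (fun t => piece_fun r e (single point 0) t `^ r^-1).
  by apply/funext => t /=; rewrite subrr.
by rewrite E0; split.
Qed.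

Lemma approximable_sum (A : seq X) (F : X -> U -> R) :
  (forall x, approximable (F x)) -> approximable (fun t => \sum_(x <- A) F x t).
Proof.
move=> HF; elim: A => [|x A IH].
  by under eq_fun do rewrite big_nil; exact: approximable0.
have := approximable_sub (HF x) (approximable_sub approximable0 IH).
rewrite (_ : _ \- _ = (fun t => \sum_(y <- x :: A) F y t))//.
by apply/funext => t /=; rewrite big_cons sub0r opprK.
Qed.

(** The pieces are disjoint, so the r-th root of the sum over the pieces is the sum of the r-th
    roots. *)
Lemma approximable_function (f : U -> R) : piece_functions r e f ->
  approximable (fun t => f t `^ r^-1).
Proof.
move=> [A [u [[hu u0] ->]]].
have := approximable_sum (undup A) (fun x => approximable_single (hu x)).
congr approximable; apply/funext => -[y phi].
have p0 : (0 : R) `^ r^-1 = 0 by rewrite powR0// invr_eq0 gt_eqF.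
have [h|h] := pselect (state e y phi); last first.
  rewrite piece_fun_out// p0 big1// => x _.
  by rewrite piece_fun_out// p0.
have z0 : phi 0 `^ r = 0 by rewrite (lat_hom0 h.1) ?powR0 ?gt_eqF//; exact: ideal0.
have sE x : piece_fun r e (single x (u x)) (y, phi) `^ r^-1 =
    if x == y then piece_fun r e u (y, phi) `^ r^-1 else 0.
  by rewrite !piece_funE// /single eq_sym; case: eqP => [->//|_]; rewrite z0 p0.
under eq_bigr do rewrite sE.
have [yA|yA] := boolP (y \in A); last first.
  rewrite piece_funE// u0// z0 p0 big1_seq// => x; rewrite mem_undup => /andP[_ xA].
  by case: eqP => // xy; rewrite -xy xA in yA.
rewrite (bigD1_seq y)/= ?undup_uniq ?mem_undup// eqxx big1 ?addr0//.
by move=> x /negbTE ->.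
Qed.

Lemma approximable_indic c (A : set U) : 0 <= c -> measurable A ->
  (mes A < +oo)%E -> approximable (fun t => c * \1_A t).
Proof.
move=> c0 mA Afin; have m1 : measurable_fun setT (\1_A : U -> R) by exact: measurable_indic.
apply: approximable_closed => [|eps eps0]; first exact: measurable_funM.
have k0 : 0 < 1 + c `^ r by rewrite ltr_pwDl// powR_ge0.
have d0 : 0 < eps / (1 + c `^ r) by rewrite divr_gt0.
have [f [Cf f1 fA]] := dan_dense dan muE mA Afin d0.
have mf := measurable_piece_root Cf.
have f0 t : 0 <= f t by exact: (dan_ge0 dan t Cf).
exists (fun t => c * f t `^ r^-1); last split.
- have Ccf := danZ dan (powR_ge0 c r) Cf.
  have := approximable_function Ccf; congr approximable; apply/funext => t.
  by rewrite powRM ?powR_ge0// powRK.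
- exact: measurable_funM.
rewrite (_ : (_ \- _)%R = (fun t => c * ((\1_A t) - f t `^ r^-1))); last first.
  by apply/funext => t /=; rewrite mulrBr.
rewrite powintZ//; last exact: measurable_funB.
apply: (@le_trans _ _ ((c `^ r)%:E * (eps / (1 + c `^ r))%:E)%E).
  rewrite lee_wpmul2l ?lee_fin ?powR_ge0//; apply: le_trans fA.
  rewrite powintE; apply: ge0_le_integral => //.
  - by apply: measurable_powint; exact: measurable_funB.
  - apply/measurable_EFinP; apply: measurableT_comp => //; apply: measurable_funB => //.
    exact: measurable_piece_fun.
  - move=> t _; rewrite lee_fin.
    have i0 : 0 <= \1_A t :> R by rewrite indicE.
    apply: le_trans (powR_dist r1 i0 (powR_ge0 (f t) r^-1)) _.
    rewrite powRVK// distrC indicE; case: (t \in A); rewrite ?powR1//.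
    by rewrite powR0// gt_eqF.
rewrite -EFinM lee_fin mulrCA ler_piMr ?(ltW eps0)//.
by rewrite ler_pdivrMr ?mul1r ?lerDr.
Qed.

Lemma approximable_all (f : U -> R) : measurable_fun setT f -> (pint f < +oo)%E ->
  approximable f.
Proof.
exact: (powint_approximation r1 approximable_sub approximable_closed
  approximable_indic).
Qed.

Lemma representation_exists : exists J : E -> U -> R,
  [/\ forall u, I u -> measurable_fun setT (J u),
      forall u v, I u -> I v -> pint (J u \- J v)%R = (N (lat_abs (u - v)))%:E,
      forall u, I u -> pint (J u) = (N (lat_abs u))%:E &
      forall f eps, measurable_fun setT f -> (pint f < +oo)%E -> 0 < eps ->
        exists2 u, I u & (pint (f \- J u)%R <= eps%:E)%E].
Proof.
have /choice[F hF] : forall u, exists F, I u -> exhausts F (lat_abs u).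
  move=> u; have [Iu|nIu] := pselect (I u); last by exists (fun=> [::]).
  by have [F hF] := exhausts_exists (abs_pos Iu); exists F.
exists (fun u => rep r e (F u) u); split.
- by move=> u Iu; apply: measurable_rep; case: (hF _ Iu).
- by move=> u v Iu Iv; rewrite powintE integral_rep_sub//; exact: hF.
- by move=> u Iu; rewrite powintE integral_rep//; exact: hF.
move=> f eps mf ffin eps0; have [_ /(_ _ eps0)[u [G [Iu hG fu]]]] := approximable_all mf ffin.
exists u; first exact: Iu.
(* [J u] is computed on a list chosen beforehand, not on [G]; both agree almost everywhere with the
   representation on the union. *)
have [H [eH FH GH]] := exhausting_union (hF _ Iu).1 hG.1.
rewrite (@powint_ae _ _ _ mes r _ (f \- rep r e G u)%R); first exact: fu.
- exact: (measurable_funB mf (measurable_rep u (hF _ Iu).1)).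
- exact: (measurable_funB mf (measurable_rep u hG.1)).
move: (rep_sub_ae Iu (hF _ Iu) eH FH) (rep_sub_ae Iu hG eH GH).
by apply: filterS2 => t /= -> ->.
Qed.

End RepresentationMeasure.

(** The order laws follow from unique minima of sets of two or three elements, and induction from
    the minimum of the set of counterexamples. *)
Lemma well_order_exists (X : eqType) : exists le : rel X,
  [/\ reflexive le, transitive le, antisymmetric le, total le &
    forall P : X -> Prop, (forall x, (forall y, le y x -> y != x -> P y) -> P x) ->
      forall x, P x].
Proof.
have [le wo] := wochoice.well_ordering_principle X; exists le.
have tot : total le.
  move=> x y; have [|z [[+ zl] _]] := wo (pred2 x y); first by exists x; rewrite inE eqxx.
  have := zl x; have := zl y; rewrite !inE !eqxx orbT => /(_ isT) zy /(_ isT) zx.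
  by move=> /orP[]/eqP zE; rewrite -zE ?zx ?zy ?orbT.
have rfl : reflexive le by move=> x; have /orP[] := tot x x.
have anti : antisymmetric le.
  move=> x y /andP[xy yx].
  have [|z [_ zu]] := wo (pred2 x y); first by exists x; rewrite inE eqxx.
  have xm : wochoice.minimum_of le (pred2 x y) x.
    by split; [rewrite inE eqxx|move=> w; rewrite inE => /orP[]/eqP ->].
  have ym : wochoice.minimum_of le (pred2 x y) y.
    by split; [rewrite inE eqxx orbT|move=> w; rewrite inE => /orP[]/eqP ->].
  by rewrite -(zu _ xm) -(zu _ ym).
split=> //.
  move=> y x z xy yz.
  have [|m [[+ ml] _]] := wo [pred w | (w == x) || (w == y) || (w == z)].
    by exists x; rewrite inE eqxx.
  have := (ml x, ml y, ml z); rewrite !inE !eqxx !orbT /=.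
  case=> [[/(_ isT) mx /(_ isT) my] /(_ isT) mz].
  move=> /orP[/orP[]|] /eqP mE; subst m => //.
    by have -> : x = y by apply: anti; rewrite xy.
  by have <- : y = z by apply: anti; rewrite yz.
move=> P IH x; apply: contrapT => nPx.
have [|m [[+ ml] _]] := wo [pred w | `[< ~ P w >]].
  by exists x; apply/asboolP.
move=> /asboolP nPm; apply: nPm; apply: IH => y ym nym; apply: contrapT => nPy.
have my : le m y by apply: ml; apply/asboolP.
by case/eqP: nym; apply: anti; rewrite ym.
Qed.

Section PowerRepresentation.
Context {R : realType} {E : banachLatticeType R} {X : pointedType}.
Variable r : R.
Hypothesis r1 : 1 <= r.
Variable e : X -> E.
Hypothesis e_ge0 : forall x, lat_le 0 (e x).
Local Notation D := (generated_pos e setT).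
Local Notation I := (generated_ideal e setT).
Variable N : E -> R.
Hypotheses (N_ge0 : forall u, D u -> 0 <= N u)
  (N_add : forall u v, D u -> D v -> N (padd r u v) = N u + N v)
  (N_scale : forall c u, 0 < c -> D u -> N (c `^ r^-1 *: u) = c * N u).

Lemma power_representation : exists d (Om : measurableType d)
    (mu : {measure set Om -> \bar R}) (J : E -> Om -> R),
  [/\ forall u, I u -> measurable_fun setT (J u),
      forall u v, I u -> I v ->
        powint mu r (J u \- J v)%R = (N (lat_abs (u - v)))%:E,
      forall u, I u -> powint mu r (J u) = (N (lat_abs u))%:E &
      forall f eps, measurable_fun setT f -> (powint mu r f < +oo)%E -> 0 < eps ->
        exists2 u, I u & (powint mu r (f \- J u)%R <= eps%:E)%E].
Proof.
have r0 : 0 < r by exact: lt_le_trans r1.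
have [le [l_refl l_trans l_anti l_tot l_ind]] := well_order_exists X.
pose Psi := band_comp e N le.
have Psi_ge0 x u : D u -> 0 <= Psi x u by exact: (band_comp_ge0 r0).
have Psi_add x u v : D u -> D v -> Psi x (padd r u v) = Psi x u + Psi x v.
  exact: band_compD.
have Psi_scale x c u : 0 < c -> D u -> Psi x (c `^ r^-1 *: u) = c * Psi x u.
  exact: band_compZ.
have Psi_sum_le A n u : D u -> uniq A ->
    \sum_(x <- A) Psi x (lat_meet u (n%:R *: e x)) <= N u.
  exact: (band_comp_sum_le r0).
have Psi_sum_ge u eps : D u -> 0 < eps -> exists A n, uniq A /\
    N u <= \sum_(x <- A) Psi x (lat_meet u (n%:R *: e x)) + eps.
  exact: (band_comp_sum_ge r0).
have Psi_approx x u eps : D u -> 0 < eps -> exists g w,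
    [/\ D g, D w, padd r g w = u, Psi x g = 0 & N w <= Psi x u + eps].
  exact: band_comp_approx.
have [mu muE] := dan_outer_measure
  (piece_space_daniell r1 e_ge0 Psi_ge0 Psi_add Psi_scale).
have [J HJ] := representation_exists r1 e_ge0 N_add Psi_ge0 Psi_add Psi_scale
  Psi_sum_le Psi_sum_ge muE Psi_approx.
by exists _, (caratheodory_type mu), (mu : set (caratheodory_type mu) -> \bar R), J.
Qed.

End PowerRepresentation.

(** * Elements of L_p and Lipschitz extensions *)

Section LpElements.
Context d (Om : measurableType d) (R : realType).
Variables (mu : {measure set Om -> \bar R}) (p : \bar R) (p1 : (1 <= p)%E).
Implicit Types f g : Om -> R.

Lemma Lnorm_powint r f : ('N[mu]_r%:E[EFin \o f] = powint mu r f `^ r^-1)%E.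
Proof. by rewrite unlock powintE. Qed.

Lemma Lnorm_ae f g : measurable_fun setT f -> measurable_fun setT g ->
  f = g %[ae mu] -> ('N[mu]_p[EFin \o f] = 'N[mu]_p[EFin \o g])%E.
Proof.
move=> mf mg fg; rewrite unlock; clear p1; case: p => [r| |].
- have H h : (\int[mu]_t `|(EFin \o h) t| `^ r)%E = powint mu r h.
    by rewrite powintE.
  rewrite !H (powint_ae r mf mg)//.
  by apply: filterS fg => t /= h; rewrite h.
- case: ifP => // _; apply: ess_sup_inf.eq_ess_sup.
  by apply: filterS fg => t /= h; rewrite h.
- case: ifP => // _; apply: ess_sup_inf.eq_ess_inf.
  by apply: filterS fg => t /= h; rewrite h.
Qed.

Lemma Lp_of_fun f : measurable_fun setT f -> finite_norm mu p f ->
  exists h : LspaceType mu p1, Lp_fun h = f %[ae mu].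
Proof.
move=> mf ff.
have mf' : measurable_fun setT (f : Om -> measurableTypeR R) by exact: mf.
pose F : {mfun Om >-> measurableTypeR R} := HB.pack f
  (isMeasurableFun.Build _ _ Om (measurableTypeR R) f mf').
pose q : {mfun_ mu, Om >-> measurableTypeR R} := (\pi F)%qT.
have qf : (q : Om -> R) = f %[ae mu].
  by have /eqmodP/asboolP := reprK q.
have fq : finite_norm mu p q.
  rewrite /finite_norm (_ : 'N[mu]_p[EFin \o q] = 'N[mu]_p[EFin \o f])%E//.
  apply: Lnorm_ae => //.
  exact: (@measurable_funPT _ _ _ _ (repr q)).
pose h : LspaceType mu p1 := HB.pack q (isFinLebesgue.Build _ _ _ _ _ p1 q fq).
by exists h.
Qed.

Lemma measurable_Lp_fun (h : LspaceType mu p1) : measurable_fun setT (Lp_fun h).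
Proof. exact: (@measurable_funPT _ _ _ _ (repr (h : aeEqMfun _ mu))). Qed.

Lemma Lp_fun_finite (h : LspaceType mu p1) : finite_norm mu p (Lp_fun h).
Proof. by case: h => h [[]]. Qed.

Lemma Lp_distE (h k : LspaceType mu p1) f g :
  measurable_fun setT f -> measurable_fun setT g ->
  Lp_fun h = f %[ae mu] -> Lp_fun k = g %[ae mu] ->
  mdist h k = fine ('N[mu]_p[EFin \o (f \- g)%R])%E.
Proof.
move=> mf mg hf kg.
rewrite [LHS](_ : _ = fine ('N[mu]_p[EFin \o (Lp_fun h \- Lp_fun k)%R])%E)//.
congr fine; apply: Lnorm_ae.
- exact: measurable_funB (measurable_Lp_fun h) (measurable_Lp_fun k).
- exact: measurable_funB.
- by apply: filterS2 hf kg => t hf kg It /=; rewrite hf// kg.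
Qed.

End LpElements.

Section LipschitzExtension.
Context {R : realType} {L : metricType R} {Y : completeMetricType R} {I : Type}.
Variables (P : I -> Prop) (j : I -> L) (s : I -> Y) (Z : set L) (K : R).
Hypotheses (K0 : 0 <= K)
  (sj : forall u v, P u -> P v -> mdist (s u) (s v) <= K * mdist (j u) (j v))
  (dense : forall z eps, Z z -> 0 < eps -> exists2 u, P u & mdist z (j u) < eps).

(** The point is the limit of [s] along any [j (w k)] tending to [z]. It is recorded by an
    inequality valid for all [u], from which the extension property and the Lipschitz bound follow
    without further limits. *)
Let limit_exists z : Z z ->
  exists y, forall u, P u -> mdist y (s u) <= K * mdist z (j u).
Proof.
move=> Zz; have /choice[w Hw] : forall k : nat, exists u,
    P u /\ mdist z (j u) < k.+1%:R^-1.
  move=> k; have k0 : (0 : R) < k.+1%:R^-1 by rewrite invr_gt0.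
  by have [u Pu zu] := dense Zz k0; exists u.
have k1 k : (0 : R) < k.+1%:R^-1 by rewrite invr_gt0.
have small eps : 0 < eps -> exists k, forall l, (k <= l)%N ->
    K * mdist z (j (w l)) < eps.
  move=> eps0; have d0 : 0 < eps / (K + 1) by rewrite divr_gt0// ltr_wpDl.
  have [k hk] := ltr_add_invr d0; rewrite add0r in hk; exists k => l kl.
  apply: (@le_lt_trans _ _ (K * k.+1%:R^-1)).
    rewrite ler_wpM2l// (le_trans (ltW (Hw l).2))// lef_pV2 ?posrE//.
    by rewrite ler_nat.
  apply: (@lt_le_trans _ _ ((K + 1) * k.+1%:R^-1)).
    by rewrite ltr_pM2r// ltrDl.
  by rewrite mulrC -ler_pdivlMr ?ltr_wpDl// ltW.
have dw k l : mdist (s (w k)) (s (w l)) <=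
    K * mdist z (j (w k)) + K * mdist z (j (w l)).
  apply: le_trans (sj (Hw k).1 (Hw l).1) _; rewrite -mulrDr ler_wpM2l//.
  by apply: le_trans (metric_triangle _ z _) _; rewrite lerD2r metric_sym.
have cs : cauchy ((s \o w) @ \oo).
  apply: cauchy_exP => eps eps0; have e2 : 0 < eps / 2 by rewrite divr_gt0.
  have [k hk] := small _ e2; exists (s (w k)); exists k => // l /= kl.
  rewrite ballEmdist/=; apply: le_lt_trans (dw k l) _.
  by have := hk k (leqnn k); have := hk l kl; lra.
have cv : cvg ((s \o w) @ \oo) by apply: cauchy_cvg; exact: cs.
have [y /cvg_ballP hy] := (cvg_ex _).1 cv.
exists y => u Pu; apply/ler_addgt0Pr => eps eps0.
have e2 : 0 < eps / 2 by rewrite divr_gt0.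
have [k hk] := small _ e2; have [l _ hl] := hy _ e2.
pose m := maxn k l; have := hl m (leq_maxr _ _); rewrite ballEmdist/= => ym.
have := hk m (leq_maxl _ _) => zm.
have := metric_triangle y (s (w m)) (s u); have := sj (Hw m).1 Pu.
have : K * mdist (j (w m)) (j u) <= K * mdist z (j (w m)) + K * mdist z (j u).
  rewrite -mulrDr ler_wpM2l//; apply: le_trans (metric_triangle _ z _) _.
  by rewrite lerD2r metric_sym.
lra.
Qed.

Lemma lipschitz_extension : exists S1 : L -> Y,
  (forall u, P u -> Z (j u) -> S1 (j u) = s u) /\
  forall z z', Z z -> Z z' -> mdist (S1 z) (S1 z') <= K * mdist z z'.
Proof.
have /choice[S1 HS] : forall z, exists y, Z z ->
    forall u, P u -> mdist y (s u) <= K * mdist z (j u).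
  move=> z; have [Zz|nZz] := pselect (Z z); last by exists point.
  by have [y hy] := limit_exists Zz; exists y.
exists S1; split=> [u Pu Zu|z z' Zz Zz'].
  apply: mdist_positivity; apply/le_anti; rewrite mdist_ge0 andbT.
  by apply: le_trans (HS _ Zu _ Pu) _; rewrite mdistxx mulr0.
apply/ler_addgt0Pr => eps eps0.
have d0 : 0 < eps / (2 * (K + 1)) by rewrite divr_gt0// mulr_gt0// ltr_wpDl.
have [u Pu zu] := dense Zz d0.
have : K * mdist z (j u) <= eps / 2.
  apply: (@le_trans _ _ ((K + 1) * mdist z (j u))).
    by rewrite ler_wpM2r ?mdist_ge0// lerDl.
  apply: (@le_trans _ _ ((K + 1) * (eps / (2 * (K + 1))))).
    by rewrite ler_wpM2l ?(ltW zu)// addr_ge0.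
  rewrite (_ : _ * (_ / _) = eps / 2)//; field.
  by rewrite gt_eqF// ltr_wpDl.
have := metric_triangle (S1 z) (s u) (S1 z').
have := HS _ Zz _ Pu; have := HS _ Zz' _ Pu; rewrite [mdist (s u) _]metric_sym.
have : K * mdist z' (j u) <= K * mdist z z' + K * mdist z (j u).
  rewrite -mulrDr ler_wpM2l//; apply: le_trans (metric_triangle _ z _) _.
  by rewrite lerD2r metric_sym.
lra.
Qed.

End LipschitzExtension.

(** Each defining inequality is closed in the constant, so the best constants are themselves
    admissible; the bounds on [T1] and [S1] then hold without loss. *)
Lemma ler_inf_mul {R : realType} (B : set R) (a b : R) : B !=set0 ->
  (forall C, B C -> 0 <= C /\ a <= C * b) -> 0 <= b -> a <= inf B * b.
Proof.
move=> B0 HB b0; apply/ler_addgt0Pr => eps eps0.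
have d0 : 0 < eps / (b + 1) by rewrite divr_gt0// ltr_wpDl.
have iB : has_inf B by split=> //; exists 0 => C /HB[].
have [C BC hC] := inf_adherent d0 iB; have [_ aC] := HB _ BC.
apply: le_trans aC _; apply: (@le_trans _ _ ((inf B + eps / (b + 1)) * b)).
  by rewrite ler_wpM2r// ltW.
rewrite mulrDl lerD2l -mulrA ler_piMr ?(ltW eps0)// mulrC ler_pdivrMr ?mul1r ?lerDl//.
by rewrite ltr_wpDl.
Qed.

Lemma inf_ge0 {R : realType} (B : set R) : (forall C, B C -> 0 <= C) -> 0 <= inf B.
Proof.
move=> HB; have [->|/set0P B0] := eqVneq B set0; first by rewrite inf0.
by apply: lb_le_inf => // C; exact: HB.
Qed.

Lemma Lip_on_le {R : realType} {U V : metricType R} (A : set U) (f : U -> V) k :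
  0 <= k -> (forall x y, A x -> A y -> mdist (f x) (f y) <= k * mdist x y) ->
  is_lipschitz_on A f /\ Lip_on A f <= k.
Proof.
move=> k0 H; have kf : lip_bounds A f k by split.
split; first by exists k.
by apply: ge_inf => //; exists 0 => c [].
Qed.

(** * Finite exponents *)

(** The sandwich functional is controlled on [pdominated] only. An ordinary sum of dominated
    generators lies below twice their [padd], hence below a family again, so the whole positive cone
    of the ideal is covered. *)
Lemma pdominated_generated {R : realType} {E : banachLatticeType R} {J X : Type}
    (r : R) (vec : J -> E) (cost : J -> R) (e : X -> E) :
  0 < r -> (forall j, 0 <= cost j) -> (forall x, pdominated r vec cost (e x)) ->
  generated_pos e setT `<=` pdominated r vec cost.
Proof.
move=> r0 cost0 He u [u0 [g gG [c c0 ug]]].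
have e0 x : lat_le 0 (e x) by case: (He x).
have scale a h k : 0 <= a -> pfamily r vec cost h k ->
    pfamily r vec cost (a *: h) (a `^ r * k).
  by move=> a0 /(pfamilyZ r0 (powR_ge0 a r)); rewrite powRK.
have [h [k [hk gh]]] : exists h k, pfamily r vec cost h k /\ lat_le g h.
  elim: gG => [|x f _ _ [h [k [hk fh]]]].
    by exists 0, 0; split; [exact: pfamily0|exact: lat_le_refl].
  have [_ [h1 [k1 [hk1 eh1]]]] := He x.
  have two := pfamilyD r0 hk1 hk.
  exists (2 *: padd r h1 h), (2 `^ r * (k1 + k)); split; first exact: scale.
  apply: lat_trans (lat_le_add eh1 fh) (add_le_padd r0 _ _).
    by case: (pfamily_ge0 r0 cost0 hk1).
  by case: (pfamily_ge0 r0 cost0 hk).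
split=> //; exists (c *: h), (c `^ r * k); split; first exact: scale.
apply: lat_trans (lat_le_abs u) _; apply: lat_trans ug _; exact: lat_le_scale.
Qed.

Lemma sum_powR_psum {R : realType} (r k : R) n (lam a : 'I_n -> R) : 0 < r ->
  0 <= k -> (forall i, 0 <= lam i) -> (forall i, 0 <= a i) ->
  \sum_(i < n) lam i * (k * a i) `^ r = (k * psum r%:E lam a) `^ r.
Proof.
move=> r0 k0 lam0 a0; rewrite powRM ?powR_ge0// powRVK//; last first.
  by apply: sumr_ge0 => i _; rewrite mulr_ge0// powR_ge0.
rewrite mulr_sumr; apply: eq_bigr => i _.
by rewrite powRM// (ger0_norm (a0 i)) mulrCA.
Qed.

Section FiniteExponent.
Context {R : realType} {X : metricType R} {Y : completeMetricType R}
  {E : banachLatticeType R}.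
Variables (r : R) (p1 : (1 <= r%:E)%E) (T : X -> E) (S : E -> Y).
Hypotheses (hT : lipschitz_p_convex r%:E T) (hS : lipschitz_p_concave r%:E S).

Let r1 : 1 <= r. Proof. by rewrite -lee_fin. Qed.
Let r0 : 0 < r. Proof. exact: lt_le_trans r1. Qed.

Local Notation K1 := (convexity_constant r%:E T).
Local Notation K2 := (concavity_constant r%:E S).

Let psum_ge0 n (lam a : 'I_n -> R) : 0 <= psum r%:E lam a.
Proof. exact: powR_ge0. Qed.

Let K1_ge0 : 0 <= K1. Proof. by apply: inf_ge0 => C []. Qed.

Let K2_ge0 : 0 <= K2. Proof. by apply: inf_ge0 => C []. Qed.

Let convex n (x x' : 'I_n -> X) lam : (forall i, 0 <= lam i) ->
  `|lat_psum r%:E lam (fun i => T (x i) - T (x' i))| <=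
  K1 * psum r%:E lam (fun i => mdist (x i) (x' i)).
Proof.
by move=> lam0; apply: ler_inf_mul => //; [case: hT|move=> C [C0 HC]; split=> //; exact: HC].
Qed.

Let concave n (v v' : 'I_n -> E) lam : (forall i, 0 <= lam i) ->
  psum r%:E lam (fun i => mdist (S (v i)) (S (v' i))) <=
  K2 * `|lat_psum r%:E lam (fun i => v i - v' i)|.
Proof.
by move=> lam0; apply: ler_inf_mul => //; move=> C [C0 HC]; split=> //; exact: HC.
Qed.

Let vec1 (j : X * X) := T j.1 - T j.2.
Let cost1 (j : X * X) := (K1 * mdist j.1 j.2) `^ r.
Let vec2 (j : E * E) := j.1 - j.2.
(* If [K2 = 0] then [S] is constant, in accordance with [0^-1 = 0]. *)
Let cost2 (j : E * E) := (K2^-1 * mdist (S j.1) (S j.2)) `^ r.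

Let families g c h c' : pfamily r vec1 cost1 g c -> pfamily r vec2 cost2 h c' ->
  lat_le h g -> c' <= c.
Proof.
move=> [n [i1 [lam [lam0 gE ->]]]] [m [i2 [nu [nu0 hE ->]]]] hg.
have V0 : 0 <= K2^-1 by rewrite invr_ge0.
pose a1 i := mdist (i1 i).1 (i1 i).2; pose a2 i := mdist (S (i2 i).1) (S (i2 i).2).
have := sum_powR_psum (a := a1) r0 K1_ge0 lam0 (fun i => mdist_ge0 _ _).
have := sum_powR_psum (a := a2) r0 V0 nu0 (fun i => mdist_ge0 _ _).
rewrite /cost1 /cost2 => -> ->.
rewrite powR_le ?mulr_ge0 ?psum_ge0 ?K1_ge0//.
have := concave (fun i => (i2 i).1) (fun i => (i2 i).2) nu0.
have := convex (fun i => (i1 i).1) (fun i => (i1 i).2) lam0.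
rewrite -[lat_psum _ lam _]gE -[lat_psum _ nu _]hE => gK hK.
have [K20|K20] := eqVneq K2 0.
  by rewrite K20 invr0 mul0r mulr_ge0 ?psum_ge0 ?K1_ge0.
have Kp : 0 < K2 by rewrite lt_neqAle eq_sym K20.
rewrite mulrC ler_pdivrMr// mulrC; apply: le_trans hK _.
rewrite ler_wpM2l//; apply: le_trans gK; apply: lat_le_norm => //.
by rewrite hE; exact: lat_psum_ge0.
Qed.

(* [None] provides a base point when [X] is empty. *)
Let e (o : option (X * X)) : E := if o is Some j then lat_abs (vec1 j) else 0.

Let e_ge0 o : lat_le 0 (e o).
Proof. by case: o => [j|]; [exact: lat_abs_ge0|exact: lat_le_refl]. Qed.

Let e_dominated o : pdominated r vec1 cost1 (e o).
Proof.
split=> //; case: o => [j|]; [exists (lat_abs (vec1 j)), (cost1 j)|exists 0, 0].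
  by split; [exact: pfamily1|exact: lat_le_refl].
by split; [exact: pfamily0|exact: lat_le_refl].
Qed.

Let I := generated_ideal e setT.
Let D := generated_pos e setT.

Let DP : D `<=` pdominated r vec1 cost1.
Proof.
by apply: pdominated_generated => // j; exact: powR_ge0.
Qed.

Let base_exists : exists w0, forall x, I (T x - w0).
Proof.
have [[x0 _]|nX] := pselect (exists x : X, True); last first.
  by exists 0 => x; case: nX; exists x.
exists (T x0) => x; exists (e (Some (x, x0))); first exact: generated1.
exact: ideal_abs_self.
Qed.

Let norm_powint d (Om : measurableType d) (mu : {measure set Om -> \bar R})
    (f : Om -> R) a : 0 <= a -> powint mu r f = a%:E ->
  fine ('N[mu]_r%:E[EFin \o f])%E = a `^ r^-1.
Proof. by move=> a0 fa; rewrite Lnorm_powint fa poweR_EFin. Qed.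

Theorem factorization_finite :
  exists (d : measure_display) (Om : measurableType d)
    (mu : {measure set Om -> \bar R}) (Z : set (LspaceType mu p1))
    (T1 : X -> LspaceType mu p1) (S1 : LspaceType mu p1 -> Y),
    [/\ closed_sublattice Z /\ (r%:E != +oo%E -> Z = setT),
        forall x, Z (T1 x),
        forall x, S (T x) = S1 (T1 x),
        is_lipschitz_on setT T1 /\ Lip_on setT T1 <= K1 &
        is_lipschitz_on Z S1 /\ Lip_on Z S1 <= K2].
Proof.
have cost20 j : 0 <= cost2 j by exact: powR_ge0.
have [N [N_ge0 N_add N_scale N1 N2]] := pfamily_sandwich r0 cost20 families.
have [d [Om [mu [J [mJ JB J1 Jdense]]]]] := @power_representation R E _ r r1 e e_ge0 N
  (fun u Du => N_ge0 u (DP Du)) (fun u v Du Dv => N_add u v (DP Du) (DP Dv))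
  (fun c u c0 Du => N_scale c u c0 (DP Du)).
have [I_D I_Z _] := generated_ideal_subspace e_ge0 setT.
have I_B u v : I u -> I v -> I (u - v).
  by move=> Iu Iv; apply: (I_D _ _ Iu); rewrite -scaleN1r; exact: I_Z.
have D_abs u : I u -> D (lat_abs u).
  by move=> Iu; split; [exact: lat_abs_ge0|exact: generated_ideal_abs].
have I0 : I 0 by exists 0; [exact: generated0|exact: ideal0].
have /choice[h Hh] : forall u, exists z : LspaceType mu p1, I u -> Lp_fun z = J u %[ae mu].
  move=> u; have [Iu|nIu] := pselect (I u).
    have fJ : finite_norm mu r%:E (J u).
      by rewrite /finite_norm Lnorm_powint J1// poweR_EFin ltry.
    by have [z hz] := Lp_of_fun p1 (mJ u Iu) fJ; exists z.
  have f0 : finite_norm mu r%:E (fun=> 0).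
    by rewrite /finite_norm Lnorm0 ?ltry// eqe gt_eqF.
  by have [z _] := Lp_of_fun p1 (measurable_cst (0 : R)) f0; exists z.
have dist_h u v : I u -> I v -> mdist (h u) (h v) = N (lat_abs (u - v)) `^ r^-1.
  move=> Iu Iv; rewrite (Lp_distE (mJ u Iu) (mJ v Iv) (Hh u Iu) (Hh v Iv)).
  by apply: norm_powint; [exact/N_ge0/DP/D_abs/I_B|exact: JB].
have [w0 Hw] := base_exists.
have [S1 [S1h S1L]] : exists S1 : LspaceType mu p1 -> Y,
    (forall u, I u -> setT (h u) -> S1 (h u) = S (w0 + u)) /\
    forall z z', setT z -> setT z' -> mdist (S1 z) (S1 z') <= K2 * mdist z z'.
  apply: lipschitz_extension => //.
    move=> u v Iu Iv; rewrite dist_h//.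
    have Duv := DP (D_abs _ (I_B _ _ Iu Iv)).
    have uv : w0 + u - (w0 + v) = u - v by rewrite opprD addrACA subrr add0r.
    (* Here [cost2] vanishes and the lower bound on [N] gives nothing; concavity for a single pair
       shows directly that the distance is 0. *)
    have [K20|K20] := eqVneq K2 0.
      have := @concave 1 (fun=> w0 + u) (fun=> w0 + v) (fun=> 1) (fun=> ler01).
      rewrite K20 !mul0r /psum big_ord1 mul1r powRK//.
      by rewrite (ger0_norm (mdist_ge0 _ _)).
    have Kp : 0 < K2 by rewrite lt_neqAle eq_sym K20 K2_ge0.
    have := N2 (w0 + u, w0 + v); rewrite /vec2 /= uv => /(_ Duv).
    rewrite /cost2 /= -(@powR_le _ r^-1) ?invr_gt0// ?powR_ge0 ?N_ge0//.
    by rewrite powRK ?mulr_ge0 ?invr_ge0 ?mdist_ge0// ler_pdivrMl.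
  move=> z eps _ eps0; have e2 : 0 < eps / 2 by rewrite divr_gt0.
  have fz : (powint mu r (Lp_fun z) < +oo)%E.
    have := Lp_fun_finite z; rewrite /finite_norm Lnorm_powint.
    by apply: lty_poweRy; rewrite invr_eq0 gt_eqF.
  have [u Iu hu] := Jdense _ _ (measurable_Lp_fun z) fz (powR_gt0 r e2).
  exists u => //.
  rewrite (Lp_distE (measurable_Lp_fun z) (mJ u Iu) _ (Hh u Iu)); last exact: nearW.
  have qn : (powint mu r (Lp_fun z \- J u)%R) \is a fin_num.
    have /ge0_fin_numE -> := powint_ge0 mu r (Lp_fun z \- J u)%R.
    exact: le_lt_trans hu (ltry _).
  have q0 := powint_ge0 mu r (Lp_fun z \- J u)%R.
  move: hu; rewrite -(fineK qn) lee_fin => hu.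
  rewrite (norm_powint (fine_ge0 q0) (esym (fineK qn))).
  apply: (@le_lt_trans _ _ (eps / 2)); last by lra.
  by rewrite -(powRK r0 (ltW e2)) powR_le ?invr_gt0 ?powR_ge0 ?fine_ge0.
exists d, Om, mu, setT, (fun x => h (T x - w0)), S1; split=> //.
- by split=> //; split=> //; exists (h 0).
- by move=> x; rewrite S1h// addrC subrK.
- apply: Lip_on_le => [|x x' _ _]; first exact: K1_ge0.
  have TE : T x - w0 - (T x' - w0) = T x - T x' by rewrite opprB addrA subrK.
  rewrite dist_h// TE -(powRK r0 (mulr_ge0 K1_ge0 (mdist_ge0 x x'))).
  rewrite powR_le ?invr_gt0 ?powR_ge0//; first exact: (N1 (x, x')).
  by apply/N_ge0/DP/D_abs; rewrite -TE; exact: I_B.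
- by apply: Lip_on_le; [exact: K2_ge0|exact: S1L].
Qed.

End FiniteExponent.

(** * The exponent +oo *)

Section Gauge.
Context {R : realType} {E : banachLatticeType R}.
Variables (M D : set E).
Hypotheses (M_ge0 : forall g, M g -> lat_le 0 g)
  (M_dir : forall g h, M g -> M h -> exists2 k, M k & lat_le g k /\ lat_le h k)
  (sD : lat_subspace D)
  (D_dom : forall u, D u -> exists c g, [/\ 0 <= c, M g & lat_le u (c *: g)]).
Implicit Types (u v g h : E) (c : R).

Let bounds u : set R := [set c | 0 <= c /\ exists2 g, M g & lat_le u (c *: g)].

(** At [lat_abs u] this is a Kakutani M-seminorm. As [M] is directed, two bounds can be taken with
    the same [g], which makes the gauge subadditive and maxitive, the hypotheses of
    [exists_lat_hom]. *)
Definition gauge u : R := inf (bounds u).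

Let bounds_inf u : D u -> has_inf (bounds u).
Proof.
move=> Du; split; last by exists 0 => c [].
by have [c [g [c0 Mg ug]]] := D_dom Du; exists c; split=> //; exists g.
Qed.

Lemma gauge_le u c g : 0 <= c -> M g -> lat_le u (c *: g) -> gauge u <= c.
Proof.
by move=> c0 Mg ug; apply: ge_inf; [exists 0 => x []|split=> //; exists g].
Qed.

Lemma gauge_lt u eps : D u -> 0 < eps -> exists c g,
  [/\ 0 <= c, M g, lat_le u (c *: g) & c < gauge u + eps].
Proof.
move=> Du eps0; have [c [c0 [g Mg ug]] h] := inf_adherent eps0 (bounds_inf Du).
by exists c, g.
Qed.

Lemma gauge_mono u v : D v -> lat_le u v -> gauge u <= gauge v.
Proof.
move=> Dv uv; apply/ler_addgt0Pr => eps eps0.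
have [c [g [c0 Mg vg h]]] := gauge_lt Dv eps0.
apply: le_trans (ltW h); exact: gauge_le c0 Mg (lat_trans uv vg).
Qed.

Lemma gaugeD u v : D u -> D v -> gauge (u + v) <= gauge u + gauge v.
Proof.
move=> Du Dv; apply/ler_addgt0Pr => eps eps0; have e2 : 0 < eps / 2 by rewrite divr_gt0.
have [c [g [c0 Mg ug hc]]] := gauge_lt Du e2.
have [b [h [b0 Mh vh hb]]] := gauge_lt Dv e2.
have [k Mk [gk hk]] := M_dir Mg Mh.
apply: (@le_trans _ _ (c + b)); last by lra.
apply: gauge_le Mk _; first exact: addr_ge0.
rewrite scalerDl; apply: lat_le_add.
  by apply: lat_trans ug _; exact: lat_le_scale.
by apply: lat_trans vh _; exact: lat_le_scale.
Qed.

Lemma gaugeZ c u : 0 < c -> D u -> gauge (c *: u) = c * gauge u.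
Proof.
have [_ DZ _] := sD.
have H b v : 0 < b -> D v -> gauge (b *: v) <= b * gauge v.
  move=> b0 Dv; apply/ler_addgt0Pr => eps eps0.
  have [k [g [k0 Mg vg hk]]] := gauge_lt Dv (divr_gt0 eps0 b0).
  apply: (@le_trans _ _ (b * k)).
    by apply: gauge_le Mg _; [exact: mulr_ge0 (ltW b0) k0|rewrite -scalerA lat_le_scale// ltW].
  by rewrite -ler_pdivlMl// mulrDr mulKf ?gt_eqF// mulrC ltW.
move=> c0 Du; apply/le_anti; rewrite H//= -ler_pdivlMl//.
have := H c^-1 (c *: u); rewrite scalerA mulVf ?gt_eqF// scale1r; apply.
  by rewrite invr_gt0.
exact: DZ.
Qed.

Lemma gaugeJ u v : D u -> D v -> gauge (lat_join u v) = Num.max (gauge u) (gauge v).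
Proof.
move=> Du Dv; have [_ _ DJ] := sD; have Duv := DJ _ _ Du Dv.
apply/le_anti/andP; split; last first.
  by rewrite ge_max !gauge_mono//; [exact: lat_joinr|exact: lat_joinl].
apply/ler_addgt0Pr => eps eps0.
have [c [g [c0 Mg ug hc]]] := gauge_lt Du eps0.
have [b [h [b0 Mh vh hb]]] := gauge_lt Dv eps0.
have [k Mk [gk hk]] := M_dir Mg Mh.
apply: (@le_trans _ _ (Num.max c b)); last by max_lra.
have k0 := M_ge0 Mk.
have up x w z : 0 <= x -> x <= Num.max c b -> lat_le w (x *: z) -> lat_le z k ->
    lat_le w (Num.max c b *: k).
  move=> x0 xm wz zk; apply: lat_trans wz _; apply: lat_trans (lat_le_scale x0 zk) _.
  by rewrite -lat_subr_ge0 -scalerBl; apply: lat_scale_ge0 => //; rewrite subr_ge0.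
apply: gauge_le Mk _; first by rewrite le_max c0.
rewrite lat_joinP; apply/andP; split.
  by apply: up ug gk => //; rewrite le_max lexx.
by apply: up vh hk => //; rewrite le_max lexx orbT.
Qed.

Definition gauge_state (phi : E -> R) : Prop :=
  lat_hom D phi /\ forall u, D u -> phi u <= gauge u.

Lemma gauge_state_exists u : D u -> exists2 phi, gauge_state phi & phi u = gauge u.
Proof.
move=> Du; have [phi hphi [le_phi phiu]] := exists_lat_hom sD gaugeD gaugeZ gaugeJ Du.
by exists phi.
Qed.

Lemma gauge_state_norm phi u : D u -> D (lat_abs u) -> gauge_state phi ->
  `|phi u| <= gauge (lat_abs u).
Proof. by move=> Du Dau [hphi le_phi]; rewrite -(lat_hom_abs sD hphi Du) le_phi. Qed.

End Gauge.

(** * Bounded functions on a set as an [L_oo] space *)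

Section DiscreteSupNorm.
Context {R : realType} {Tp : pointedType}.
Variable K : set Tp.
Hypothesis K0 : K !=set0.

Definition discrete_space : Type := g_sigma_algebraType [set: set Tp].
HB.instance Definition _ := Measurable.on discrete_space.

Local Notation Om := discrete_space.

Lemma discrete_measurable (A : set Om) : measurable A.
Proof. exact: sub_sigma_algebra. Qed.

(** The null sets are those that miss [K]: almost everywhere means everywhere on [K], and the
    essential supremum is the supremum over [K]. *)
Definition discrete_measure : set Om -> \bar R :=
  mrestr (@counting _ R) (discrete_measurable K).

HB.instance Definition _ := Measure.on discrete_measure.

Local Notation mu := discrete_measure.

Lemma discrete_measurable_fun (f : Om -> R) : measurable_fun setT f.
Proof. by move=> _ A mA; exact: discrete_measurable. Qed.

Lemma discrete_measure0 (A : set Om) : mu A = 0%E <-> A `&` K = set0.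
Proof.
rewrite /discrete_measure /mrestr /counting; split; last first.
  by move=> ->; rewrite asboolT// fset_set0.
case: asboolP => [fA|//] [] /eqP; rewrite pnatr_eq0 finmap.cardfs_eq0 => /eqP.
exact: fset_set_set0.
Qed.

Lemma discrete_aeP (P : Om -> Prop) : {ae mu, forall t, P t} <-> forall t, K t -> P t.
Proof.
split=> [[A [mA A0 PA]] t Kt|KP].
  apply: contrapT => nPt; have /discrete_measure0 := A0.
  by move/seteqP => [/(_ t) + _]; apply; split=> //; exact: PA.
exists (~` K); split; first exact: discrete_measurable.
  by apply/discrete_measure0; rewrite setICl.
by move=> t /= nPt Kt; apply: nPt; exact: KP.
Qed.

Let mu_gt0 : (0 < mu setT)%E.
Proof.
rewrite lt_neqAle measure_ge0 andbT eq_sym; apply/eqP => /discrete_measure0.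
by rewrite setTI => K00; case: K0 => t; rewrite K00.
Qed.

Lemma discrete_norm_le (f : Om -> R) c : (forall t, K t -> `|f t| <= c) ->
  ('N[mu]_+oo[EFin \o f] <= c%:E)%E.
Proof.
move=> fc; rewrite unlock mu_gt0; apply/ess_sup_inf.ess_supP.
by apply/discrete_aeP => t Kt /=; rewrite lee_fin fc.
Qed.

Lemma discrete_norm_ge (f : Om -> R) t : K t ->
  (`|f t|%:E <= 'N[mu]_+oo[EFin \o f])%E.
Proof.
rewrite unlock mu_gt0 => Kt.
have /discrete_aeP := ess_sup_inf.ess_sup_ge mu (abse \o (EFin \o f)).
exact.
Qed.

Variable p1 : (1 <= (+oo : \bar R))%E.
Implicit Types h k : LspaceType mu p1.

Lemma discrete_Lp_of_fun (f : Om -> R) c : (forall t, K t -> `|f t| <= c) ->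
  exists h, forall t, K t -> Lp_fun h t = f t.
Proof.
move=> fc; have ff : finite_norm mu +oo f.
  by apply: le_lt_trans (discrete_norm_le fc) (ltry _).
have [h hf] := Lp_of_fun p1 (discrete_measurable_fun f) ff; exists h => t Kt.
by move: hf => /discrete_aeP /(_ t Kt); apply.
Qed.

Let dist_norm h k : (mdist h k)%:E = ('N[mu]_+oo[EFin \o (Lp_fun h \- Lp_fun k)%R])%E.
Proof.
rewrite (Lp_distE (measurable_Lp_fun h) (measurable_Lp_fun k)); [|exact: nearW..].
rewrite fineK// ge0_fin_numE ?Lnorm_ge0//.
apply: (@le_lt_trans _ _ ('N[mu]_+oo[EFin \o Lp_fun h] + 'N[mu]_+oo[EFin \o Lp_fun k])%E).
  rewrite -[X in (_ <= _ + X)%E]oppe_Lnorm.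
  apply: (eminkowski mu (g := (\- Lp_fun k)%R)) => //.
    exact: measurable_Lp_fun.
  by apply: measurableT_comp => //; exact: measurable_Lp_fun.
by apply: lte_add_pinfty; exact: Lp_fun_finite.
Qed.

Lemma discrete_dist_le h k c : (forall t, K t -> `|Lp_fun h t - Lp_fun k t| <= c) ->
  mdist h k <= c.
Proof. by move=> hk; rewrite -lee_fin dist_norm; exact: discrete_norm_le. Qed.

Lemma discrete_dist_ge h k t : K t -> `|Lp_fun h t - Lp_fun k t| <= mdist h k.
Proof. by move=> Kt; rewrite -lee_fin dist_norm; exact: discrete_norm_ge. Qed.

End DiscreteSupNorm.

Section BigJoin.
Context {R : realType} {E : banachLatticeType R}.

Lemma bigjoin_le n (F : 'I_n -> E) z : lat_le 0 z -> (forall i, lat_le (F i) z) ->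
  lat_le (\big[lat_join/0]_(i < n) F i) z.
Proof. by move=> z0 Fz; elim/big_rec: _ => // i x _ xz; rewrite lat_joinP Fz. Qed.

Lemma bigjoin_ge0 n (F : 'I_n -> E) : lat_le 0 (\big[lat_join/0]_(i < n) F i).
Proof.
elim/big_rec: _ => [|i x _ x0]; first exact: lat_le_refl.
exact: lat_trans x0 (lat_joinr _ _).
Qed.

Lemma le_bigjoin n (F : 'I_n -> E) i : lat_le (F i) (\big[lat_join/0]_(j < n) F j).
Proof.
have := mem_index_enum i; elim: (index_enum _) => //= j s IH.
rewrite big_cons inE => /predU1P[<-|/IH]; first exact: lat_joinl.
by move=> h; exact: lat_trans h (lat_joinr _ _).
Qed.

End BigJoin.

Lemma dist_max {R : realType} (a b c d x y : R) : `|a - c| <= x -> `|b - d| <= y ->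
  `|Num.max a b - Num.max c d| <= x + y.
Proof.
by rewrite !ler_norml => /andP[? ?] /andP[? ?]; apply/andP; split; max_lra.
Qed.

Section InfiniteExponent.
Context {R : realType} {X : metricType R} {Y : completeMetricType R}
  {E : banachLatticeType R}.
Variables (p1 : (1 <= (+oo : \bar R))%E) (T : X -> E) (S : E -> Y).
Hypotheses (hT : lipschitz_p_convex +oo%E T) (hS : lipschitz_p_concave +oo%E S).

Local Notation K1 := (convexity_constant +oo%E T).
Local Notation K2 := (concavity_constant +oo%E S).

Let psum_ge0 n (lam a : 'I_n -> R) : 0 <= psum +oo%E lam a.
Proof. exact: bigmax_ge_id. Qed.

Let K1_ge0 : 0 <= K1. Proof. by apply: inf_ge0 => C []. Qed.

Let K2_ge0 : 0 <= K2. Proof. by apply: inf_ge0 => C []. Qed.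

Let vec (j : X * X) := lat_abs (T j.1 - T j.2).

Let M : set E := [set g | exists n (i : 'I_n -> X * X) (lam : 'I_n -> R),
  (forall k, 0 <= lam k /\ lam k * mdist (i k).1 (i k).2 <= 1) /\
  g = \big[lat_join/0]_(k < n) (lam k *: vec (i k))].

Let M0 : M !=set0.
Proof.
have f0 A (i : 'I_0) : A by case: i.
by exists (\big[lat_join/0]_(k < 0) (f0 R k *: vec (f0 _ k))), 0%N, (f0 _), (f0 R); split=> // -[].
Qed.

Let M_ge0 g : M g -> lat_le 0 g.
Proof. by move=> [n [i [lam [_ ->]]]]; exact: bigjoin_ge0. Qed.

Let M_dir g h : M g -> M h -> exists2 k, M k & lat_le g k /\ lat_le h k.
Proof.
move=> [n [i [lam [Hl ->]]]] [m [j [nu [Hn ->]]]].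
pose ij k := match fintype.split k with inl a => i a | inr b => j b end.
pose ln k := match fintype.split k with inl a => lam a | inr b => nu b end.
exists (\big[lat_join/0]_(k < n + m) (ln k *: vec (ij k))).
  exists (n + m)%N, ij, ln; split=> // k; rewrite /ln /ij.
  by case: (fintype.split k) => a; [exact: Hl|exact: Hn].
split; apply: bigjoin_le => [|k]; try exact: bigjoin_ge0.
  have := le_bigjoin (fun k => ln k *: vec (ij k)) (lshift m k).
  by rewrite /ln /ij -[lshift m k]/(unsplit (inl k)) unsplitK.
have := le_bigjoin (fun k => ln k *: vec (ij k)) (rshift n k).
by rewrite /ln /ij -[rshift n k]/(unsplit (inr k)) unsplitK.
Qed.

(** This is convexity of [T], the maximum of the weighted distances being at most 1. *)
Let M_norm g : M g -> `|g| <= K1.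
Proof.
move=> [n [i [lam [Hl ->]]]]; rewrite -[leRHS]mulr1.
have lam0 k : 0 <= lam k by case: (Hl k).
apply: (@le_trans _ _
    (K1 * psum +oo%E lam (fun k => mdist (i k).1 (i k).2))).
  apply: ler_inf_mul; [by case: hT| |exact: psum_ge0].
  by move=> C [C0 HC]; split=> //; exact: (HC n (fun k => (i k).1) (fun k => (i k).2)).
rewrite ler_wpM2l//; apply: bigmax_le => // k _.
by rewrite ger0_norm ?mdist_ge0//; case: (Hl k).
Qed.

Let vec_dom j : exists2 g, M g & lat_le (vec j) (mdist j.1 j.2 *: g).
Proof.
(* The weight is the inverse distance. For coinciding points it is [0^-1 = 0], and [vec j] vanishes
   as well. *)
exists (\big[lat_join/0]_(k < 1) ((mdist j.1 j.2)^-1 *: vec j)).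
  exists 1%N, (fun=> j), (fun=> (mdist j.1 j.2)^-1); split=> // _.
  rewrite invr_ge0 mdist_ge0; split=> //.
  have [->|d0] := eqVneq (mdist j.1 j.2) 0; first by rewrite mulr0.
  by rewrite mulVf.
have [d0|d0] := eqVneq (mdist j.1 j.2) 0.
  rewrite d0 scale0r /vec; case: j d0 => x x' /= /mdist_positivity ->.
  by rewrite subrr lat_abs_pos lat_le_refl.
have := le_bigjoin (fun _ : 'I_1 => (mdist j.1 j.2)^-1 *: vec j) ord0.
by move=> /(lat_le_scale (mdist_ge0 j.1 j.2)); rewrite scalerA mulfV// scale1r.
Qed.

Let e (o : option (X * X)) : E := if o is Some j then vec j else 0.

Let e_ge0 o : lat_le 0 (e o).
Proof. by case: o => [j|]; [exact: lat_abs_ge0|exact: lat_le_refl]. Qed.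

Let I := generated_ideal e setT.

Let sI : lat_subspace I. Proof. exact: generated_ideal_subspace. Qed.

Let I_dom u : I u -> exists c g, [/\ 0 <= c, M g & lat_le u (c *: g)].
Proof.
move=> [g gG [c c0 ug]].
have [b [m [b0 Mm gm]]] : exists b m, [/\ 0 <= b, M m & lat_le g (b *: m)].
  elim: gG => [|o f _ _ [b [m [b0 Mm fm]]]].
    by have [m Mm] := M0; exists 0, m; split=> //; rewrite scale0r lat_le_refl.
  have [a [k [a0 Mk ek]]] : exists a k, [/\ 0 <= a, M k & lat_le (e o) (a *: k)].
    case: o => [j|] /=; first by have [k Mk jk] := vec_dom j;
      exists (mdist j.1 j.2), k; split=> //; exact: mdist_ge0.
    by exists 0, m; split=> //; rewrite scale0r lat_le_refl.
  have [l Ml [kl ml]] := M_dir Mk Mm; exists (a + b), l; split=> //.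
    exact: addr_ge0.
  rewrite scalerDl; apply: lat_le_add.
    exact: lat_trans ek (lat_le_scale a0 kl).
  exact: lat_trans fm (lat_le_scale b0 ml).
exists (c * b), m; split=> //; first exact: mulr_ge0.
rewrite -scalerA; apply: lat_trans (lat_le_scale c0 gm).
exact: lat_trans (lat_le_abs u) ug.
Qed.

Let I_B u v : I u -> I v -> I (u - v).
Proof. by case: sI => A Z _ Iu Iv; apply: (A _ _ Iu); rewrite -scaleN1r; exact: Z. Qed.

Let I_abs u : I u -> I (lat_abs u). Proof. exact: generated_ideal_abs. Qed.

Let base_exists : exists w0, forall x, I (T x - w0).
Proof.
have [[x0 _]|nX] := pselect (exists x : X, True); last first.
  by exists 0 => x; case: nX; exists x.
exists (T x0) => x; exists (e (Some (x, x0))); first exact: generated1.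
exact: ideal_abs_self.
Qed.

Let rho := gauge M.
Let K := gauge_state M I.

Let K_n0 : K !=set0.
Proof.
have I0 : I 0 by exists 0; [exact: generated0|exact: ideal0].
by have [phi Kphi _] := gauge_state_exists M_ge0 M_dir sI I_dom I0; exists phi.
Qed.

(** If [|w| <= c *: g] with [g] in [M], the norm of [w] is at most [c * K1]; then [c] tends to the
    gauge. *)
Let norm_rho w : I w -> `|w| <= K1 * rho (lat_abs w).
Proof.
move=> Iw; rewrite -lat_abs_norm; apply/ler_addgt0Pr => eps eps0.
have d0 : 0 < eps / (K1 + 1) by rewrite divr_gt0// ltr_wpDl.
have [c [g [c0 Mg wg hc]]] := gauge_lt I_dom (I_abs Iw) d0.
apply: le_trans (lat_le_norm (lat_abs_ge0 w) wg) _.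
rewrite normrZ (ger0_norm c0); apply: (@le_trans _ _ (c * K1)).
  by rewrite ler_wpM2l// M_norm.
apply: (@le_trans _ _ ((rho (lat_abs w) + eps / (K1 + 1)) * K1)).
  by rewrite ler_wpM2r// ltW.
rewrite mulrDl mulrC lerD2l -mulrA ler_piMr ?(ltW eps0)// mulrC.
by rewrite ler_pdivrMr ?mul1r ?lerDl// ltr_wpDl.
Qed.

(** With one pair and weight 1, concavity is the Lipschitz property of [S] for the norm of [E]. *)
Let concave v v' : mdist (S v) (S v') <= K2 * `|v - v'|.
Proof.
apply: ler_inf_mul => //; move=> C [C0 HC]; split=> //.
have := HC 1%N (fun=> v) (fun=> v') (fun=> 1) (fun=> ler01).
rewrite /psum /lat_psum !big_ord_recl !big_ord0 mul1r scale1r.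
have -> : lat_join (lat_abs (v - v')) 0 = lat_abs (v - v').
  apply: lat_eq; last exact: lat_joinl.
  by rewrite lat_joinP lat_le_refl lat_abs_ge0.
by rewrite lat_abs_norm (ger0_norm (mdist_ge0 _ _)) (max_idPl (mdist_ge0 _ _)).
Qed.

Theorem factorization_infinite :
  exists (d : measure_display) (Om : measurableType d)
    (mu : {measure set Om -> \bar R}) (Z : set (LspaceType mu p1))
    (T1 : X -> LspaceType mu p1) (S1 : LspaceType mu p1 -> Y),
    [/\ closed_sublattice Z /\ ((+oo%E : \bar R) != +oo%E -> Z = setT),
        forall x, Z (T1 x),
        forall x, S (T x) = S1 (T1 x),
        is_lipschitz_on setT T1 /\ Lip_on setT T1 <= K1 &
        is_lipschitz_on Z S1 /\ Lip_on Z S1 <= K2].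
Proof.
pose mu := @discrete_measure R (E -> R) K.
have K_hom phi : K phi -> lat_hom I phi by case.
have K_norm phi u : K phi -> I u -> `|phi u| <= rho (lat_abs u).
  by move=> Kphi Iu; apply: gauge_state_norm Kphi => //; exact: I_abs.
have K_scale phi u : K phi -> I u -> `|K1 * phi u| <= K1 * rho (lat_abs u).
  by move=> Kphi Iu; rewrite normrM (ger0_norm K1_ge0) ler_wpM2l// K_norm.
(* The factor [K1] goes into the embedding: the gauge of [|T x - T x'|] is at most the distance,
   while the norm is controlled by [K1] times the gauge. The two Lipschitz constants then come out
   as [K1] and [K2]. *)
have /choice[h Hh] : forall u, exists z : LspaceType mu p1, I u ->
    forall phi, K phi -> Lp_fun z phi = K1 * phi u.
  move=> u; have [Iu|nIu] := pselect (I u).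
    have [z hz] := discrete_Lp_of_fun K_n0 p1 (fun phi Kphi => K_scale phi u Kphi Iu).
    by exists z.
  have z0 (phi : E -> R) : K phi -> `|0 : R| <= 0 by rewrite normr0.
  by have [z _] := discrete_Lp_of_fun K_n0 p1 z0; exists z.
have h_diff u v phi : I u -> I v -> K phi ->
    Lp_fun (h u) phi - Lp_fun (h v) phi = K1 * phi (u - v).
  by move=> Iu Iv Kphi; rewrite !Hh// (lat_homB sI (K_hom _ Kphi))// mulrBr.
have dist_h u v : I u -> I v -> mdist (h u) (h v) = K1 * rho (lat_abs (u - v)).
  move=> Iu Iv; have Iuv := I_B Iu Iv; apply/le_anti/andP; split.
    apply: (discrete_dist_le K_n0) => phi Kphi; rewrite h_diff//; exact: K_scale.
  have [phi Kphi phiE] := gauge_state_exists M_ge0 M_dir sI I_dom (I_abs Iuv).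
  have := discrete_dist_ge K_n0 (h u) (h v) Kphi.
  rewrite h_diff// normrM (ger0_norm K1_ge0).
  by rewrite -(lat_hom_abs sI (K_hom _ Kphi))// phiE.
(* The closure of the range of [h], where [S1] is determined by continuity. It is a sublattice
   because the points of [K] are lattice homomorphisms on [I] and [K1] is nonnegative. *)
pose Z : set (LspaceType mu p1) := [set z | forall eps, 0 < eps ->
  exists2 u, I u & mdist z (h u) < eps].
have Zh u : I u -> Z (h u) by move=> Iu eps eps0; exists u => //; rewrite mdistxx.
have I0 : I 0 by exists 0; [exact: generated0|exact: ideal0].
have Z_closed : closed_sublattice Z.
  split.
  - move=> z cz eps eps0; have e2 : 0 < eps / 2 by rewrite divr_gt0.
    have [z' [Zz' zz']] := cz _ (nbhsx_ballx z _ e2).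
    have [u Iu hu] := Zz' _ e2; exists u => //.
    move: zz'; rewrite ballEmdist /= => zz'.
    by apply: le_lt_trans (metric_triangle z z' (h u)) _; lra.
  - by exists (h 0); exact: Zh.
  - move=> a f g k Zf Zg /(discrete_aeP K) kE eps eps0.
    have a1 : 0 < `|a| + 1 by rewrite ltr_wpDl.
    have d0 : 0 < eps / 4 / (`|a| + 1) by rewrite !divr_gt0.
    have e4 : 0 < eps / 4 by rewrite divr_gt0.
    have [u Iu fu] := Zf _ d0; have [v Iv gv] := Zg _ e4.
    have [A Zs _] := sI; have Iau := Zs a _ Iu.
    exists (a *: u + v); first exact: A.
    apply: (@le_lt_trans _ _ (eps / 4 + eps / 4)); last by lra.
    apply: (discrete_dist_le K_n0) => phi Kphi.
    rewrite (kE _ Kphi Logic.I) Hh//; last exact: A.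
    have hphi := K_hom _ Kphi; rewrite (lat_homD hphi)// (lat_homZ hphi)//.
    have := discrete_dist_ge K_n0 f (h u) Kphi.
    have := discrete_dist_ge K_n0 g (h v) Kphi; rewrite !Hh// => gv' fu'.
    have -> : a * Lp_fun f phi + Lp_fun g phi - K1 * (a * phi u + phi v) =
      a * (Lp_fun f phi - K1 * phi u) + (Lp_fun g phi - K1 * phi v) by ring.
    apply: le_trans (ler_normD _ _) _; apply: lerD; last exact: le_trans gv' (ltW gv).
    rewrite normrM; apply: (@le_trans _ _ ((`|a| + 1) * (eps / 4 / (`|a| + 1)))).
      apply: ler_pM => //; first by rewrite lerDl.
      exact: le_trans fu' (ltW fu).
    by rewrite mulrC divfK// gt_eqF.
  - move=> f g k Zf Zg /(discrete_aeP K) kE eps eps0.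
    have e4 : 0 < eps / 4 by rewrite divr_gt0.
    have [u Iu fu] := Zf _ e4; have [v Iv gv] := Zg _ e4.
    have [_ _ J] := sI; exists (lat_join u v); first exact: J.
    apply: (@le_lt_trans _ _ (eps / 4 + eps / 4)); last by lra.
    apply: (discrete_dist_le K_n0) => phi Kphi.
    rewrite (kE _ Kphi Logic.I) Hh//; last exact: J.
    rewrite (lat_homJ (K_hom _ Kphi))// maxr_pMr//.
    have := discrete_dist_ge K_n0 f (h u) Kphi.
    have := discrete_dist_ge K_n0 g (h v) Kphi; rewrite !Hh// => gv' fu'.
    exact: dist_max (le_trans fu' (ltW fu)) (le_trans gv' (ltW gv)).
have [w0 Hw] := base_exists.
have [S1 [S1h S1L]] : exists S1 : LspaceType mu p1 -> Y,
    (forall u, I u -> Z (h u) -> S1 (h u) = S (w0 + u)) /\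
    forall z z', Z z -> Z z' -> mdist (S1 z) (S1 z') <= K2 * mdist z z'.
  apply: lipschitz_extension; [exact: K2_ge0| |by move=> z eps Zz; exact: Zz].
  move=> u v Iu Iv; rewrite dist_h//.
  apply: le_trans (concave _ _) _; rewrite ler_wpM2l//.
  have -> : w0 + u - (w0 + v) = u - v by rewrite opprD addrACA subrr add0r.
  exact/norm_rho/I_B.
exists _, (@discrete_space (E -> R)), mu, Z, (fun x => h (T x - w0)), S1; split.
- by split=> //; rewrite eqxx.
- by move=> x; exact/Zh.
- by move=> x; rewrite (S1h _ (Hw x) (Zh _ (Hw x))) addrC subrK.
- apply: Lip_on_le => [|x x' _ _]; first exact: K1_ge0.
  have TE : T x - w0 - (T x' - w0) = T x - T x' by rewrite opprB addrA subrK.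
  rewrite dist_h// TE ler_wpM2l//; have [g Mg xg] := vec_dom (x, x').
  exact: gauge_le (mdist_ge0 x x') Mg xg.
- by apply: Lip_on_le; [exact: K2_ge0|exact: S1L].
Qed.

End InfiniteExponent.

Theorem theorem4p2 (R : realType) (p : \bar R) (p1 : (1 <= p)%E)
    (X : metricType R) (Y : completeMetricType R) (E : banachLatticeType R)
    (T : X -> E) (S : E -> Y)
    (hT : lipschitz_p_convex p T) (hS : lipschitz_p_concave p S) :
  exists (d : measure_display) (Om : measurableType d)
    (mu : {measure set Om -> \bar R}) (Z : set (LspaceType mu p1))
    (T1 : X -> LspaceType mu p1) (S1 : LspaceType mu p1 -> Y),
    [/\ closed_sublattice Z /\ (p != +oo%E -> Z = setT),
        forall x, Z (T1 x),
        forall x, S (T x) = S1 (T1 x),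
        is_lipschitz_on setT T1 /\ Lip_on setT T1 <= convexity_constant p T &
        is_lipschitz_on Z S1 /\ Lip_on Z S1 <= concavity_constant p S].
Proof.
case: p p1 hT hS => [r| |] p1' hT' hS'; last by have := p1'; rewrite leeNy_eq.
  exact: factorization_finite.
exact: factorization_infinite.
Qed.
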